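(* Let $\theta,\gamma\in[0,1]$, let $X\in\{(R,C)_\theta,(\min(\ell_2),\max(\ell_2))_\theta,(R\cap C,R+C)_\theta\}$ and $Y\in\{(R,C)_\gamma,(\min(\ell_2),\max(\ell_2))_\gamma,(R\cap C,R+C)_\gamma\}$. If there is a completely Lipschitz in small scale embedding $f\colon B_X\to Y$, then $\theta=\gamma$.
   Context: Operator spaces are complex: closed linear subspaces $X\subseteq \mathcal B(H)$ (or given by matrix norms satisfying Ruan's axioms), with $\mathrm M_n(X)$ normed through $\mathrm M_n(X)\subseteq \mathrm M_n(\mathcal B(H))\cong\mathcal B(H^{\oplus n})$. $B_E$ is the closed unit ball of $E$, and $f_n([x_{ij}])=[f(x_{ij})]$. A map $f\colon B_X\to Y$ is a completely Lipschitz in small scale embedding if there is $L\ge1$ such that $\frac1L\|x-y\|_{\mathrm M_n(X)}\le\|f_n(x)-f_n(y)\|_{\mathrm M_n(Y)}\le L\|x-y\|_{\mathrm M_n(X)}$ for all $n\in\mathbb N$ and all $x,y\in B_{\mathrm M_n(X)}$. With $e_{i,j}\in\mathcal B(\ell_2)$ the matrix units, $R=\overline{\rm span}\{e_{1,j}:j\in\mathbb N\}$ and $C=\overline{\rm span}\{e_{i,1}:i\in\mathbb N\}$. $\min(\ell_2)$ and $\max(\ell_2)$ are $\ell_2$ with its minimal and maximal operator space structures: $\|[x_{ij}]\|_{\mathrm M_n(\min(\ell_2))}=\sup\{\|[\varphi(x_{ij})]\|_{\mathrm M_n(\mathbb C)}:\varphi\in B_{\ell_2^*}\}$ and $\|[x_{ij}]\|_{\mathrm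 M_n(\max(\ell_2))}=\sup\{\|[u(x_{ij})]\|_{\mathrm M_n(\mathcal B(H))}: H \text{ a Hilbert space}, u\colon\ell_2\to\mathcal B(H)\text{ linear},\|u\|\le1\}$. With $r\colon\ell_2\to R$, $c\colon\ell_2\to C$ the canonical isometries, $R\cap C$ is $\ell_2$ with the operator space structure given by $x\mapsto(r(x),c(x))\in R\oplus_\infty C$, and $R+C=(R\oplus_1C)/\Delta$ with $\Delta=\{(r(x),-c(x)):x\in\ell_2\}$ (quotient operator space structure of the operator space $\ell_1$-sum). All these spaces are isometric to $\ell_2$ and homogeneous (every bounded linear $u\colon X\to X$ satisfies $\|u\|_{\rm cb}=\|u\|$). For two such spaces $X_0,X_1$, identified as Banach spaces through a linear isometry (the choice is irrelevant), $(X_0,X_1)_\theta$ is the complex interpolation space with the operator space structure $\mathrm M_n((X_0,X_1)_\theta)=(\mathrm M_n(X_0),\mathrm M_n(X_1))_\theta$, with $(X_0,X_1)_0=X_0$ and $(X_0,X_1)_1=X_1$. *)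

(* Defs.v *)
(* The scalars are R[i] for R : realType.                                     *)
(* [sup] and [inf] of MathComp-Analysis are real-valued and return 0 on sets  *)
(* without a supremum or infimum; every set to which they are applied below   *)
(* is nonempty and bounded on the spaces considered (matrices of bounded      *)
(* operators, families of contractions, equivalent norms).                    *)
From HB Require Import structures.
From mathcomp Require Import all_boot all_order all_algebra sesquilinear.
From mathcomp Require Import complex.
From mathcomp Require Import all_classical all_reals all_analysis.
From mathcomp Require Import ring lra.

Set Implicit Arguments.
Unset Strict Implicit.
Unset Printing Implicit Defensive.

Import Order.TTheory GRing.Theory Num.Theory.
Import numFieldNormedType.Exports.
Import Normc.

Local Open Scope classical_set_scope.
Local Open Scope ring_scope.

Section Hilbert.
Variable R : realType.

Definition dot_norm (H : lmodType R[i]) (d : {dot H for Num.conj}) (x : H) : R :=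
  Num.sqrt (complex.Re (d x x)).

(* Inner products are linear in the first variable, conjugate-linear in the *)
(* second one. *)
Record hilbert := Hilbert {
  hilbert_car :> lmodType R[i];
  hdot : {dot hilbert_car for Num.conj};
  hilbert_complete : forall u : nat -> hilbert_car,
    (forall e : R, 0 < e -> exists N : nat, forall m n : nat,
      (N <= m)%N -> (N <= n)%N -> dot_norm hdot (u m - u n) < e) ->
    exists l, dot_norm hdot (u n - l) @[n --> \oo] --> (0 : R)
}.

Definition hnorm (H : hilbert) (x : H) : R := dot_norm (@hdot H) x.

End Hilbert.

Section DotNormTheory.
Variables (R : realType) (H : lmodType R[i]) (d : {dot H for Num.conj}).
Implicit Types x y : H.

Lemma normCE (z : R[i]) : `|z| = (normc z)%:C%C. Proof. by []. Qed.

Lemma normc_ge0 (z : R[i]) : 0 <= normc z.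
Proof. by case: z => ? ?; exact: sqrtr_ge0. Qed.

Lemma dot_self x : d x x = (dot_norm d x ^+ 2)%:C%C.
Proof.
have := @dnorm_ge0 _ _ d x; rewrite /dot_norm.
case: (d x x) => a b; rewrite lecE /= => /andP[/eqP -> a0].
by rewrite sqr_sqrtr.
Qed.

Lemma dot_norm_ge0 x : 0 <= dot_norm d x.
Proof. exact: sqrtr_ge0. Qed.

Lemma dot_normZ (a : R[i]) x : dot_norm d (a *: x) = normc a * dot_norm d x.
Proof.
apply/eqP; rewrite -(@eqrXn2 _ 2) ?mulr_ge0 ?dot_norm_ge0 ?normc_ge0//.
apply/eqP/(@complexI R); rewrite -dot_self dnormZ dot_self normCE -rmorphXn -rmorphM /= exprMn.
by [].
Qed.

Lemma dot_CauchySchwarz x y : normc (d x y) <= dot_norm d x * dot_norm d y.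
Proof.
have [->|y0] := eqVneq y 0.
  by rewrite linear0r normc0 mulr_ge0 ?dot_norm_ge0.
have dy0 : dot_norm d y ^+ 2 != 0.
  have : 0 < d y y by exact: neq0_dnorm_gt0.
  rewrite dot_self => yy0.
  by move: yy0; rewrite lt_def => /andP[+ _]; apply: contraNneq => ->.
set p := dot_norm d x; set q := dot_norm d y.
rewrite -(@ler_pXn2r _ 2)// ?nnegrE ?mulr_ge0 ?dot_norm_ge0 ?normc_ge0//.
pose a := d x y / (q ^+ 2)%:C%C.
have := @dnorm_ge0 _ _ d (x - a *: y).
rewrite dnormB dnormZ linearZr_LR /= !dot_self -/p -/q.
have aE : a^* * d x y = (normc (d x y) ^+ 2 / q ^+ 2)%:C%C.
  rewrite /a rmorphM fmorphV /=.
  rewrite [((_%:C%C) ^* )%R](conjc_real (q ^+ 2)).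
  rewrite mulrAC [(d x y)^* * _]mulrC -normCK normCE -rmorphXn.
  by rewrite -fmorphV -rmorphM.
rewrite aE [((_%:C%C) ^* )%R](conjc_real _).
have -> : `|a| ^+ 2 = (normc (d x y) ^+ 2 / q ^+ 2 / q ^+ 2)%:C%C.
  rewrite normCE -rmorphXn /=; congr (_%:C)%C.
  rewrite /a normcM normcV exprMn exprVn.
  have -> : normc (q ^+ 2)%:C%C = q ^+ 2.
    by rewrite /= expr0n /= addr0 sqrtr_sqr ger0_norm// sqr_ge0.
  by rewrite -mulrA -invfM.
rewrite -!rmorphM -!rmorphD -rmorphN -rmorphD /= lecR.
rewrite mulfVK// opprD addrA addrK subr_ge0 ler_pdivrMr ?exprMn//.
by rewrite exprn_gt0// lt_def dot_norm_ge0 andbT; apply: contraNneq dy0 => q0; rewrite -/q q0 expr0n.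
Qed.

Lemma dot_normD x y : dot_norm d (x + y) <= dot_norm d x + dot_norm d y.
Proof.
rewrite -(@ler_pXn2r _ 2)// ?nnegrE ?addr_ge0 ?dot_norm_ge0// sqrrD.
have := dnormD d x y; rewrite /= !dot_self => /(congr1 (@complex.Re R)).
have := dot_CauchySchwarz x y.
case: (d x y) => a b /= ab ->.
have : a <= Num.sqrt (a ^+ 2 + b ^+ 2).
  by rewrite (le_trans (ler_norm _))// -sqrtr_sqr ler_wsqrtr// lerDl sqr_ge0.
by lra.
Qed.

End DotNormTheory.

Section Ell2.
Variable R : realType.
Implicit Types x y : nat -> R[i].

Definition square_summable x : Prop :=
  cvgn (series (fun k => normc (x k) ^+ 2)).

Definition ell2_pred : {pred nat -> R[i]} := fun x => `[< square_summable x >].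

Lemma ell2_pred_submod : submod_closed ell2_pred.
Proof.
split.
  apply/asboolP; rewrite /square_summable (_ : series _ = fun=> 0).
    exact: is_cvg_cst.
  apply/funext => n; rewrite /series /= big1// => k _.
  by rewrite -[LHS]/(normc 0 ^+ 2) normc0 expr0n.
move=> a x y /asboolP hx /asboolP hy; apply/asboolP.
pose z := (2 * normc a ^+ 2) *: (fun k => normc (x k) ^+ 2) +
          2%:R *: (fun k => normc (y k) ^+ 2) : R^nat.
have zE n : z n = 2 * normc a ^+ 2 * normc (x n) ^+ 2 + 2 * normc (y n) ^+ 2.
  by [].
apply: (@series_le_cvg _ _ z) => [n|n|n|].
- exact: sqr_ge0.
- rewrite zE.
  by apply: addr_ge0; last exact: mulr_ge0 (sqr_ge0 _);
    exact: mulr_ge0 (mulr_ge0 _ (sqr_ge0 _)) (sqr_ge0 _).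
- apply: (@le_trans _ _ ((normc (a * x n) + normc (y n)) ^+ 2)).
    by rewrite ler_pXn2r ?nnegrE ?addr_ge0 ?normc_ge0// le_normcD.
  rewrite normcM zE.
  have := sqr_ge0 (normc a * normc (x n) - normc (y n)); nra.
- by apply: is_cvg_seriesD; exact: is_cvg_seriesZ.
Qed.

HB.instance Definition _ :=
  GRing.isSubmodClosed.Build R[i] (nat -> R[i]) ell2_pred ell2_pred_submod.

Record ell2 := Ell2 {
  ell2_fun :> nat -> R[i];
  ell2_funP : ell2_fun \in ell2_pred
}.

HB.instance Definition _ := [isSub for ell2_fun].
HB.instance Definition _ := [Choice of ell2 by <:].
HB.instance Definition _ := [SubChoice_isSubLmodule of ell2 by <:].


(* Sums of complex series, through their real and imaginary parts. *)
Definition csum (u : nat -> R[i]) : R[i] :=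
  Complex (limn (series (fun k => complex.Re (u k))))
          (limn (series (fun k => complex.Im (u k)))).

Lemma csum_single (u : nat -> R[i]) i :
  (forall k, k != i -> u k = 0) -> csum u = u i.
Proof.
move=> ui; have E (f : R^nat) : (forall k, k != i -> f k = 0) ->
    limn (series f) = f i.
  move=> fi; apply/cvg_lim => //; apply: cvg_near_cst; exists i.+1 => // n /= ni.
  rewrite /series /= (bigD1_seq i) ?mem_index_iota ?iota_uniq//= big1 ?addr0//.
by rewrite /csum !E => [|k /ui->|k /ui->]//; case: (u i).
Qed.

Definition abs_summable (u : nat -> R[i]) : Prop :=
  cvgn (series (fun k => normc (u k))).

Lemma normc_sqr (z : R[i]) :
  normc z ^+ 2 = complex.Re z ^+ 2 + complex.Im z ^+ 2.
Proof. by case: z => a b /=; rewrite sqr_sqrtr// addr_ge0 ?sqr_ge0. Qed.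

Lemma abs_summable_cvg u : abs_summable u ->
  cvgn (series (fun k => complex.Re (u k))) /\
  cvgn (series (fun k => complex.Im (u k))).
Proof.
move=> hu; split; apply: normed_cvg; apply: (series_le_cvg _ _ _ hu) => k //;
  rewrite ?normc_ge0//= -sqrtr_sqr -[leRHS]ger0_norm ?normc_ge0// -[leRHS]sqrtr_sqr;
  by rewrite ler_wsqrtr// normc_sqr ?lerDl ?lerDr sqr_ge0.
Qed.

Lemma csum_linear (a : R[i]) u v : abs_summable u -> abs_summable v ->
  csum (fun k => a * u k + v k) = a * csum u + csum v.
Proof.
move=> /abs_summable_cvg[ur ui] /abs_summable_cvg[vr vi]; case: a => a b.
rewrite /csum; set ru := (fun k => _) in ur *; set iu := (fun k => _) in ui *.
set rv := (fun k => _) in vr *; set iv := (fun k => _) in vi *.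
have -> : (fun k => complex.Re (Complex a b * u k + v k)) =
    a *: ru - b *: iu + rv.
  apply/funext => k.
  rewrite -[RHS]/(a * ru k - b * iu k + rv k) /ru /iu /rv.
  by case: (u k); case: (v k).
have Zcvg c (w : R^nat) : cvgn (series w) -> cvgn (series (c *: w)).
  exact: is_cvg_seriesZ.
have -> : (fun k => complex.Im (Complex a b * u k + v k)) =
    a *: iu + b *: ru + iv.
  apply/funext => k.
  rewrite -[RHS]/(a * iu k + b * ru k + iv k) /ru /iu /iv.
  by case: (u k); case: (v k).
rewrite lim_seriesD//; last by apply: is_cvg_seriesB; exact: Zcvg.
rewrite lim_seriesB; [|exact: Zcvg..].
rewrite lim_seriesD//; last by apply: is_cvg_seriesD; exact: Zcvg.
rewrite lim_seriesD; [|exact: Zcvg..].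
by rewrite !lim_seriesZ.
Qed.

Lemma csum_conj u : abs_summable u ->
  csum (fun k => (u k)^*) = (csum u)^*.
Proof.
move=> /abs_summable_cvg[ur ui]; apply/eqP; rewrite /csum eq_complex /=.
rewrite -lim_seriesN//; apply/andP; split; apply/eqP; congr (limn (series _)).
  by apply/funext => k; case: (u k).
apply/funext => k; rewrite -[RHS]/(- complex.Im (u k)).
by case: (u k).
Qed.

Lemma abs_summableM x y : square_summable x -> square_summable y ->
  abs_summable (fun k => x k * y k).
Proof.
move=> hx hy; have hxy := is_cvg_seriesD hx hy.
apply: (series_le_cvg _ _ _ hxy) => k; rewrite ?normc_ge0//.
  rewrite -[leRHS]/(normc (x k) ^+ 2 + normc (y k) ^+ 2).
  by rewrite addr_ge0 ?sqr_ge0.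
rewrite normcM -[leRHS]/(normc (x k) ^+ 2 + normc (y k) ^+ 2).
have := sqr_ge0 (normc (x k) - normc (y k)).
have := sqr_ge0 (normc (x k)); have := sqr_ge0 (normc (y k)); nra.
Qed.

Lemma normc_conj (z : R[i]) : normc (z^*) = normc z.
Proof. by case: z => a b /=; rewrite sqrrN. Qed.

Lemma square_summableJ x : square_summable x ->
  square_summable (fun k => (x k)^*).
Proof.
rewrite /square_summable => hx; rewrite (_ : (fun k => _) =
  fun k => normc (x k) ^+ 2)//; by apply/funext => k; rewrite normc_conj.
Qed.

Lemma ell2_summable (x : ell2) : square_summable x.
Proof. by have /asboolP := ell2_funP x. Qed.

Definition ell2_dot (x y : ell2) : R[i] := csum (fun k => x k * (y k)^*).

Lemma ell2_dot_summable (x y : ell2) :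
  abs_summable (fun k => x k * (y k)^*).
Proof.
by apply: abs_summableM; [|apply: square_summableJ]; exact: ell2_summable.
Qed.

Lemma ell2_dot_linear (y : ell2) (a : R[i]) (x x' : ell2) :
  ell2_dot (a *: x + x') y = a * ell2_dot x y + ell2_dot x' y.
Proof.
rewrite -csum_linear; [|exact: ell2_dot_summable..].
by congr csum; apply/funext => k; rewrite mulrA -mulrDl.
Qed.

Lemma ell2_dotC (x y : ell2) : ell2_dot x y = (ell2_dot y x)^*.
Proof.
rewrite -csum_conj; last exact: ell2_dot_summable.
by congr csum; apply/funext => k; rewrite [RHS]rmorphM mulrC;
  congr (_ * _); exact/esym/conjCK.
Qed.

Lemma ell2_dotB (y x x' : ell2) :
  ell2_dot (x - x') y = ell2_dot x y - ell2_dot x' y.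
Proof. by rewrite addrC -scaleN1r ell2_dot_linear mulN1r addrC. Qed.

Lemma ell2_dotZ (y : ell2) a (x : ell2) : ell2_dot (a *: x) y = a * ell2_dot x y.
Proof.
have -> : a *: x = a *: x + 0 by rewrite addr0.
by rewrite ell2_dot_linear -(subrr x) ell2_dotB subrr addr0.
Qed.

Lemma ell2_dotBr (x y y' : ell2) :
  ell2_dot x (y - y') = ell2_dot x y - ell2_dot x y'.
Proof. by rewrite !(ell2_dotC x) ell2_dotB; exact: (rmorphB Num.conj). Qed.

Lemma ell2_dotZr (x : ell2) a (y : ell2) : ell2_dot x (a *: y) = a^* * ell2_dot x y.
Proof. by rewrite !(ell2_dotC x) ell2_dotZ; exact: (rmorphM Num.conj). Qed.

HB.instance Definition _ := @isBilinear.Build R[i] ell2 ell2 R[i]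
  *%R (Num.conj \; *%R) ell2_dot ell2_dotB ell2_dotBr
  ell2_dotZ ell2_dotZr.

Lemma ell2_dot_hermitian (x y : ell2) :
  ell2_dot x y = (-1) ^+ false * (ell2_dot y x)^*.
Proof. by rewrite expr0 mul1r ell2_dotC. Qed.

HB.instance Definition _ := @isHermitianSesquilinear.Build R[i] ell2
  false Num.conj ell2_dot ell2_dot_hermitian.

Lemma ell2_dot_self (x : ell2) :
  ell2_dot x x = (limn (series (fun k => normc (x k) ^+ 2)))%:C%C.
Proof.
apply/eqP; rewrite /ell2_dot /csum eq_complex /=; apply/andP; split; apply/eqP.
  congr (limn (series _)); apply/funext => k; rewrite normc_sqr.
  by case: (x k) => a b /=; rewrite mulrN opprK !expr2.
rewrite (_ : series _ = fun=> 0) ?lim_cst//.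
apply/funext => n; rewrite /series /= big1// => k _.
by case: (x k) => a b /=; rewrite mulrN mulrC addNr.
Qed.

Lemma ell2_partial_sum (x : ell2) n :
  \sum_(0 <= k < n) normc (x k) ^+ 2 <=
  limn (series (fun k => normc (x k) ^+ 2)).
Proof.
apply: (@nondecreasing_cvgn_le _ (series _)); last exact: ell2_summable.
by apply: nondecreasing_series => k _ _; exact: sqr_ge0.
Qed.

Lemma ell2_dot_gt0 (x : ell2) : x != 0 -> 0 < ell2_dot x x.
Proof.
move=> x0; rewrite ell2_dot_self ltcR.
have [k xk0] : exists k, x k != 0.
  apply: contrapT => /forallNP xE; move/eqP: x0; apply; apply/val_inj/funext => k.
  by have /negP := xE k; rewrite negbK => /eqP.
apply: (lt_le_trans _ (ell2_partial_sum x k.+1)).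
rewrite big_nat_recr//= ltr_wpDl//.
  by rewrite sumr_ge0// => i _; exact: sqr_ge0.
rewrite exprn_gt0// lt_def normc_ge0 andbT.
by apply: contra xk0 => /eqP/eq0_normc ->.
Qed.

HB.instance Definition _ := @isDotProduct.Build R[i] ell2 ell2_dot ell2_dot_gt0.

Definition ell2_dotp : {dot ell2 for Num.conj} := ell2_dot.

Lemma ell2_norm_sqr (x : ell2) :
  dot_norm ell2_dotp x ^+ 2 = limn (series (fun k => normc (x k) ^+ 2)).
Proof.
by apply: (@complexI R); rewrite -dot_self -[LHS]/(ell2_dot x x) ell2_dot_self.
Qed.

Lemma ell2_norm_ge_sum (x : ell2) n :
  \sum_(0 <= k < n) normc (x k) ^+ 2 <= dot_norm ell2_dotp x ^+ 2.
Proof. by rewrite ell2_norm_sqr; exact: ell2_partial_sum. Qed.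

Lemma ell2_norm_ge_coord (x : ell2) k : normc (x k) <= dot_norm ell2_dotp x.
Proof.
rewrite -(@ler_pXn2r _ 2)// ?nnegrE ?normc_ge0 ?dot_norm_ge0//.
apply: le_trans (ell2_norm_ge_sum x k.+1).
by rewrite big_nat_recr//= lerDr sumr_ge0// => i _; exact: sqr_ge0.
Qed.

Lemma square_summable_bounded x (M : R) :
  (forall n, \sum_(0 <= k < n) normc (x k) ^+ 2 <= M) -> square_summable x.
Proof.
move=> hM; apply: nondecreasing_is_cvgn.
  by apply: nondecreasing_series => k _ _; exact: sqr_ge0.
by exists M => _ [n _ <-]; exact: hM.
Qed.

Lemma real_cauchy_cvg (r : nat -> R) :
  (forall e : R, 0 < e -> exists N, forall m n, (N <= m)%N -> (N <= n)%N ->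
    `|r m - r n| < e) -> cvgn r.
Proof.
move=> hr; apply: cauchy_cvg; apply: cauchy_exP => e /hr[N hN].
by exists (r N); exists N => // n /= Nn; apply: hN.
Qed.

Lemma ell2_complete (u : nat -> ell2) :
  (forall e : R, 0 < e -> exists N : nat, forall m n : nat,
    (N <= m)%N -> (N <= n)%N -> dot_norm ell2_dotp (u m - u n) < e) ->
  exists l, dot_norm ell2_dotp (u n - l) @[n --> \oo] --> (0 : R).
Proof.
move=> hu.
have coordB m n k : (u m - u n) k = u m k - u n k by [].
have reim (z : R[i]) : `|complex.Re z| <= normc z /\ `|complex.Im z| <= normc z.
  by split; rewrite -sqrtr_sqr -[leRHS]ger0_norm ?normc_ge0// -[leRHS]sqrtr_sqr;
    rewrite ler_wsqrtr// normc_sqr ?lerDl ?lerDr sqr_ge0.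
have cvr k : cvgn (fun n => complex.Re (u n k)).
  apply: real_cauchy_cvg => e /hu[N hN]; exists N => m n Nm Nn.
  apply: le_lt_trans (hN m n Nm Nn); apply: le_trans (ell2_norm_ge_coord _ k).
  rewrite coordB; apply: le_trans (reim _).1.
  by case: (u m k); case: (u n k).
have cvi k : cvgn (fun n => complex.Im (u n k)).
  apply: real_cauchy_cvg => e /hu[N hN]; exists N => m n Nm Nn.
  apply: le_lt_trans (hN m n Nm Nn); apply: le_trans (ell2_norm_ge_coord _ k).
  rewrite coordB; apply: le_trans (reim _).2.
  by case: (u m k); case: (u n k).
pose x k := Complex (limn (fun n => complex.Re (u n k)))
                    (limn (fun n => complex.Im (u n k))).
have key (e : R) : 0 < e -> exists N, forall n K, (N <= n)%N ->
    \sum_(0 <= k < K) normc (u n k - x k) ^+ 2 <= e ^+ 2.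
  move=> e0; have [N hN] := hu _ e0; exists N => n K Nn.
  have cv : (\sum_(0 <= k < K) normc (u n k - u m k) ^+ 2) @[m --> \oo] -->
      \sum_(0 <= k < K) normc (u n k - x k) ^+ 2.
    elim: K => [|K IH].
      by under eq_fun do rewrite big_nil; rewrite big_nil; exact: cvg_cst.
    under eq_fun do rewrite big_nat_recr//=.
    rewrite big_nat_recr//=; apply: cvgD => //.
    have E (z w : R[i]) : normc (z - w) ^+ 2 =
        (complex.Re z - complex.Re w) ^+ 2 + (complex.Im z - complex.Im w) ^+ 2.
      by rewrite normc_sqr; case: z => ? ?; case: w.
    under eq_fun do rewrite E.
    have sq (f : R^nat) a b : cvgn f -> b = limn f ->
        (a - f m) ^+ 2 @[m --> \oo] --> (a - b) ^+ 2.
      move=> cf ->; rewrite expr2; under eq_fun do rewrite expr2.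
      by apply: cvgM; apply: cvgB => //; exact: cvg_cst.
    by rewrite E; apply: cvgD; apply: sq.
  rewrite -(cvg_lim _ cv)//; apply: limr_le; first by apply/cvg_ex; eexists; exact: cv.
  exists N => // m /= Nm; apply: le_trans (ell2_norm_ge_sum (u n - u m) K) _.
  by rewrite ler_pXn2r ?nnegrE ?dot_norm_ge0 ?ltW// hN.
have subx n (y : ell2) : (forall k, y k = u n k - x k) ->
    x = ell2_fun (u n - y).
  by move=> yE; apply/funext => k; rewrite -[RHS]/(u n k - y k) yE subKr.
have sqx : square_summable x.
  have [N hN] := key 1 ltr01.
  have hy : square_summable (fun k => u N k - x k).
    by apply: (@square_summable_bounded _ (1 ^+ 2)) => K; exact: hN.
  pose y := Ell2 (asboolT hy).
  have -> : x = ell2_fun (u N - y) by apply: subx.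
  exact: ell2_summable.
exists (Ell2 (asboolT sqx)); apply/cvgrPdist_le => e e0.
have [N hN] := key e e0; exists N => // n /= Nn.
rewrite sub0r normrN ger0_norm ?dot_norm_ge0//.
rewrite -(@ler_pXn2r _ 2)// ?nnegrE ?dot_norm_ge0 ?(ltW e0)// ell2_norm_sqr.
apply: limr_le; first exact: ell2_summable.
by apply: nearW => K; exact: hN.
Qed.

Definition ell2_hilbert : hilbert R := Hilbert ell2_complete.

End Ell2.

Section BoundedOperators.
Variables (R : realType) (H : hilbert R).

Definition bounded_operator (T : H -> H) : Prop :=
  linear T /\ exists M : R, forall x, hnorm (T x) <= M * hnorm x.

Definition bop_pred : {pred H -> H} := fun T => `[< bounded_operator T >].

Lemma bop_pred_submod : submod_closed bop_pred.
Proof.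
split.
  apply/asboolP; split; first by move=> a x y; rewrite scaler0 addr0.
  exists 0 => x; rewrite mul0r -[X in hnorm X](scale0r x).
  by rewrite /hnorm dot_normZ normc0 mul0r.
move=> a S T /asboolP[Slin [M SM]] /asboolP[Tlin [N TN]]; apply/asboolP; split.
  move=> b x y.
  rewrite -[LHS]/(a *: S (b *: x + y) + T (b *: x + y)) Slin Tlin.
  rewrite -[RHS]/(b *: (a *: S x + T x) + (a *: S y + T y)).
  by rewrite !scalerDr !scalerA [b * a]mulrC addrACA.
exists (normc a * M + N) => x; rewrite -[in leLHS]/(a *: S x + T x).
apply: le_trans (dot_normD _ _ _) _; rewrite mulrDl lerD ?TN//.
by rewrite dot_normZ -mulrA ler_wpM2l ?normc_ge0 ?SM.
Qed.

HB.instance Definition _ :=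
  GRing.isSubmodClosed.Build R[i] (H -> H) bop_pred bop_pred_submod.

Record bop := Bop { bop_fun :> H -> H; bop_funP : bop_fun \in bop_pred }.

HB.instance Definition _ := [isSub for bop_fun].
HB.instance Definition _ := [Choice of bop by <:].
HB.instance Definition _ := [SubChoice_isSubLmodule of bop by <:].

Definition bop_norm (T : bop) : R :=
  sup [set hnorm (T x) | x in [set x | hnorm x <= 1]].

(* The norm of the Hilbert space direct sum of n copies of H; with it       *)
(* n x n matrices over B(H) act on H^n, which is M_n(B(H)) = B(H^n).        *)
Definition hcol_norm n (x : 'cV[H]_n) : R :=
  Num.sqrt (\sum_(i < n) hnorm (x i ord0) ^+ 2).

Definition bop_mx_app n (T : 'M[bop]_n) (x : 'cV[H]_n) : 'cV[H]_n :=
  \col_i \sum_(j < n) T i j (x j ord0).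

End BoundedOperators.

Section OperatorSpaces.
Variable R : realType.
Local Notation C := R[i].
Implicit Types (H : hilbert R) (V W : lmodType C).

(* An operator space structure on V is given by its matrix norms, N n being *)
(* the norm of M_n(V). *)
Definition mnorms V := forall n : nat, 'M[V]_n -> R.

Definition bop_mnorm H : mnorms (bop H) := fun n T =>
  sup [set hcol_norm (bop_mx_app T x) | x in [set x : 'cV[H]_n | hcol_norm x <= 1]].

(* The matrix norms making the linear map j a complete isometry onto its    *)
(* range. *)
Definition pullback V W (j : V -> W) (N : mnorms W) : mnorms V :=
  fun n x => N n (map_mx j x).

Definition ccol_norm n (x : 'cV[C]_n) : R :=
  Num.sqrt (\sum_(i < n) normc (x i ord0) ^+ 2).

Definition cmx_norm n (A : 'M[C]_n) : R :=
  sup [set ccol_norm (A *m x) | x in [set x : 'cV[C]_n | ccol_norm x <= 1]].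

(* MIN(V) and MAX(V) for the Banach space norm nV on V. *)
Definition min_mnorm V (nV : V -> R) : mnorms V := fun n x =>
  sup [set cmx_norm (map_mx phi x) |
       phi in [set phi : {scalar V} | forall y, normc (phi y) <= nV y]].

Definition max_mnorm V (nV : V -> R) : mnorms V := fun n x =>
  sup [set t | exists (H : hilbert R) (u : {linear V -> bop H}),
    (forall y, bop_norm (u y) <= nV y) /\ t = bop_mnorm (map_mx u x)].

Definition complete_contraction V H (N : mnorms V) (u : V -> bop H) : Prop :=
  forall n (x : 'M[V]_n), bop_mnorm (map_mx u x) <= N n x.

Definition linf_mnorm V W (NV : mnorms V) (NW : mnorms W) : mnorms (V * W)%type :=
  fun n z => Num.max (NV n (map_mx fst z)) (NW n (map_mx snd z)).

(* The operator space l1-sum: (x, y) has the largest norm of u(x) + v(y)    *)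
(* over all pairs of complete contractions u and v into a common B(H).      *)
Definition l1_mnorm V W (NV : mnorms V) (NW : mnorms W) : mnorms (V * W)%type :=
  fun n z => sup [set t | exists (H : hilbert R)
      (u : {linear V -> bop H}) (v : {linear W -> bop H}),
    [/\ complete_contraction NV u, complete_contraction NW v &
        t = bop_mnorm (map_mx u (map_mx fst z) + map_mx v (map_mx snd z))]].

(* M_n(V / D) = M_n(V) / M_n(D); classes are given by representatives. *)
Definition quotient_mnorm V (N : mnorms V) (D : set V) : mnorms V := fun n x =>
  inf [set N n (x + d) | d in [set d : 'M[V]_n | forall i j, D (d i j)]].

End OperatorSpaces.

(* Calderon's complex method for two norms N0 and N1 on the same vector space  *)
(* V: functions on the closed strip 0 <= Re z <= 1 that are bounded and        *)
(* continuous into V with the norm of X0 + X1, analytic inside, and continuous *)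
(* and vanishing at infinity into (V, Nj) on the line Re z = j. Only the       *)
(* values of F on the strip matter.                                            *)
Section Interpolation.
Variables (R : realType) (V : lmodType R[i]) (N0 N1 : V -> R).
Local Notation C := R[i].

Definition sum_norm (x : V) : R := inf [set N0 y + N1 (x - y) | y in [set: V]].

Definition strip : set C^o := [set z | 0 <= complex.Re z <= 1].

Definition boundary_C0 (N : V -> R) (a : R) (F : C -> V) : Prop :=
  [/\ forall s : R,
        N (F (Complex a t) - F (Complex a s)) @[t --> s] --> (0 : R),
      N (F (Complex a t)) @[t --> +oo] --> (0 : R) &
      N (F (Complex a t)) @[t --> -oo] --> (0 : R)].

Definition calderon_space (F : C -> V) : Prop :=
  [/\ exists M : R, forall z, strip z -> sum_norm (F z) <= M,
      forall z : C^o, strip z ->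
        sum_norm (F w - F z) @[w --> within strip (nbhs z)] --> (0 : R),
      forall z : C, 0 < complex.Re z < 1 -> exists v : V,
        sum_norm (h^-1 *: (F (z + h) - F z) - v) @[h --> (0 : C^o)^'] --> (0 : R),
      boundary_C0 N0 0 F &
      boundary_C0 N1 1 F].

Definition calderon_norm (F : C -> V) : R :=
  Num.max (sup [set N0 (F (Complex 0 t)) | t in [set: R]])
          (sup [set N1 (F (Complex 1 t)) | t in [set: R]]).

Definition interp_norm (theta : R) (x : V) : R :=
  inf [set calderon_norm F |
       F in [set F | calderon_space F /\ F theta%:C%C = x]].

End Interpolation.

Section Mn.
Variables (R : realType) (V : lmodType R[i]) (n : nat).

(* M_n(V) as a complex vector space. *)
Definition Mn : Type := 'M[V]_n.
HB.instance Definition _ := GRing.Zmodule.on Mn.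

Definition Mn_scale (a : R[i]) (x : Mn) : Mn := map_mx (fun v => a *: v) x.

Lemma Mn_scalerA a b x : Mn_scale a (Mn_scale b x) = Mn_scale (a * b) x.
Proof. by apply/matrixP => i j; rewrite !mxE scalerA. Qed.

Lemma Mn_scale1r : left_id 1 Mn_scale.
Proof. by move=> x; apply/matrixP => i j; rewrite !mxE scale1r. Qed.

Lemma Mn_scalerDr : right_distributive Mn_scale +%R.
Proof. by move=> a x y; apply/matrixP => i j; rewrite !mxE scalerDr. Qed.

Lemma Mn_scalerDl x : {morph Mn_scale^~ x : a b / a + b}.
Proof. by move=> a b; apply/matrixP => i j; rewrite !mxE scalerDl. Qed.

HB.instance Definition _ := GRing.Zmodule_isLmodule.Build R[i] Mn
  Mn_scalerA Mn_scale1r Mn_scalerDr Mn_scalerDl.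

End Mn.

(* M_n((X0, X1)_theta) = (M_n(X0), M_n(X1))_theta, for X0 and X1 carried by   *)
(* the same vector space V, with endpoints X0 and X1.                         *)
Definition interp (R : realType) (V : lmodType R[i]) (X0 X1 : mnorms V)
    (theta : R) : mnorms V := fun n x =>
  if theta == 0 then X0 n x else if theta == 1 then X1 n x
  else @interp_norm R (Mn V n) (X0 n) (X1 n) theta x.

(* For maps from the unit ball of X into Y: if X n x <= 1 then the entries  *)
(* of x belong to the unit ball, so the values of f outside are irrelevant. *)
Definition completely_lipschitz_small_scale_embedding (R : realType)
    (V W : lmodType R[i]) (X : mnorms V) (Y : mnorms W) (f : V -> W) : Prop :=
  exists2 L : R, 1 <= L & forall n (x y : 'M[V]_n), X n x <= 1 -> X n y <= 1 ->
    L^-1 * X n (x - y) <= Y n (map_mx f x - map_mx f y) <= L * X n (x - y).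

Section HilbertianSpaces.
Variable R : realType.
Local Notation ell2 := (ell2 R).
Local Notation ell2H := (ell2_hilbert R).

Definition delta_seq (i : nat) : nat -> R[i] := fun k => (k == i)%:R.

Lemma square_summable_delta i : square_summable (delta_seq i).
Proof.
apply: (@square_summable_bounded _ _ 1) => n.
have [ni|ni] := leqP n i.
  rewrite big_nat_cond big1 ?ler01// => k /andP[/andP[_ kn] _].
  by rewrite /delta_seq ltn_eqF ?normc0 ?expr0n// (leq_trans kn).
rewrite (bigD1_seq i) ?mem_index_iota ?iota_uniq//= big1 => [|k ki].
  by rewrite addr0 /delta_seq eqxx normc1 expr1n.
by rewrite /delta_seq (negbTE ki) normc0 expr0n.
Qed.

Definition ell2_basis (i : nat) : ell2 := Ell2 (asboolT (@square_summable_delta i)).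

(* row_op x is the operator sum_k x_k e_{1,k} and col_op x the operator       *)
(* sum_k x_k e_{k,1} on l2 (indices start at 0 here); x |-> row_op x and      *)
(* x |-> col_op x are the canonical isometries of l2 onto R and C.            *)
Definition row_fun (x : ell2) (xi : ell2H) : ell2H :=
  csum (fun k => x k * (xi : ell2) k) *: ell2_basis 0.

Definition col_fun (x : ell2) (xi : ell2H) : ell2H := (xi : ell2) 0%N *: x.

Lemma row_funP x : row_fun x \in @bop_pred R ell2H.
Proof.
apply/asboolP; split.
  move=> a xi eta; rewrite /row_fun scalerA -scalerDl -csum_linear.
  - by congr (csum _ *: _); apply/funext => k; rewrite mulrDr mulrCA.
  - by apply: abs_summableM; exact: ell2_summable.
  - by apply: abs_summableM; exact: ell2_summable.
pose y : ell2 := Ell2 (asboolT (square_summableJ (@ell2_summable _ x))).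
exists (hnorm (y : ell2H) * hnorm (ell2_basis 0 : ell2H)) => xi.
rewrite /row_fun {1}/hnorm dot_normZ mulrAC ler_wpM2r ?dot_norm_ge0//.
rewrite mulrC; apply: le_trans (dot_CauchySchwarz _ _ _).
rewrite -[X in _ <= normc X]/(ell2_dot xi y) /ell2_dot le_eqVlt; apply/orP; left.
apply/eqP; congr (normc (csum _)); apply/funext => k.
by rewrite mulrC; congr (_ * _); exact/esym/conjCK.
Qed.

Lemma col_funP x : col_fun x \in @bop_pred R ell2H.
Proof.
apply/asboolP; split.
  by move=> a xi eta; rewrite /col_fun scalerDl scalerA.
exists (hnorm (x : ell2H)) => xi; rewrite /col_fun {1}/hnorm dot_normZ mulrC.
by rewrite ler_wpM2l ?dot_norm_ge0// ell2_norm_ge_coord.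
Qed.

Definition row_op (x : ell2) : bop ell2H := Bop (row_funP x).
Definition col_op (x : ell2) : bop ell2H := Bop (col_funP x).

Lemma row_op_basis j (xi : ell2) : row_op (ell2_basis j) xi = xi j *: ell2_basis 0.
Proof.
rewrite -[LHS]/(csum (fun k => ell2_basis j k * xi k) *: ell2_basis 0).
rewrite (@csum_single _ _ j) => [|k kj]; rewrite /= /delta_seq ?eqxx ?mul1r//.
by rewrite (negbTE kj) mul0r.
Qed.

Lemma col_op_basis i (xi : ell2) : col_op (ell2_basis i) xi = xi 0%N *: ell2_basis i.
Proof. by []. Qed.

Definition row_space : mnorms ell2 := pullback row_op (@bop_mnorm R ell2H).
Definition col_space : mnorms ell2 := pullback col_op (@bop_mnorm R ell2H).

Definition min_space : mnorms ell2 := min_mnorm (@hnorm R ell2H).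
Definition max_space : mnorms ell2 := max_mnorm (@hnorm R ell2H).

(* row_space, col_space, min_space, max_space, cap_space and plus_space are  *)
(* R, C, min(l2), max(l2), the intersection and the sum of R and C, all      *)
(* carried by l2: R and C through the maps above, the sum through            *)
(* x |-> [(r(x), 0)], whose inverse is [(r(a), c(b))] |-> a + b.             *)
Definition cap_space : mnorms ell2 :=
  pullback (fun x => (x, x)) (linf_mnorm row_space col_space).

Definition antidiagonal : set (ell2 * ell2)%type :=
  [set z | exists x : ell2, z = (x, - x)].

Definition plus_space : mnorms ell2 :=
  pullback (fun x => (x, 0))
    (quotient_mnorm (l1_mnorm row_space col_space) antidiagonal).

End HilbertianSpaces.

Arguments row_space R : clear implicits.
Arguments col_space R : clear implicits.
Arguments min_space R : clear implicits.
Arguments max_space R : clear implicits.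
Arguments cap_space R : clear implicits.
Arguments plus_space R : clear implicits.

(* Main.v *)
(* Say that a matrix norm N on l2 is of order b(m, k) when N is comparable to *)
(* b(m, k) on every almost orthonormal family (v_ij), i < m, j < k, placed in *)
(* the first m rows of a k x k matrix.  The upper estimates are direct; the   *)
(* lower ones come from duality: the functional sum_ij <x_ij, v_ij> is at     *)
(* most mk / b(m, k) times N(x).  The orders are sqrt k for R, sqrt m for C,  *)
(* 1 for min, sqrt (mk) for max and, for m <= k, sqrt k for the intersection  *)
(* and sqrt m for the sum of R and C.  Both estimates interpolate, the upper  *)
(* one by an explicit analytic family and the lower one by the three lines    *)
(* theorem, so that the spaces with parameter theta are of order              *)
(* b0^(1 - theta) b1^theta.                                                   *)
(* The embedding f needs no linearization.  For a small s, the vectors        *)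
(* f(s e_l) form a bounded sequence, so by the pigeonhole principle there are *)
(* disjoint pairs (l, l') for which the differences f(s e_l) - f(s e_l') are  *)
(* almost orthogonal, and their norms are comparable to s.  Applying f to     *)
(* matrices with entries s e_l and s e_l' shows that X and Y have the same    *)
(* order; taking (m, k) = (1, n) and (n, n) gives theta = gamma.              *)
From HB Require Import structures.
Require Import Defs.
From mathcomp Require Import all_boot all_order all_algebra sesquilinear.
From mathcomp Require Import complex.
From mathcomp Require Import all_classical all_reals all_analysis.
From mathcomp Require Import ring lra.

Set Implicit Arguments.
Unset Strict Implicit.
Unset Printing Implicit Defensive.

Import Order.TTheory GRing.Theory Num.Theory.
Import numFieldNormedType.Exports.
Import Normc.

Local Open Scope classical_set_scope.
Local Open Scope ring_scope.

(* [lra] is slow in large contexts. *)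
Ltac olra := repeat match goal with H : _ |- _ =>
    lazymatch type of H with
    | is_true (Order.le _ _) => fail
    | is_true (Order.lt _ _) => fail
    | is_true (andb _ _) => fail
    | _ => clear H
    end
  end; lra.

(** * Goursat's theorem *)

(** The invariant is the size b(m, k) of a matrix norm on almost orthonormal families that fill m
    rows of a k x k matrix. [rect_norm] records it by an upper estimate on such families and a dual
    lower estimate by the pairing with them. For m <= k it is k^((1 - theta)/2) m^(theta/2) for (R,
    C)_theta and for the interpolation between intersection and sum, and (mk)^(theta/2) for (min,
    max)_theta.

    An embedding preserves this order up to a constant independent of m and k
    ([embedding_comparison]). On 1 x 1 matrices it makes f bi-Lipschitz near 0 for the Hilbert norm.
    The vectors f(s e_l) form a bounded sequence, so differences over disjoint pairs of indices can
    be chosen almost orthogonal ([near_orthogonal_pairs]). Two matrices with entries s e_l and s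
    e_l' then have as difference a test family for X, while their images have as difference a test
    family for Y, both of scale s; the scale cancels when the two-sided estimates are compared.

    At the sizes (1, n^2) and (n^2, n^2) the orders are powers of n, with exponents (1 - theta, 1)
    for the first kind of space and (theta, 2 theta) for the second. Equality of exponents gives
    theta = gamma within a kind, and theta = gamma = 1/2 across kinds.

    For the interpolated norms the upper estimate uses the extremal function [interp_fun]. The lower
    one applies [three_lines] to the scalar function z |-> pairing (F z) v for an arbitrary
    competitor F. The Gaussian factors cost [expR 1], a harmless constant. The three lines theorem
    rests on the maximum modulus principle, which is deduced from Goursat's theorem for rectangles
    ([div_free_flux]) through the complex exponential. *)

Section Goursat.
Variable R : realType.
Implicit Types (a b c d x y e : R) (f g : R -> R).

(** Goursat's subdivision as an induction principle: if [T] failed on the large rectangle, it would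
    fail on one of the four quarters, and so on; the failing rectangles shrink to a point, where the
    local hypothesis contradicts them. *)
Lemma rectangle_bisection (T : R -> R -> R -> R -> Prop) a0 b0 c0 d0 :
  a0 <= b0 -> c0 <= d0 ->
  (forall a b c d, a0 <= a -> a <= b -> b <= b0 -> c0 <= c -> c <= d -> d <= d0 ->
    T a ((a + b) / 2) c ((c + d) / 2) -> T ((a + b) / 2) b c ((c + d) / 2) ->
    T a ((a + b) / 2) ((c + d) / 2) d -> T ((a + b) / 2) b ((c + d) / 2) d ->
    T a b c d) ->
  (forall x y, a0 <= x <= b0 -> c0 <= y <= d0 -> exists2 e, 0 < e &
    forall a b c d, a0 <= a -> a <= x <= b -> b <= b0 ->
      c0 <= c -> c <= y <= d -> d <= d0 ->
      b - a < e -> d - c < e -> T a b c d) ->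
  T a0 b0 c0 d0.
Proof.
move=> ab cd merge loc; apply: contrapT => nT.
pose rect := (R * R * (R * R))%type.
pose ok (q : rect) := ([/\ a0 <= q.1.1, q.1.1 <= q.1.2 & q.1.2 <= b0] /\
  [/\ c0 <= q.2.1, q.2.1 <= q.2.2 & q.2.2 <= d0]) /\ ~ T q.1.1 q.1.2 q.2.1 q.2.2.
pose sub (q q' : rect) :=
  ([/\ q.1.1 <= q'.1.1, q'.1.2 <= q.1.2 & q'.1.2 - q'.1.1 = (q.1.2 - q.1.1) / 2] /\
  [/\ q.2.1 <= q'.2.1, q'.2.2 <= q.2.2 & q'.2.2 - q'.2.1 = (q.2.2 - q.2.1) / 2]).
have next (q : {q | ok q}) : {q' : {q | ok q} | sub (sval q) (sval q')}.
  apply: cid; case: q => [[[a b] [c d]] okq].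
  have [[[/= h1 h2 h3] [h4 h5 h6]] h7] := okq.
  apply: contrapT => /forallNP no; apply: h7.
  have H q' : sub (a, b, (c, d)) q' -> T q'.1.1 q'.1.2 q'.2.1 q'.2.2.
    move=> sq; apply: contrapT => nTq.
    have okq' : ok q'.
      by move: sq => [[/= s1 s2 s3] [s4 s5 s6]]; split; last exact: nTq; clear -s1 s2 s3 s4 s5 s6 h1 h2 h3 h4 h5 h6; split; split; lra.
    exact: (no (exist _ q' okq')).
  apply: merge => //.
  - by apply: (H (a, (a + b) / 2, (c, (c + d) / 2))); split; split=> /=; olra.
  - by apply: (H ((a + b) / 2, b, (c, (c + d) / 2))); split; split=> /=; olra.
  - by apply: (H (a, (a + b) / 2, ((c + d) / 2, d))); split; split=> /=; olra.
  - by apply: (H ((a + b) / 2, b, ((c + d) / 2, d))); split; split=> /=; olra.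
have ok0 : ok (a0, b0, (c0, d0)) by split => //; split; split.
pose u n : rect := sval (iter n (fun q => sval (next q)) (exist _ _ ok0)).
have okn n : ok (u n) by rewrite /u; case: (iter _ _ _).
have subn n : sub (u n) (u n.+1).
  by rewrite /u iterS; exact: (svalP (next _)).
(* Nested intervals, used once for each coordinate: the supremum of the left ends is the common
   point, and the widths are geometric of ratio 1/2. *)
have nested (l r : nat -> R) : (forall n, l n <= r n) ->
    (forall n, [/\ l n <= l n.+1, r n.+1 <= r n &
      r n.+1 - l n.+1 = (r n - l n) / 2]) ->
    exists2 x, (forall n, l n <= x <= r n) &
      forall e, 0 < e -> exists N, forall n, (N <= n)%N -> r n - l n < e.
  move=> lr st.
  have ml : {homo l : m n / (m <= n)%N >-> m <= n}.
    by apply: homo_leq => [//|y x z|n]; [exact: le_trans|case: (st n)].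
  have mr : {homo r : m n / (m <= n)%N >-> n <= m}.
    by apply: homo_leq => [//|y x z|n];
      [move=> h1 h2; exact: le_trans h2 h1|case: (st n)].
  have lrmn m n : l m <= r n.
    have := ml _ _ (leq_maxl m n); have := mr _ _ (leq_maxr m n).
    have := lr (maxn m n); olra.
  exists (sup (range l)).
    move=> n; apply/andP; split.
      by apply: ub_le_sup; [exists (r 0%N) => _ [m _ <-]|exists n].
    by apply: ge_sup; [exists (l 0%N), 0%N|move=> _ [m _ <-]].
  have wE n : r n - l n = (r 0%N - l 0%N) / 2 ^+ n.
    elim: n => [|n IH]; first by rewrite expr0 divr1.
    by case: (st n) => _ _ ->; rewrite IH exprS invfM [2^-1 * _]mulrC mulrA.
  move=> e e0; have /cvgrPdist_lt/(_ e e0)[N _ hN] := @cvg_geometric R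
    (r 0%N - l 0%N) 2^-1 ltac:(by rewrite ger0_norm ?invr_ge0//; olra).
  exists N => n Nn; apply: le_lt_trans (ler_norm _) _.
  by have := hN n Nn; rewrite /= sub0r normrN /geometric /= exprVn -wE.
have [x hx wx] := @nested (fun n => (u n).1.1) (fun n => (u n).1.2)
  (fun n => ltac:(by case: (okn n) => -[[]])) (fun n => (subn n).1).
have [y hy wy] := @nested (fun n => (u n).2.1) (fun n => (u n).2.2)
  (fun n => ltac:(by case: (okn n) => -[_ []])) (fun n => (subn n).2).
have [e e0 he] := loc x y (hx 0%N) (hy 0%N).
have [N hN] := wx e e0; have [N' hN'] := wy e e0.
pose M := maxn N N'.
have [[[h1 h2 h3] [h4 h5 h6]]] := okn M; apply.
by apply: he => //; [apply: hN; exact: leq_maxl|apply: hN'; exact: leq_maxr].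
Qed.

Local Notation mu := (@lebesgue_measure R).
Definition itg a b f : R := \int[mu]_(x in `[a, b]) f x.
Definition continuous_on a b f :=
  forall x, a <= x <= b -> {for x, continuous f}.

Lemma continuous_on_integrable a b f : continuous_on a b f ->
  mu.-integrable `[a, b] (EFin \o f).
Proof.
move=> cf; apply: continuous_compact_integrable; first exact: segment_compact.
by apply: continuous_in_subspaceT => x /set_mem /=; rewrite in_itv/=; exact: cf.
Qed.

Lemma continuous_onB a b f g : continuous_on a b f -> continuous_on a b g ->
  continuous_on a b (fun x => f x - g x).
Proof. by move=> cf cg x xab; apply: cvgB; [exact: cf|exact: cg]. Qed.

Lemma itgB a b f g : continuous_on a b f -> continuous_on a b g ->
  itg a b (fun x => f x - g x) = itg a b f - itg a b g.
Proof. by move=> cf cg; rewrite /itg RintegralB//; exact: continuous_on_integrable. Qed.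

Lemma itg_split a b c f : a <= c -> c <= b -> continuous_on a b f ->
  itg a b f = itg a c f + itg c b f.
Proof.
move=> ac cb cf; rewrite /itg addrC; apply/eqP; rewrite -subr_eq; apply/eqP.
rewrite Rintegral_itvB ?bnd_simp//; last exact: continuous_on_integrable.
apply: Rintegral_itv_obnd_cbnd; apply: integrableS (continuous_on_integrable cf) => //.
by apply: subset_itv; rewrite bnd_simp.
Qed.

Lemma itg_bound a b f (k M : R) : a <= b -> continuous_on a b f ->
  (forall x, a <= x <= b -> `|f x - k| <= M) ->
  `|itg a b f - k * (b - a)| <= M * (b - a).
Proof.
move=> ab cf fM.
have cst (r : R) : itg a b (fun=> r) = r * (b - a).
  by rewrite /itg Rintegral_cst//= lebesgue_measure_itv/= lte_fin;
    case: ltP => [//|ba]; rewrite (@le_anti _ _ a b) ?ab// subrr.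
have ccst (r : R) : continuous_on a b (fun=> r) by move=> x _; exact: cst_continuous.
rewrite -cst -itgB// -cst; apply: le_trans (le_normr_Rintegral _ _) _ => //.
  by apply: continuous_on_integrable; exact: continuous_onB.
apply: le_Rintegral => //.
- apply: continuous_on_integrable => x xab; apply: cvg_norm.
  by apply: cvgB; [exact: cf|exact: cvg_cst].
- exact: continuous_on_integrable.
Qed.

(* P and -S are the components of a divergence-free field, differentiable     *)
(* at (x, y).                                                                 *)
Definition div_free (P S : R -> R -> R) x y : Prop :=
  exists p q s : R, forall e, 0 < e -> exists2 dl, 0 < dl & forall x' y',
    `|x' - x| < dl -> `|y' - y| < dl ->
    `|P x' y' - P x y - p * (x' - x) - q * (y' - y)| <= e * (`|x' - x| + `|y' - y|) /\
    `|S x' y' - S x y - s * (x' - x) - p * (y' - y)| <= e * (`|x' - x| + `|y' - y|).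

Lemma for_continuous_ed f y :
  (forall e, 0 < e -> exists2 dl, 0 < dl &
    forall z, `|z - y| < dl -> `|f z - f y| <= e) -> {for y, continuous f}.
Proof.
move=> h; apply/cvgrPdist_le => e /h[dl dl0 hd]; apply/nbhs_ballP; exists dl => // z.
by rewrite /ball/= distrC => /hd; rewrite distrC.
Qed.

(** These are the two partial continuities that the flux uses: [P] is integrated along vertical
    sides and [S] along horizontal ones. *)
Lemma div_free_continuous P S x y : div_free P S x y ->
  {for y, continuous (P x)} /\ {for x, continuous (S ^~ y)}.
Proof.
move=> [p [q [s h]]].
have key (f : R -> R) (k w : R) :
    (exists2 dl, 0 < dl & forall z, `|z - w| < dl ->
       `|f z - f w - k * (z - w)| <= `|z - w|) -> {for w, continuous f}.
  move=> [dl dl0 hd]; apply: for_continuous_ed => e e0.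
  have k0 : 0 < 1 + `|k| by have := normr_ge0 k; olra.
  exists (Num.min dl (e / (1 + `|k|))) => [|z].
    by rewrite lt_min dl0 divr_gt0.
  rewrite lt_min => /andP[/hd h1 h2].
  have -> : f z - f w = (f z - f w - k * (z - w)) + k * (z - w) by ring.
  apply: le_trans (ler_normD _ _) _; rewrite normrM.
  apply: (@le_trans _ _ ((1 + `|k|) * `|z - w|)); first by rewrite mulrDl mul1r lerD2r.
  by rewrite mulrC -ler_pdivlMr// ltW.
have [dl dl0 hd] := h 1 ltr01.
split; [apply: (key _ q)|apply: (key _ s)]; exists dl => // z hz.
  have [] := hd x z ltac:(by rewrite subrr normr0) hz.
  by rewrite subrr mulr0 subr0 normr0 add0r mul1r.
have [_] := hd z y hz ltac:(by rewrite subrr normr0).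
by rewrite subrr mulr0 subr0 normr0 addr0 mul1r.
Qed.

(** The net flux is additive under subdivision, and on a small rectangle the affine parts of [P] and
    [S] cancel, so that it is at most [e] times the square of the half-perimeter. Bisection carries
    this bound to the whole rectangle, for every [e]. *)
Lemma div_free_flux P S a b c d : a <= b -> c <= d ->
  (forall x y, a <= x <= b -> c <= y <= d -> div_free P S x y) ->
  itg c d (fun y => P b y - P a y) = itg a b (fun x => S x d - S x c).
Proof.
move=> ab cd df.
pose flux a b c d :=
  itg c d (fun y => P b y - P a y) - itg a b (fun x => S x d - S x c).
have cP x a' b' : a <= x <= b -> c <= a' -> b' <= d -> continuous_on a' b' (P x).
  move=> xab h1 h2 y /andP[y1 y2]; apply: (div_free_continuous (df x y xab _)).1.
  by apply/andP; split; olra.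
have cS y a' b' : c <= y <= d -> a <= a' -> b' <= b -> continuous_on a' b' (S ^~ y).
  move=> ycd h1 h2 x /andP[x1 x2]; apply: (div_free_continuous (df x y _ ycd)).2.
  by apply/andP; split; olra.
suff H e : 0 < e -> `|flux a b c d| <= e * ((b - a) + (d - c)) ^+ 2.
  apply/eqP; rewrite -subr_eq0 -normr_le0; apply/ler_addgt0Pl => e e0.
  have w0 : 0 < ((b - a) + (d - c)) ^+ 2 + 1 by rewrite ltr_wpDl// sqr_ge0.
  apply: le_trans (H (e / (((b - a) + (d - c)) ^+ 2 + 1)) _) _.
    by rewrite divr_gt0.
  by rewrite addr0 -mulrA ger_pMr// mulrC ler_pdivrMr// mul1r lerDl.
move=> e0.
apply: (@rectangle_bisection (fun a b c d =>
  `|flux a b c d| <= e * ((b - a) + (d - c)) ^+ 2)) => //.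
- move=> a' b' c' d' h1 h2 h3 h4 h5 h6.
  set x := (a' + b') / 2; set y := (c' + d') / 2.
  have -> : flux a' b' c' d' = flux a' x c' y + flux x b' c' y +
      flux a' x y d' + flux x b' y d'.
    have [hx1 hx2 hy1 hy2] : [/\ a' <= x, x <= b', c' <= y & y <= d'].
      by rewrite /x /y; split; olra.
    rewrite /flux !itgB; try by (apply: cP || apply: cS);
      (by olra || by apply/andP; split; olra).
    rewrite (@itg_split c' d' y (P b'))// ?(@itg_split c' d' y (P a'))//
      ?(@itg_split a' b' x (S ^~ d'))// ?(@itg_split a' b' x (S ^~ c'))//; last first.
    all: try by (apply: cP || apply: cS);
      (by olra || by apply/andP; split; olra).
    ring.
  move=> q1 q2 q3 q4.
  apply: le_trans (ler_normD _ _) _; apply: le_trans (lerD (ler_normD _ _) q4) _.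
  apply: le_trans (lerD (lerD (ler_normD _ _) q3) (lexx _)) _.
  apply: le_trans (lerD (lerD (lerD q1 q2) (lexx _)) (lexx _)) _.
  (* A quarter has half the half-perimeter, hence a quarter of the bound: the four bounds add up
     exactly. *)
  rewrite le_eqVlt; apply/orP; left; apply/eqP; by rewrite /x /y; field.
- move=> x y xab ycd; have [p [q [s h]]] := df x y xab ycd.
  have e20 : 0 < e / 2 by rewrite divr_gt0.
  have [dl dl0 hd] := h _ e20.
  exists dl => // a' b' c' d' h1 h2 h3 h4 h5 h6 w1 w2.
  have /andP[x1 x2] := h2; have /andP[y1 y2] := h5.
  have bnd z w : a' <= z <= b' -> c' <= w <= d' ->
      [/\ `|z - x| < dl, `|w - y| < dl &
        `|z - x| + `|w - y| <= (b' - a') + (d' - c')].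
    move=> /andP[z1 z2] /andP[v1 v2].
    have hz : `|z - x| <= b' - a' by rewrite ler_norml; apply/andP; split; olra.
    have hw : `|w - y| <= d' - c' by rewrite ler_norml; apply/andP; split; olra.
    by split; [apply: le_lt_trans w1|apply: le_lt_trans w2|exact: lerD].
  set W := (b' - a') + (d' - c').
  have bP z w : a' <= z <= b' -> c' <= w <= d' ->
      `|P z w - P x y - p * (z - x) - q * (w - y)| <= e / 2 * W /\
      `|S z w - S x y - s * (z - x) - p * (w - y)| <= e / 2 * W.
    move=> hz hw; have [d1 d2 d3] := bnd z w hz hw; have [g1 g2] := hd z w d1 d2.
    by split; [apply: le_trans g1 _|apply: le_trans g2 _];
      rewrite ler_wpM2l// divr_ge0// ltW.
  have ia : a' <= a' <= b' by apply/andP; split; olra.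
  have ib : a' <= b' <= b' by apply/andP; split; olra.
  have ic : c' <= c' <= d' by apply/andP; split; olra.
  have id : c' <= d' <= d' by apply/andP; split; olra.
  have f1 : `|itg c' d' (fun y => P b' y - P a' y) - (p * (b' - a')) * (d' - c')|
      <= e * W * (d' - c').
    apply: itg_bound; first by olra.
      by apply: continuous_onB; apply: cP; (by olra || by apply/andP; split; olra).
    move=> w hw; have [k1 _] := bP b' w ib hw; have [k2 _] := bP a' w ia hw.
    have -> : P b' w - P a' w - p * (b' - a') =
      (P b' w - P x y - p * (b' - x) - q * (w - y)) -
      (P a' w - P x y - p * (a' - x) - q * (w - y)) by ring.
    apply: le_trans (ler_normB _ _) _; apply: le_trans (lerD k1 k2) _.
    by rewrite -mulrDl -splitr.
  have f2 : `|itg a' b' (fun x => S x d' - S x c') - (p * (d' - c')) * (b' - a')|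
      <= e * W * (b' - a').
    apply: itg_bound; first by olra.
      by apply: continuous_onB; apply: cS; (by olra || by apply/andP; split; olra).
    move=> z hz; have [_ k1] := bP z d' hz id; have [_ k2] := bP z c' hz ic.
    have -> : S z d' - S z c' - p * (d' - c') =
      (S z d' - S x y - s * (z - x) - p * (d' - y)) -
      (S z c' - S x y - s * (z - x) - p * (c' - y)) by ring.
    apply: le_trans (ler_normB _ _) _; apply: le_trans (lerD k1 k2) _.
    by rewrite -mulrDl -splitr.
  rewrite /flux; set A := itg _ _ _ in f1 *; set B := itg _ _ _ in f2 *.
  (* The coefficient [p] is shared by [P] in the first variable and [S] in the second, so the main
     terms cancel. *)
  have -> : A - B = (A - p * (b' - a') * (d' - c')) - (B - p * (d' - c') * (b' - a')).
    by ring.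
  apply: le_trans (ler_normB _ _) _; apply: le_trans (lerD f1 f2) _.
  by rewrite le_eqVlt; apply/orP; left; apply/eqP; rewrite /W; ring.
Qed.

End Goursat.

(** * Complex differentiability *)

Section ComplexCalculus.
Variable R : realType.
Local Notation C := R[i].
Implicit Types (z w h l : C) (f g : C -> C) (e : R).

Lemma normcD z w : normc (z + w) <= normc z + normc w.
Proof. exact: le_normcD. Qed.

Lemma normcNE z : normc (- z) = normc z.
Proof. by case: z => a b /=; rewrite !sqrrN. Qed.

Lemma normcBC z w : normc (z - w) = normc (w - z).
Proof. by rewrite -normcNE opprB. Qed.

Lemma normc_Re z : `|complex.Re z| <= normc z.
Proof.
by rewrite -sqrtr_sqr -[leRHS]ger0_norm ?normc_ge0// -[leRHS]sqrtr_sqr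
  ler_wsqrtr// normc_sqr lerDl sqr_ge0.
Qed.

Lemma normc_Im z : `|complex.Im z| <= normc z.
Proof.
by rewrite -sqrtr_sqr -[leRHS]ger0_norm ?normc_ge0// -[leRHS]sqrtr_sqr
  ler_wsqrtr// normc_sqr lerDr sqr_ge0.
Qed.

Lemma normc_le z : normc z <= `|complex.Re z| + `|complex.Im z|.
Proof.
rewrite -(@ler_pXn2r _ 2)// ?nnegrE ?addr_ge0 ?normr_ge0 ?normc_ge0//.
rewrite normc_sqr sqrrD !real_normK ?num_real// lerD2r lerDl.
by rewrite mulrn_wge0// mulr_ge0.
Qed.

Lemma normc_real (a : R) : normc a%:C%C = `|a|.
Proof. by rewrite /= expr0n addr0 sqrtr_sqr. Qed.

Lemma nbhs_normcP (z : C^o) (A : set C) :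
  nbhs z A <-> exists2 e, 0 < e & forall w, normc (w - z) < e -> A w.
Proof.
split=> [/nbhs_ballP[e /= e0 eA]|[e e0 eA]].
  have er : e = (complex.Re e)%:C%C.
    by move: e0; case: (e) => a b; rewrite ltcE /= => /andP[/eqP -> _].
  exists (complex.Re e) => [|w we]; first by move: e0; rewrite {1}er ltcR.
  apply: eA; rewrite /ball/= normCE er ltcR normcBC.
  by [].
apply/nbhs_ballP; exists e%:C%C => /=; first by rewrite ltcR.
by move=> w; rewrite /ball/= normCE ltcR normcBC; exact: eA.
Qed.

Definition ccont f z : Prop := {for (z : C^o), continuous (f : C^o -> C^o)}.

Lemma ccontP f z : ccont f z <-> forall e, 0 < e -> exists2 dl, 0 < dl &
  forall w, normc (w - z) < dl -> normc (f w - f z) < e.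
Proof.
split=> [cf e e0|h].
  have /cf : nbhs (f z : C^o) [set w | normc (w - f z) < e].
    by apply/nbhs_normcP; exists e.
  by move=> /nbhs_normcP[dl dl0 hd]; exists dl.
move=> A /nbhs_normcP[e e0 eA]; have [dl dl0 hd] := h e e0.
by apply/nbhs_normcP; exists dl => // w /hd; exact: eA.
Qed.

Lemma ccont_cst (k : C) z : ccont (fun=> k) z.
Proof. by apply/ccontP => e e0; exists 1 => // w _; rewrite subrr normc0. Qed.

Lemma ccont_id z : ccont id z.
Proof. by apply/ccontP => e e0; exists e. Qed.

Lemma ccontD f g z : ccont f z -> ccont g z -> ccont (fun w => f w + g w) z.
Proof. by move=> cf cg; exact: (continuousD cf cg). Qed.

Lemma ccontM f g z : ccont f z -> ccont g z -> ccont (fun w => f w * g w) z.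
Proof. by move=> cf cg; exact: (continuousM cf cg). Qed.

Lemma ccont_comp f g z : ccont g z -> ccont f (g z) -> ccont (f \o g) z.
Proof.
move=> /ccontP cg /ccontP cf; apply/ccontP => e /cf[d /cg[d' d'0 hg] hf].
by exists d' => // w /hg; exact: hf.
Qed.

(* Caratheodory's form of complex differentiability. *)
Definition cdiff f z :=
  exists2 phi : C -> C, ccont phi z & forall w, f w = f z + phi w * (w - z).

Lemma cdiffP f z l :
  (forall e, 0 < e -> exists2 dl, 0 < dl & forall w, normc (w - z) < dl ->
    normc (f w - f z - l * (w - z)) <= e * normc (w - z)) -> cdiff f z.
Proof.
move=> h; pose phi w := if w == z then l else (f w - f z) / (w - z).
exists phi => [|w]; last first.
  rewrite /phi; case: eqVneq => [->|wz]; first by rewrite subrr mulr0 addr0.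
  by rewrite divfK ?subr_eq0// addrC subrK.
apply/ccontP => e e0; have [dl dl0 hd] := h (e / 2) (divr_gt0 e0 (ltr0n _ 2)).
exists dl => // w wz; rewrite /phi eqxx; case: eqVneq => [_|nwz].
  by rewrite subrr normc0.
have wz0 : w - z != 0 by rewrite subr_eq0.
have nz : 0 < normc (w - z).
  by rewrite lt_def normc_ge0 andbT; apply: contra wz0 => /eqP/eq0_normc ->.
have -> : (f w - f z) / (w - z) - l = (f w - f z - l * (w - z)) / (w - z).
  by rewrite [RHS]mulrBl mulfK.
rewrite normcM normcV; apply: (@le_lt_trans _ _ (e / 2)).
  by rewrite ler_pdivrMr// hd.
by rewrite ltr_pdivrMr// ltr_pMr// ltr1n.
Qed.

Lemma cdiff_continuous f z : cdiff f z -> ccont f z.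
Proof.
move=> [phi cphi fE]; rewrite (_ : f = fun w => f z + phi w * (w + - z)); last exact/funext.
have H := ccontD (@ccont_cst (f z) z) (ccontM cphi (ccontD (@ccont_id z) (@ccont_cst (- z) z))); refine H.
Qed.

Lemma cdiff_approx f z : cdiff f z -> exists l, forall e, 0 < e ->
  exists2 dl, 0 < dl & forall w, normc (w - z) < dl ->
    normc (f w - f z - l * (w - z)) <= e * normc (w - z).
Proof.
move=> [phi /ccontP cphi fE]; exists (phi z) => e e0.
have [dl dl0 hd] := cphi e e0; exists dl => // w wz.
by rewrite fE [f z + _]addrC addrK -mulrBl normcM ler_wpM2r ?normc_ge0// ltW ?hd.
Qed.

Lemma cdiff_cst (k : C) z : cdiff (fun=> k) z.
Proof. by exists (fun=> 0) => [|w]; [exact: ccont_cst|rewrite mul0r addr0]. Qed.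

Lemma cdiff_id z : cdiff id z.
Proof. by exists (fun=> 1) => [|w]; [exact: ccont_cst|rewrite mul1r addrC subrK]. Qed.

Lemma cdiffD f g z : cdiff f z -> cdiff g z -> cdiff (fun w => f w + g w) z.
Proof.
move=> [p cp fE] [q cq gE]; exists (fun w => p w + q w); first exact: ccontD.
by move=> w; rewrite {1}fE {1}gE; ring.
Qed.

Lemma cdiffM f g z : cdiff f z -> cdiff g z -> cdiff (fun w => f w * g w) z.
Proof.
move=> df dg; have cg := cdiff_continuous dg; move: df dg => [p cp fE] [q cq gE].
exists (fun w => p w * g w + f z * q w).
  have H := ccontD (ccontM cp cg) (ccontM (@ccont_cst (f z) z) cq); refine H.
move=> w; transitivity (f z * (g z + q w * (w - z)) + p w * (w - z) * g w).
  by rewrite -gE {1}fE mulrDl.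
by ring.
Qed.

Lemma cdiff_comp f g z : cdiff g z -> cdiff f (g z) -> cdiff (f \o g) z.
Proof.
move=> dg; have cg := cdiff_continuous dg; move: dg => [q cq gE] [p cp fE].
exists (fun w => p (g w) * q w).
  exact: (@ccontM (p \o g) q z (ccont_comp cg cp) cq).
move=> w /=; rewrite fE; have -> : g w - g z = q w * (w - z) by rewrite gE [g z + _]addrC addrK.
by rewrite mulrA.
Qed.

Definition cexp z : C :=
  Complex (expR (complex.Re z) * cos (complex.Im z))
          (expR (complex.Re z) * sin (complex.Im z)).

Lemma normc_cexp z : normc (cexp z) = expR (complex.Re z).
Proof.
rewrite /= !exprMn -mulrDr cos2Dsin2 mulr1 sqrtr_sqr ger0_norm// expR_ge0.
Qed.

Lemma cexpD z w : cexp (z + w) = cexp z * cexp w.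
Proof.
case: z w => a b [c d]; rewrite /cexp /= expRD cosD sinD.
by apply/eqP; rewrite eq_complex /=; apply/andP; split; apply/eqP; ring.
Qed.

Lemma derive_approx (u : R -> R) (x l : R) : is_derive x 1 u l ->
  forall e, 0 < e -> exists2 dl, 0 < dl & forall t, `|t| < dl ->
    `|u (t + x) - u x - l * t| <= e * `|t|.
Proof.
move=> [du <-] e e0; move/cvgrPdist_le : du => /(_ e e0).
move=> /nbhs_ballP[dl dl0 hd]; exists dl => // t tdl.
have [->|t0] := eqVneq t 0; first by rewrite add0r subrr mulr0 subr0 normr0 mulr0.
have := hd t; rewrite /ball/= sub0r normrN => /(_ tdl t0).
rewrite -[lim _]/('D_1 u x) [_%:A]mulr1 distrC -[_ *: _]/(_ * _) => H.
have -> : u (t + x) - u x - 'D_1 u x * t = (t^-1 * (u (t + x) - u x) - 'D_1 u x) * t.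
  by rewrite mulrBl mulrAC mulVf// mul1r.
by rewrite normrM ler_wpM2r.
Qed.

(** The functional equation reduces the point [z] to 0, where the first-order expansions of the real
    exponential, cosine and sine combine. *)
Lemma cexp_diff z : cdiff cexp z.
Proof.
have d0 : cdiff cexp 0.
  apply: (@cdiffP _ _ 1) => e e0.
  (* With these constants the four error terms below add up to 9/16 of [e * N]. *)
  have e40 : 0 < e / 16 by rewrite divr_gt0.
  have [d1 d10 h1] := derive_approx (is_derive_expR (0 : R)) e40.
  have [d2 d20 h2] := derive_approx (is_derive_cos (0 : R)) e40.
  have [d3 d30 h3] := derive_approx (is_derive_sin (0 : R)) e40.
  have [d4 d40 h4] := derive_approx (is_derive_expR (0 : R)) ltr01.
  pose d5 := e / 8.
  exists (Num.min (Num.min (Num.min d1 d2) (Num.min d3 d4)) (Num.min 2^-1 d5)).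
    by rewrite !lt_min d10 d20 d30 d40 invr_gt0 ltr0n divr_gt0.
  move=> w; rewrite !subr0 mul1r !lt_min.
  move=> /andP[/andP[/andP[w1 w2] /andP[w3 w4]] /andP[w5 w6]].
  have := normc_Re w; have := normc_Im w; set N := normc w.
  case: w w1 w2 w3 w4 w5 w6 @N => x y w1 w2 w3 w4 w5 w6 N.
  move=> yN' xN'; have yN : `|y| <= N by []; have {yN' xN'} xN : `|x| <= N by [].
  have {}h1 := h1 x (le_lt_trans xN w1); have {}h2 := h2 y (le_lt_trans yN w2).
  have {}h3 := h3 y (le_lt_trans yN w3); have {}h4 := h4 x (le_lt_trans xN w4).
  rewrite !addr0 expR0 mul1r in h1 h4; rewrite addr0 cos0 sin0 oppr0 mul0r subr0 in h2.
  rewrite addr0 cos0 sin0 subr0 mul1r in h3.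
  rewrite mul1r in h4.
  have ex : 0 < expR x <= 2.
    rewrite expR_gt0/=; move: h4; rewrite ler_norml => /andP[_ h4].
    have := le_trans xN (ltW w5); have := ler_norm x; clear -h4; lra.
  have N0 : 0 <= N by exact: normc_ge0.
  apply: le_trans (normc_le _) _; rewrite /cexp /=.
  rewrite expR0 cos0 sin0 mulr1 mulr0 subr0.
  have -> : expR x * cos y - 1 - x = expR x * (cos y - 1) + (expR x - 1 - x) by ring.
  have -> : expR x * sin y - y = expR x * (sin y - y) + ((expR x - 1 - x) + x) * y by ring.
  have /andP[ex0 ex2] := ex.
  have mulb (u v : R) (p q : R) : `|u| <= p -> `|v| <= q -> `|u * v| <= p * q.
    by move=> hu hv; rewrite normrM ler_pM.
  have ubN (u k : R) : 0 <= k -> `|u| <= N -> k * `|u| <= k * N.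
    by move=> k0 uN; rewrite ler_wpM2l.
  have e0' := ltW e40.
  have nex : `|expR x| <= 2 by rewrite gtr0_norm.
  have b1 := mulb _ _ _ _ nex (le_trans h2 (ubN _ _ e0' yN)).
  have b2 := le_trans h1 (ubN _ _ e0' xN).
  have b3 := mulb _ _ _ _ nex (le_trans h3 (ubN _ _ e0' yN)).
  have b4 : `|(expR x - 1 - x + x) * y| <= (N + N) * (e / 8).
    apply: mulb; last exact: le_trans yN (ltW w6).
    by apply: le_trans (ler_normD _ _) _; rewrite lerD// (le_trans h4).
  apply: le_trans (lerD (ler_normD _ _) (ler_normD _ _)) _.
  apply: le_trans (lerD (lerD b1 b2) (lerD b3 b4)) _.
  have := mulr_ge0 (ltW e0) N0; clear; nra.
have [p cp pE] := d0.
exists (fun w => cexp z * p (w - z)).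
  apply: ccontM; first exact: ccont_cst.
  apply: (@ccont_comp p (fun w => w + - z)); last by rewrite subrr.
  by apply: ccontD; [exact: ccont_id|exact: ccont_cst].
move=> w; rewrite -[in LHS](subrK z w) addrC cexpD [cexp (w - z)]pE subr0.
have -> : cexp 0 = 1 by rewrite /cexp /= expR0 cos0 sin0 mulr1 mulr0.
by ring.
Qed.

Lemma cexp_period (x y : R) : cexp (Complex x (y + 2 * pi)) = cexp (Complex x y).
Proof.
rewrite /cexp /= (_ : y + 2 * pi = y + pi + pi) ?cosDpi ?sinDpi ?opprK//.
by rewrite mulr_natl mulr2n addrA.
Qed.

End ComplexCalculus.

(** * The maximum modulus principle and the three lines theorem *)

Section MaximumModulus.
Variable R : realType.
Local Notation C := R[i].
Implicit Types (z w : C) (f g k : C -> C) (e : R).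

Lemma itg_le a b (f : R -> R) (M : R) : a <= b -> continuous_on a b f ->
  (forall x, a <= x <= b -> f x <= M) -> itg a b f <= M * (b - a).
Proof.
move=> ab cf fM.
have -> : M * (b - a) = itg a b (fun=> M).
  rewrite /itg Rintegral_cst//= lebesgue_measure_itv/= lte_fin.
  by case: ltP => [//|ba]; rewrite (@le_anti _ _ a b) ?ab// subrr.
apply: le_Rintegral => //; first exact: continuous_on_integrable.
by apply: continuous_on_integrable => x _; exact: cst_continuous.
Qed.

Lemma cdiff_div_free f x y : cdiff f (Complex x y) ->
  div_free (fun x y => complex.Re (f (Complex x y)))
           (fun x y => complex.Im (f (Complex x y))) x y.
Proof.
move=> /cdiff_approx[l hl].
exists (complex.Re l), (- complex.Im l), (complex.Im l) => e e0.
have [d d0 hd] := hl e e0; exists (d / 2); first by rewrite divr_gt0.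
move=> x' y' hx hy.
have le_xy : normc (Complex x' y' - Complex x y) <= `|x' - x| + `|y' - y|.
  exact: normc_le.
have /hd hk : normc (Complex x' y' - Complex x y) < d.
  by apply: le_lt_trans le_xy _; rewrite (splitr d) ltrD.
have := le_trans hk (ler_wpM2l (ltW e0) le_xy).
set u := _ - _ - _ => hu; split.
  apply: le_trans hu; apply: le_trans (normc_Re u); rewrite /u.
  case: (f (Complex x' y')) (f (Complex x y)) (l) => [a b] [a' b'] [c c'] /=.
  by rewrite le_eqVlt; apply/orP; left; apply/eqP; congr (`| _ |); ring.
apply: le_trans hu; apply: le_trans (normc_Im u); rewrite /u.
case: (f (Complex x' y')) (f (Complex x y)) (l) => [a b] [a' b'] [c c'] /=.
by rewrite le_eqVlt; apply/orP; left; apply/eqP; congr (`| _ |); ring.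
Qed.

(* Goursat's theorem for [k (z0 + exp w)] on a rectangle of height [2 pi]:    *)
(* by periodicity the integral of [k] over a circle around [z0] does not      *)
(* depend on the radius.                                                      *)
Lemma Re_circle_lt0 k z0 (r r' dl : R) : 0 < r -> r < r' -> 0 < dl ->
  (forall w, normc (w - z0) < r' -> cdiff k w) ->
  (forall w, normc (w - z0) = r -> complex.Re (k w) <= - dl) ->
  complex.Re (k z0) < 0.
Proof.
move=> r0 rr' dl0 dk hk; rewrite ltNge; apply/negP => kz0.
pose F w := k (z0 + cexp w).
pose P x y := complex.Re (F (Complex x y)); pose S x y := complex.Im (F (Complex x y)).
have dist w : normc (z0 + cexp w - z0) = expR (complex.Re w).
  by rewrite addrAC subrr add0r normc_cexp.
pose x1 := ln r.
have ex1 : expR x1 = r by rewrite lnK.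
have df x y : x <= x1 -> div_free P S x y.
  move=> xx1; apply: cdiff_div_free.
  apply: (@cdiff_comp _ k (fun w => z0 + cexp w)).
    by apply: cdiffD; [exact: cdiff_cst|exact: cexp_diff].
  by apply: dk; rewrite dist (le_lt_trans _ rr')// -ex1 ler_expR.
have z0r' : normc (z0 - z0) < r' by rewrite subrr normc0 (lt_trans r0).
have /ccontP/(_ (dl / 2) (divr_gt0 dl0 (ltr0n _ 2)))[d d0 hd] :=
  cdiff_continuous (dk z0 z0r').
(* The inner circle has radius [expR x0 < d], so [k] differs there from [k z0] by less than
   [dl / 2]. *)
pose x0 := Num.min x1 (ln (d / 2)).
have x01 : x0 <= x1 by rewrite ge_min lexx.
have ex0 : expR x0 < d.
  apply: (@le_lt_trans _ _ (expR (ln (d / 2)))); first by rewrite ler_expR ge_min lexx orbT.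
  by rewrite lnK ?posrE ?divr_gt0// ltr_pdivrMr// ltr_pMr// ltr1n.
have pi20 : 0 < 2 * pi :> R by rewrite mulr_gt0 ?pi_gt0.
have := @div_free_flux R P S x0 x1 0 (2 * pi) x01 (ltW pi20).
have df' x y : x0 <= x <= x1 -> 0 <= y <= 2 * pi -> div_free P S x y.
  by move=> /andP[_ xx1] _; exact: df.
(* The horizontal sides cancel by periodicity, so the vertical ones must balance; but the integrand
   there is at most [- (dl / 2)] when the real part of [k z0] is nonnegative. *)
have -> : (fun x => S x (2 * pi) - S x 0) = fun=> 0.
  by apply/funext => x; rewrite /S /F -(add0r (2 * pi)) cexp_period subrr.
move=> /(_ df'); have -> : itg x0 x1 (fun=> 0) = 0.
  by rewrite /itg Rintegral_cst//= mul0r.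
apply/eqP; rewrite lt_eqF//.
have cP x : x <= x1 -> continuous_on 0 (2 * pi) (P x).
  by move=> xx1 y _; exact: (div_free_continuous (df x y xx1)).1.
apply: (@le_lt_trans _ _ (- (dl / 2) * (2 * pi - 0))); last first.
  by rewrite subr0 mulNr oppr_lt0 mulr_gt0// divr_gt0.
apply: itg_le; [exact: ltW|by apply: continuous_onB; exact: cP|move=> y _].
have h1 : P x1 y <= - dl by apply: hk; rewrite dist.
have h2 : `|P x0 y - complex.Re (k z0)| <= dl / 2.
  have := hd (z0 + cexp (Complex x0 y)); rewrite dist => /(_ ex0)/ltW.
  apply: le_trans; apply: le_trans (normc_Re _); rewrite /P /F.
  by case: (k _) (k z0) => [a b] [c c'].
by move: h2; rewrite ler_norml => /andP[h2 _]; clear -h1 h2 kz0; lra.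
Qed.

Lemma normc_sqr_expand z w : normc w ^+ 2 =
  normc z ^+ 2 + 2 * complex.Re (z^*%C * (w - z)) + normc (w - z) ^+ 2.
Proof. by rewrite !normc_sqr; case: z w => [a b] [c d] /=; ring. Qed.

Definition rect (a b c d : R) : set C :=
  [set z | a <= complex.Re z <= b /\ c <= complex.Im z <= d].

Definition ccont_in (A : set C) f := forall z, A z -> forall e, 0 < e ->
  exists2 dl, 0 < dl & forall w, A w -> normc (w - z) < dl -> normc (f w - f z) <= e.

(** Compactness of a product of real segments, transported to the complex rectangle. The term in [e]
    is the perturbation that later rules out an interior maximum. *)
Lemma rect_EVT_max a b c d f e : a <= b -> c <= d -> ccont_in (rect a b c d) f ->
  exists2 z, rect a b c d z & forall w, rect a b c d w ->
    normc (f w) ^+ 2 + e * normc w ^+ 2 <= normc (f z) ^+ 2 + e * normc z ^+ 2.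
Proof.
move=> ab cd cf.
pose Q : set (R * R) := `[a, b] `*` `[c, d].
pose nf (p : R * R) := normc (f (Complex p.1 p.2)).
have cQ : compact Q by apply: compact_setX; exact: segment_compact.
have Q0 : Q !=set0 by exists (a, c); split; rewrite /= in_itv/= lexx.
have QP p : Q p <-> rect a b c d (Complex p.1 p.2).
  by rewrite /Q /rect /=; split=> -[]; rewrite !in_itv.
have cn : {within Q, continuous nf}.
  apply/subspace_continuousP => p /QP Qp; apply/cvgrPdist_le => e' e'0.
  have [dl dl0 hd] := cf _ Qp e' e'0.
  have dl2 : 0 < dl / 2 by rewrite divr_gt0.
  rewrite near_withinE; apply/nbhs_ballP; exists (dl / 2) => // q [q1 q2] Qq.
  have := hd (Complex q.1 q.2) ((QP q).1 Qq).
  have nn (u v : C) : `|normc u - normc v| <= normc (v - u).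
    rewrite ler_norml; apply/andP; split.
      have := normcD (v - u) u; rewrite subrK; clear; lra.
    have := normcD (u - v) v; rewrite subrK normcBC; clear; lra.
  move=> H; apply: le_trans (nn _ _) _; apply: H.
  apply: le_lt_trans (normc_le _) _ => /=; rewrite (splitr dl).
  by apply: ltrD; rewrite distrC; [exact: q1|exact: q2].
pose v p : R := nf p ^+ 2 + e * (p.1 ^+ 2 + p.2 ^+ 2).
have cv : {within Q, continuous v}.
  move=> p; apply: cvgD.
    by under eq_fun do rewrite expr2; rewrite expr2; apply: cvgM; exact: cn.
  apply: cvgM; first exact: cvg_cst.
  have c1 : {within Q, continuous (fun q : R * R => q.1 ^+ 2 + q.2 ^+ 2)}.
    apply: continuous_subspaceT => q; apply: cvgD; under eq_fun do rewrite expr2;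
      rewrite expr2; apply: cvgM; (exact: cvg_fst || exact: cvg_snd).
  exact: c1.
have [[x y] /set_mem/QP Qxy hmax] := compact_EVT_max Q0 cQ cv.
exists (Complex x y) => // -[x' y'] Qw.
have := hmax (x', y') (mem_set ((QP (x', y')).2 Qw)).
by rewrite /v /nf !normc_sqr.
Qed.

(* At an interior maximum [z0] of [|f|^2 + e |z|^2], the function [k] below   *)
(* vanishes at [z0] and has negative real part on small circles around it.    *)
Lemma max_modulus_rect f a b c d B : a < b -> c < d -> 0 <= B ->
  ccont_in (rect a b c d) f ->
  (forall z, a < complex.Re z < b -> c < complex.Im z < d -> cdiff f z) ->
  (forall z, rect a b c d z -> [\/ complex.Re z = a, complex.Re z = b,
     complex.Im z = c | complex.Im z = d] -> normc (f z) <= B) ->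
  forall z, rect a b c d z -> normc (f z) <= B.
Proof.
move=> ab cd B0 cf df fB z1 Qz1; rewrite leNgt; apply/negP => Bz1.
pose M := (`|a| + `|b|) ^+ 2 + (`|c| + `|d|) ^+ 2.
have M0 : 0 <= M by rewrite addr_ge0 ?sqr_ge0.
have QM z : rect a b c d z -> normc z ^+ 2 <= M.
  move=> [/andP[x1 x2] /andP[y1 y2]]; rewrite normc_sqr /M.
  have key (s t u : R) : s <= u -> u <= t -> u ^+ 2 <= (`|s| + `|t|) ^+ 2.
    move=> su ut; rewrite -real_normK ?num_real//.
    rewrite ler_pXn2r ?nnegrE ?addr_ge0// ler_norml.
    have := ler_norm t; have := ler_norm (- s); rewrite normrN.
    have := normr_ge0 s; have := normr_ge0 t; move=> p1 p2 p3 p4.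
    by apply/andP; split; olra.
  by apply: lerD; exact: key.
(* [e] is so small that the perturbation, at most [e * M] on the rectangle, does not fill the gap
   between [normc (f z1) ^+ 2] and [B ^+ 2]; hence the perturbed maximum is not on the boundary. *)
pose e := (normc (f z1) ^+ 2 - B ^+ 2) / (2 * (M + 1)).
have gap : 0 < normc (f z1) ^+ 2 - B ^+ 2.
  by rewrite subr_gt0 ltr_pXn2r ?nnegrE ?normc_ge0.
have e0 : 0 < e by rewrite divr_gt0// mulr_gt0// ltr_wpDl.
have eM : e * M < normc (f z1) ^+ 2 - B ^+ 2.
  rewrite /e mulrAC ltr_pdivrMr ?mulr_gt0 ?ltr_wpDl//.
  by rewrite ltr_pM2l//; clear -M0; lra.
have [z0 Qz0 hmax] := @rect_EVT_max a b c d f e (ltW ab) (ltW cd) cf.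
have nbd : ~ [\/ complex.Re z0 = a, complex.Re z0 = b,
     complex.Im z0 = c | complex.Im z0 = d].
  move=> /(fB _ Qz0) fz0.
  have := hmax z1 Qz1; apply/negP; rewrite -ltNge.
  have : normc (f z0) ^+ 2 <= B ^+ 2 by rewrite ler_pXn2r ?nnegrE ?normc_ge0.
  have := ler_wpM2l (ltW e0) (QM z0 Qz0).
  have : 0 <= e * normc z1 ^+ 2 by rewrite mulr_ge0 ?sqr_ge0 ?ltW.
  by move: eM; clear; lra.
have [x1 x2 y1 y2] : [/\ a < complex.Re z0, complex.Re z0 < b,
    c < complex.Im z0 & complex.Im z0 < d].
  move: Qz0 => [/andP[x1 x2] /andP[y1 y2]].
  split; rewrite lt_neqAle ?x1 ?x2 ?y1 ?y2 andbT; apply/eqP => E; apply: nbd.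
  - by constructor 1.
  - by constructor 2.
  - by constructor 3.
  - by constructor 4.
pose r' := Num.min (Num.min (complex.Re z0 - a) (b - complex.Re z0))
                   (Num.min (complex.Im z0 - c) (d - complex.Im z0)).
have r'0 : 0 < r' by rewrite !lt_min !subr_gt0 x1 x2 y1 y2.
have inQ w : normc (w - z0) < r' ->
    a < complex.Re w < b /\ c < complex.Im w < d.
  rewrite !lt_min => /andP[/andP[w1 w2] /andP[w3 w4]].
  have := normc_Re (w - z0); have := normc_Im (w - z0).
  have -> : complex.Re (w - z0) = complex.Re w - complex.Re z0 by case: (w) (z0) => ? ? [].
  have -> : complex.Im (w - z0) = complex.Im w - complex.Im z0 by case: (w) (z0) => ? ? [].
  rewrite !ler_norml => /andP[u1 u2] /andP[u3 u4].
  by split; apply/andP; split; olra.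
pose k w := ((f z0)^*)%C * (f w - f z0) + e%:C%C * (z0^*)%C * (w - z0).
have kE w : normc (f w) ^+ 2 + e * normc w ^+ 2 =
    normc (f z0) ^+ 2 + e * normc z0 ^+ 2 + 2 * complex.Re (k w) +
    normc (f w - f z0) ^+ 2 + e * normc (w - z0) ^+ 2.
  have -> : complex.Re (k w) = complex.Re ((f z0)^*%C * (f w - f z0)) +
      e * complex.Re (z0^*%C * (w - z0)).
    by rewrite /k -mulrA; case: (_ * _) (z0^*%C * _) => [? ?] [? ?] /=; ring.
  by rewrite (normc_sqr_expand (f z0) (f w)) (normc_sqr_expand z0 w); ring.
have : complex.Re (k z0) < 0.
  (* By [kE], maximality at [z0] forces twice the real part of [k] to be at most - e r^2 on the
     circle of radius r = [r' / 2]. *)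
  apply: (@Re_circle_lt0 k z0 (r' / 2) r' (e * (r' / 2) ^+ 2 / 2)).
  - by rewrite divr_gt0.
  - by rewrite ltr_pdivrMr// ltr_pMr// ltr1n.
  - by rewrite divr_gt0// mulr_gt0// exprn_gt0// divr_gt0.
  - move=> w /inQ[w1 w2]; apply: cdiffD; apply: cdiffM; try exact: cdiff_cst.
      by apply: cdiffD; [exact: df|exact: cdiff_cst].
    by apply: cdiffD; [exact: cdiff_id|exact: cdiff_cst].
  - move=> w wr.
    have [] := inQ w; first by rewrite wr ltr_pdivrMr// ltr_pMr// ltr1n.
    move=> /andP[/ltW w1 /ltW w2] /andP[/ltW w3 /ltW w4].
    have := hmax w ltac:(by split; apply/andP; split).
    rewrite kE wr; have := sqr_ge0 (normc (f w - f z0)); clear; lra.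
by rewrite /k !subrr !mulr0 addr0 ltxx.
Qed.

End MaximumModulus.

(** * The three lines theorem *)

Section ThreeLines.
Variable R : realType.
Local Notation C := R[i].
Implicit Types (z w : C) (f g h : C -> C) (e : R).

Lemma ccont_inM (A : set C) f h : ccont_in A f -> (forall z, A z -> ccont h z) ->
  ccont_in A (fun z => f z * h z).
Proof.
move=> cf ch z Az e e0.
have hz0 : 0 < normc (h z) + 1 by rewrite ltr_wpDl// normc_ge0.
have fz0 : 0 < normc (f z) + 1 by rewrite ltr_wpDl// normc_ge0.
have e20 : 0 < e / 2 by rewrite divr_gt0.
have [d1 d10 h1] := cf z Az (e / 2 / (normc (h z) + 1)) (divr_gt0 e20 hz0).
have /ccontP ch' := ch z Az.
have m0 : 0 < Num.min 1 (e / 2 / (normc (f z) + 1)) by rewrite lt_min ltr01 divr_gt0.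
have [d2 d20 h2] := ch' _ m0.
exists (Num.min d1 d2) => [|w Aw]; first by rewrite lt_min d10.
rewrite lt_min => /andP[/(h1 w Aw) w1 /h2]; rewrite lt_min => /andP[w2 /ltW w3].
have hw : normc (h w) <= normc (h z) + 1.
  rewrite -[h w](subrK (h z)) addrC; apply: le_trans (normcD _ _) _.
  by rewrite lerD2l ltW.
have -> : f w * h w - f z * h z = (f w - f z) * h w + f z * (h w - h z) by ring.
apply: le_trans (normcD _ _) _; rewrite (splitr e) !normcM; apply: lerD.
  apply: le_trans (ler_pM (normc_ge0 _) (normc_ge0 _) w1 hw) _.
  by rewrite divfK// gt_eqF.
apply: le_trans (ler_wpM2l (normc_ge0 _) w3) _.
by rewrite mulrCA ler_piMr ?(ltW e20)// ler_pdivrMr// mul1r lerDl.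
Qed.

(** Multiplication by exp(l z + z^2), with l = ln(c0 / c1), brings both boundary bounds to [c0 * S],
    up to the factor [expR 1] that z^2 costs at real part 1, and makes the product small at
    infinity. The maximum principle then applies on tall rectangles. *)
Lemma three_lines g (M c0 c1 S theta : R) : 0 < c0 -> 0 < c1 -> 0 <= S ->
  0 <= theta <= 1 ->
  (forall z, strip z -> normc (g z) <= M) -> ccont_in (@strip R) g ->
  (forall z, 0 < complex.Re z < 1 -> cdiff g z) ->
  (forall t, normc (g (Complex 0 t)) <= c0 * S) ->
  (forall t, normc (g (Complex 1 t)) <= c1 * S) ->
  normc (g theta%:C%C) <= expR 1 * (c0 `^ (1 - theta) * c1 `^ theta) * S.
Proof.
move=> c00 c10 S0 /andP[t0 t1] gM cg dg g0 g1.
pose l := ln c0 - ln c1.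
pose E z := cexp (l%:C%C * z + z * z).
have dE z : cdiff E z.
  apply: (@cdiff_comp _ (@cexp R) (fun w => l%:C%C * w + w * w)); last exact: cexp_diff.
  apply: cdiffD; first by apply: cdiffM; [exact: cdiff_cst|exact: cdiff_id].
  by apply: cdiffM; exact: cdiff_id.
have nE x y : normc (E (Complex x y)) = expR (l * x + x ^+ 2 - y ^+ 2).
  by rewrite normc_cexp /=; congr expR; ring.
have El : expR l = c0 / c1 by rewrite /l expRB !lnK.
have M0 : 0 <= M.
  by apply: le_trans (gM 0 _); [exact: normc_ge0|rewrite /strip/= lexx ler01].
have key eta : 0 < eta -> normc (g theta%:C%C * E theta%:C%C) <= expR 1 * (c0 * S) + eta.
  move=> eta0.
  pose K := M * expR (`|l| + 1); have K0 : 0 <= K by rewrite mulr_ge0 ?expR_ge0.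
  (* On the horizontal sides the Gaussian is at most [T^-1], so a height of at least [K / eta]
     brings the product below [eta]. *)
  pose T := 1 + K / eta; have T1 : 1 <= T by rewrite lerDl divr_ge0// ltW.
  have T0 : 0 < T by apply: lt_le_trans T1.
  have B0 : 0 <= expR 1 * (c0 * S) by rewrite !mulr_ge0 ?expR_ge0// ltW.
  have c0S : c0 * S <= expR 1 * (c0 * S).
    by rewrite ler_peMl ?mulr_ge0 ?(ltW c00)// -[leLHS]expR0 ler_expR.
  have Qs z : rect 0 1 (- T) T z -> strip z by case.
  have far x y : 0 <= x <= 1 -> y ^+ 2 = T ^+ 2 ->
      normc (g (Complex x y) * E (Complex x y)) <= eta.
    move=> /andP[x0 x1] yT; rewrite normcM nE yT expRD.
    have h1 : normc (g (Complex x y)) <= M by apply: gM; rewrite /strip/= x0 x1.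
    have h2 : expR (l * x + x ^+ 2) <= expR (`|l| + 1).
      rewrite ler_expR lerD// ?expr_le1//.
      apply: le_trans (ler_norm _) _; rewrite normrM (ger0_norm x0).
      by rewrite ler_piMr.
    have h3 : expR (- T ^+ 2) <= T^-1.
      rewrite expRN lef_pV2 ?posrE ?expR_gt0//.
      apply: le_trans (expR_ge1Dx _); rewrite expr2.
      have : T <= T * T by rewrite ler_peMl// ltW.
      clear; lra.
    rewrite mulrA; apply: (@le_trans _ _ (K * T^-1)).
      apply: ler_pM => //; rewrite ?mulr_ge0 ?normc_ge0 ?expR_ge0//.
      by apply: ler_pM; rewrite ?normc_ge0 ?expR_ge0.
    rewrite ler_pdivrMr// mulrDr mulr1 mulrCA divff ?gt_eqF// mulr1.
    by rewrite lerDr ltW.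
  apply: (@max_modulus_rect _ (fun z => g z * E z) 0 1 (- T) T) => //.
  - by rewrite gtrN.
  - by rewrite addr_ge0// ltW.
  - apply: ccont_inM => [z Qz e e0|z _]; last exact: cdiff_continuous.
    have [d d0 hd] := cg z (Qs z Qz) e e0.
    by exists d => // w /Qs Qw; exact: hd.
  - by move=> z z01 _; apply: cdiffM => //; exact: dg.
  - move=> [x y] [/= x01 _] [] E0.
    + rewrite E0 normcM nE; apply: (@le_trans _ _ (c0 * S)).
        rewrite -[leRHS]mulr1; apply: ler_pM; rewrite ?normc_ge0 ?expR_ge0//.
        by rewrite -expR0 ler_expR mulr0 expr0n add0r sub0r oppr_le0 sqr_ge0.
      by apply: le_trans c0S _; rewrite lerDl ltW.
    + rewrite E0 normcM nE; apply: (@le_trans _ _ (expR 1 * (c0 * S))).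
        have -> : expR 1 * (c0 * S) = c1 * S * (expR l * expR 1).
          by rewrite El; field; rewrite gt_eqF.
        apply: ler_pM; rewrite ?normc_ge0 ?expR_ge0//.
        by rewrite -expRD ler_expR mulr1 expr1n gerDl oppr_le0 sqr_ge0.
      by rewrite lerDl ltW.
    + by apply: le_trans (far x y x01 _) _; rewrite ?E0 ?sqrrN// lerDr.
    + by apply: le_trans (far x y x01 _) _; rewrite ?E0 ?sqrrN// lerDr.
  - split => /=; first by rewrite t0.
    by rewrite oppr_le0 ltW.
have : normc (g theta%:C%C * E theta%:C%C) <= expR 1 * (c0 * S).
  by apply/ler_addgt0Pl => eta /key; rewrite addrC.
(* Division by the modulus of [E] at [theta] restores the weights; its factor [expR (theta ^+ 2)] is
   at least 1. *)
rewrite normcM [E _]/(E (Complex theta 0)) nE => H.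
have e0 := expR_gt0 (l * theta + theta ^+ 2 - 0 ^+ 2).
move: H; rewrite -ler_pdivlMr// => H; apply: le_trans H _.
rewrite -expRN -!mulrA; apply: ler_wpM2l; first exact: expR_ge0.
rewrite /powR !gt_eqF// [S * _]mulrC !mulrA; apply: ler_wpM2r => //.
rewrite -[X in X * _ <= _](@lnK _ c0) ?posrE// -!expRD ler_expR /l.
by have := sqr_ge0 theta; rewrite expr0n/=; clear; lra.
Qed.

End ThreeLines.

(** * Matrices of operators *)

Section FiniteSums.
Variable R : realType.
Local Notation C := R[i].

(** Lagrange's identity: twice the difference of the two sides is a double sum of squares. *)
Lemma sum_CauchySchwarz (I : finType) (a b : I -> R) :
  (\sum_i a i * b i) ^+ 2 <= (\sum_i a i ^+ 2) * (\sum_i b i ^+ 2).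
Proof.
have : 0 <= \sum_i \sum_j (a i * b j - a j * b i) ^+ 2.
  by apply: sumr_ge0 => i _; apply: sumr_ge0 => j _; exact: sqr_ge0.
have -> : \sum_i \sum_j (a i * b j - a j * b i) ^+ 2 =
    2 * ((\sum_i a i ^+ 2) * (\sum_i b i ^+ 2)) - 2 * (\sum_i a i * b i) ^+ 2.
  rewrite expr2 !big_distrlr /= {1}mulr_sumr.
  transitivity (\sum_i \sum_j (a i ^+ 2 * b j ^+ 2) +
      \sum_i \sum_j (a j ^+ 2 * b i ^+ 2) - 2 * \sum_i \sum_j (a i * b i * (a j * b j))).
    rewrite -big_split mulr_sumr -sumrB; apply: eq_bigr => i _ /=.
    by rewrite -big_split mulr_sumr -sumrB; apply: eq_bigr => j _ /=; ring.
  rewrite [X in _ + X - _]exchange_big /= -mulr_sumr; ring.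
by lra.
Qed.

Lemma sum_sqr_le_card (I : finType) (a : I -> R) :
  (\sum_i a i) ^+ 2 <= #|I|%:R * \sum_i a i ^+ 2.
Proof.
have := sum_CauchySchwarz (fun=> 1) a.
under eq_bigr do rewrite mul1r; under [X in _ <= X * _]eq_bigr do rewrite expr1n.
by rewrite sumr_const.
Qed.

Lemma normc_sum_le (I : finType) (a : I -> C) : normc (\sum_i a i) <= \sum_i normc (a i).
Proof.
elim/big_ind2 : _ => [|x x' y y' h1 h2|//]; first by rewrite normc0.
by apply: le_trans (normcD _ _) _; exact: lerD.
Qed.

Lemma normc_sum_CauchySchwarz (I : finType) (a b : I -> C) :
  normc (\sum_i a i * b i) ^+ 2 <= (\sum_i normc (a i) ^+ 2) * (\sum_i normc (b i) ^+ 2).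
Proof.
apply: le_trans (sum_CauchySchwarz (fun i => normc (a i)) (fun i => normc (b i))).
rewrite ler_pXn2r ?nnegrE ?normc_ge0 ?sumr_ge0// => [|i _]; last first.
  by rewrite mulr_ge0 ?normc_ge0.
by apply: le_trans (normc_sum_le _) _; apply: ler_sum => i _; rewrite normcM.
Qed.

Lemma normc_sum_sqr_le_card (I : finType) (a : I -> C) :
  normc (\sum_i a i) ^+ 2 <= #|I|%:R * \sum_i normc (a i) ^+ 2.
Proof.
apply: le_trans (sum_sqr_le_card (fun i => normc (a i))).
rewrite ler_pXn2r ?nnegrE ?normc_ge0 ?sumr_ge0// => [|i _]; last exact: normc_ge0.
exact: normc_sum_le.
Qed.

Lemma sum_ge_term (I : finType) (F : I -> R) i :
  (forall j, 0 <= F j) -> F i <= \sum_j F j.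
Proof. by move=> F0; rewrite (bigD1 i)//= lerDl sumr_ge0. Qed.

Lemma sum_first_le m k (F : 'I_k -> R) (c : R) : (m <= k)%N ->
  (forall i : 'I_k, (i < m)%N -> F i <= c) ->
  (forall i : 'I_k, (m <= i)%N -> F i = 0) -> \sum_i F i <= m%:R * c.
Proof.
move=> mk Fc F0; rewrite (bigID (fun i : 'I_k => (i < m)%N))/= [X in _ + X]big1 ?addr0.
  rewrite -[m in m%:R]card_ord -sumr_const mulr_suml.
  under [leRHS]eq_bigr do rewrite mul1r.
  by rewrite (big_ord_widen k (fun=> c))//; exact: ler_sum.
by move=> i; rewrite -leqNgt; exact: F0.
Qed.

(** This holds for every set, since [sup] is 0 where there is no supremum. *)
Lemma sup_nonneg (A : set R) : (forall x, A x -> 0 <= x) -> 0 <= sup A.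
Proof.
move=> A0; have [[[x Ax] uA]|nA] := pselect (has_sup A); last by rewrite sup_out.
by apply: le_trans (A0 x Ax) _; apply: ub_le_sup.
Qed.

End FiniteSums.

Section DotSums.
Variables (R : realType) (H : lmodType R[i]) (d : {dot H for Num.conj}).
Local Notation C := R[i].

Lemma dot_norm0 : dot_norm d 0 = 0.
Proof. by rewrite -(scale0r 0) dot_normZ normc0 mul0r. Qed.

Lemma dot_norm_sum_le (I : finType) (x : I -> H) :
  dot_norm d (\sum_i x i) <= \sum_i dot_norm d (x i).
Proof.
elim/big_ind2 : _ => [|a a' b b' h1 h2|//]; first by rewrite dot_norm0.
by apply: le_trans (dot_normD _ _ _) _; exact: lerD.
Qed.

Lemma dot_normN x : dot_norm d (- x) = dot_norm d x.
Proof. by rewrite -scaleN1r dot_normZ normcNE normc1 mul1r. Qed.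

End DotSums.

Section OperatorMatrices.
Variables (R : realType) (H : hilbert R).
Local Notation C := R[i].
Implicit Types (T S : bop H).

Lemma hnorm_ge0 (x : H) : 0 <= hnorm x. Proof. exact: dot_norm_ge0. Qed.

Lemma bop_linear T : linear T.
Proof. by have /asboolP[] := bop_funP T. Qed.

Lemma bopZ T (a : C) (x : H) : T (a *: x) = a *: T x.
Proof.
have T0 : T 0 = 0.
  have := bop_linear T 1 0 0; rewrite !scale1r addr0 => /eqP.
  by rewrite -subr_eq0 opprD addrA subrr add0r oppr_eq0 => /eqP.
by rewrite -[a *: x]addr0 bop_linear T0 addr0.
Qed.

Lemma bop_bounded T : exists2 M : R, 0 <= M & forall x, hnorm (T x) <= M * hnorm x.
Proof.
have /asboolP[_ [M hM]] := bop_funP T; exists `|M| => // x.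
by apply: le_trans (hM x) _; rewrite ler_wpM2r ?hnorm_ge0 ?ler_norm.
Qed.

Lemma bop_norm_ub T x : hnorm (T x) <= bop_norm T * hnorm x.
Proof.
have [M M0 hM] := bop_bounded T.
have [x0|x0] := eqVneq (hnorm x) 0.
  by have := hM x; rewrite x0 !mulr0.
have px : 0 < hnorm x by rewrite lt_def x0 hnorm_ge0.
rewrite -ler_pdivrMr//.
apply: (@ub_le_sup _ [set hnorm (T x) | x in [set x | hnorm x <= 1]]).
  exists M => _ [y /= y1 <-]; apply: le_trans (hM y) _.
  by rewrite -[leRHS]mulr1 ler_wpM2l.
have nv : normc ((hnorm x)^-1)%:C%C = (hnorm x)^-1.
  by rewrite normc_real ger0_norm// invr_ge0 hnorm_ge0.
exists (((hnorm x)^-1)%:C%C *: x) => /=.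
  by rewrite /hnorm dot_normZ -/(hnorm _) nv mulVf.
by rewrite bopZ /hnorm dot_normZ -/(hnorm _) nv mulrC.
Qed.

Lemma bop_norm_le T (M : R) : 0 <= M -> (forall x, hnorm (T x) <= M * hnorm x) ->
  bop_norm T <= M.
Proof.
move=> M0 hM; apply: ge_sup.
  by exists (hnorm (T 0)), 0 => //=; rewrite /hnorm dot_norm0.
move=> _ [x /= x1 <-]; apply: le_trans (hM x) _.
by rewrite -[leRHS]mulr1 ler_wpM2l.
Qed.

Lemma hcol_norm_ge0 n (x : 'cV[H]_n) : 0 <= hcol_norm x.
Proof. exact: sqrtr_ge0. Qed.

Lemma hcol_norm_sqr n (x : 'cV[H]_n) :
  hcol_norm x ^+ 2 = \sum_i hnorm (x i ord0) ^+ 2.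
Proof. by rewrite sqr_sqrtr// sumr_ge0// => i _; exact: sqr_ge0. Qed.

Lemma hcol_norm_ge n (x : 'cV[H]_n) i : hnorm (x i ord0) <= hcol_norm x.
Proof.
rewrite -(@ler_pXn2r _ 2)// ?nnegrE ?hnorm_ge0 ?hcol_norm_ge0// hcol_norm_sqr.
by apply: (@sum_ge_term _ _ (fun i => hnorm (x i ord0) ^+ 2)) => j; exact: sqr_ge0.
Qed.

Lemma hcol_norm_le_sum n (x : 'cV[H]_n) : hcol_norm x <= \sum_i hnorm (x i ord0).
Proof.
have s0 : 0 <= \sum_i hnorm (x i ord0) by rewrite sumr_ge0// => i _; exact: hnorm_ge0.
rewrite -(@ler_pXn2r _ 2)// ?nnegrE ?hcol_norm_ge0// hcol_norm_sqr expr2 mulr_suml.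
apply: ler_sum => i _; rewrite expr2 ler_wpM2l ?hnorm_ge0//.
by apply: (@sum_ge_term _ _ (fun i => hnorm (x i ord0))) => j; exact: hnorm_ge0.
Qed.

Lemma hcol_normZ n (a : C) (x : 'cV[H]_n) :
  hcol_norm (\col_i (a *: x i ord0)) = normc a * hcol_norm x.
Proof.
apply/eqP; rewrite -(@eqrXn2 _ 2) ?mulr_ge0 ?hcol_norm_ge0 ?normc_ge0//.
rewrite exprMn !hcol_norm_sqr mulr_sumr; apply/eqP/eq_bigr => i _.
by rewrite mxE /hnorm dot_normZ exprMn.
Qed.

Lemma hcol_norm0 n : hcol_norm (\col_(i < n) (0 : H)) = 0.
Proof.
apply/eqP; rewrite -sqrf_eq0 hcol_norm_sqr big1// => i _.
by rewrite mxE /hnorm dot_norm0 expr0n.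
Qed.

(** A crude bound; it makes the set that defines [bop_mnorm] bounded, so that its [sup] is a true
    supremum. *)
Lemma bop_mx_bounded n (T : 'M[bop H]_n) : exists2 M : R, 0 <= M &
  forall x, hcol_norm (bop_mx_app T x) <= M * hcol_norm x.
Proof.
pose M := \sum_i \sum_j bop_norm (T i j).
have nn (S : bop H) : 0 <= bop_norm S.
  by apply: sup_nonneg => _ [x _ <-]; exact: hnorm_ge0.
exists M => [|x]; first by apply: sumr_ge0 => i _; exact: sumr_ge0.
apply: le_trans (hcol_norm_le_sum _) _; rewrite /M mulr_suml.
apply: ler_sum => i _; rewrite mxE mulr_suml.
apply: le_trans (dot_norm_sum_le _ _) _; apply: ler_sum => j _.
apply: le_trans (bop_norm_ub _ _) _.
by rewrite ler_wpM2l// hcol_norm_ge.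
Qed.

Lemma bop_mnorm_ge0 n (T : 'M[bop H]_n) : 0 <= bop_mnorm T.
Proof. by apply: sup_nonneg => _ [x _ <-]; exact: hcol_norm_ge0. Qed.

Lemma bop_mnorm_app n (T : 'M[bop H]_n) x :
  hcol_norm (bop_mx_app T x) <= bop_mnorm T * hcol_norm x.
Proof.
have [M M0 hM] := bop_mx_bounded T.
have [x0|x0] := eqVneq (hcol_norm x) 0.
  by have := hM x; rewrite x0 !mulr0.
have px : 0 < hcol_norm x by rewrite lt_def x0 hcol_norm_ge0.
rewrite -ler_pdivrMr//.
apply: (@ub_le_sup _ [set hcol_norm (bop_mx_app T x) | x in [set x | hcol_norm x <= 1]]).
  exists M => _ [y /= y1 <-]; apply: le_trans (hM y) _.
  by rewrite -[leRHS]mulr1 ler_wpM2l.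
have nv : normc ((hcol_norm x)^-1)%:C%C = (hcol_norm x)^-1.
  by rewrite normc_real ger0_norm// invr_ge0 hcol_norm_ge0.
exists (\col_i (((hcol_norm x)^-1)%:C%C *: x i ord0)) => /=.
  by rewrite hcol_normZ nv mulVf.
rewrite (_ : bop_mx_app T _ = \col_i (((hcol_norm x)^-1)%:C%C *: bop_mx_app T x i ord0)).
  by rewrite hcol_normZ nv mulrC.
apply/matrixP => i j; rewrite !mxE scaler_sumr; apply: eq_bigr => l _.
by rewrite mxE bopZ.
Qed.

Lemma bop_mnorm_sum n (T : 'M[bop H]_n) (x : 'I_n -> H) :
  \sum_i hnorm (\sum_j T i j (x j)) ^+ 2 <= bop_mnorm T ^+ 2 * \sum_j hnorm (x j) ^+ 2.
Proof.
have := bop_mnorm_app T (\col_i x i).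
rewrite -(@ler_pXn2r _ 2)// ?nnegrE ?mulr_ge0 ?hcol_norm_ge0 ?bop_mnorm_ge0//.
rewrite exprMn !hcol_norm_sqr.
under eq_bigr do (rewrite mxE; under eq_bigr do rewrite mxE).
have -> : \sum_i hnorm ((\col_i0 x i0) i ord0) ^+ 2 = \sum_j hnorm (x j) ^+ 2.
  by apply: eq_bigr => i _; rewrite mxE.
by [].
Qed.

Lemma bop_mnorm_le n (T : 'M[bop H]_n) (M : R) : 0 <= M ->
  (forall x : 'I_n -> H, \sum_i hnorm (\sum_j T i j (x j)) ^+ 2 <=
    M ^+ 2 * \sum_j hnorm (x j) ^+ 2) -> bop_mnorm T <= M.
Proof.
move=> M0 hM; apply: ge_sup.
  by exists (hcol_norm (bop_mx_app T (\col_i 0))), (\col_i 0) => //=; rewrite hcol_norm0.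
move=> _ [x /= x1 <-].
apply: (@le_trans _ _ (M * hcol_norm x)); last by rewrite -[leRHS]mulr1 ler_wpM2l.
rewrite -(@ler_pXn2r _ 2)// ?nnegrE ?mulr_ge0 ?hcol_norm_ge0//.
rewrite exprMn !hcol_norm_sqr; under eq_bigr do rewrite mxE.
exact: hM.
Qed.

(** A crude factor [n] is enough to bound the set of values that defines the operator space
    l1-sum. *)
Lemma bop_mnormD_le n (T S : 'M[bop H]_n) :
  bop_mnorm (T + S) <= n%:R * (bop_mnorm T + bop_mnorm S).
Proof.
apply: ge_sup.
  by exists (hcol_norm (bop_mx_app (T + S) (\col_i 0))), (\col_i 0) => //=; rewrite hcol_norm0.
move=> _ [x /= x1 <-]; apply: le_trans (hcol_norm_le_sum _) _.
rewrite -[n in n%:R]card_ord -sumr_const mulr_suml.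
apply: ler_sum => i _; rewrite mul1r.
have -> : bop_mx_app (T + S) x i ord0 = bop_mx_app T x i ord0 + bop_mx_app S x i ord0.
  by rewrite !mxE -big_split; apply: eq_bigr => j _ /=; rewrite mxE.
apply: le_trans (dot_normD _ _ _) _; apply: lerD; apply: le_trans (hcol_norm_ge _ _) _;
  apply: le_trans (bop_mnorm_app _ _) _; by rewrite -[leRHS]mulr1 ler_wpM2l ?bop_mnorm_ge0.
Qed.

End OperatorMatrices.

(** * Bessel families in l2 *)

Section Bessel.
Variable R : realType.
Local Notation C := R[i].
Local Notation ell2 := (ell2 R).
Local Notation ell2H := (ell2_hilbert R).
Local Notation nrm := (dot_norm (@ell2_dotp R)).
Local Notation dot := (@ell2_dot R).
Implicit Types (b : R) (x y : ell2).

Lemma hnormE (x : ell2) : hnorm (x : ell2H) = nrm x. Proof. by []. Qed.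

Lemma ell2_dot_le x y : normc (dot x y) <= nrm x * nrm y.
Proof. exact: (dot_CauchySchwarz (@ell2_dotp R)). Qed.

Lemma ell2_dot_self_nrm x : dot x x = (nrm x ^+ 2)%:C%C.
Proof. exact: (dot_self (@ell2_dotp R)). Qed.

Lemma ell2_dot0l y : dot 0 y = 0.
Proof. by rewrite -(scale0r 0) ell2_dotZ mul0r. Qed.

Lemma ell2_dot_suml (I : finType) (a : I -> C) (x : I -> ell2) y :
  dot (\sum_i a i *: x i) y = \sum_i a i * dot (x i) y.
Proof.
elim/big_rec2: _ => [|i z w _ <-]; first exact: ell2_dot0l.
by rewrite ell2_dot_linear.
Qed.

Lemma ell2_dot_sumr (I : finType) (a : I -> C) x (y : I -> ell2) :
  dot x (\sum_i a i *: y i) = \sum_i (a i)^* * dot x (y i).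
Proof.
rewrite ell2_dotC ell2_dot_suml rmorph_sum; apply: eq_bigr => i _.
by rewrite [LHS]rmorphM [in RHS]ell2_dotC.
Qed.

Lemma normc_dotC x y : normc (dot x y) = normc (dot y x).
Proof. by rewrite ell2_dotC normc_conj. Qed.

Lemma normc_conjM (z : C) : z^* * z = (normc z ^+ 2)%:C%C.
Proof. by rewrite mulrC -normCK normCE -rmorphXn. Qed.

(** For [b >= 0] this says that the synthesis operator of the family has norm at most [b]. It is the
    part of orthonormality, with [b = 1], that the upper estimates use. *)
Definition bessel (I : finType) b (v : I -> ell2) := forall a : I -> C,
  nrm (\sum_i a i *: v i) ^+ 2 <= b ^+ 2 * \sum_i normc (a i) ^+ 2.

Section BesselTheory.
Variables (I : finType) (b : R) (v : I -> ell2).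

(** The analysis operator is adjoint to the synthesis operator and has the same bound; the proof
    tests the latter on the coefficients [dot xi (v i)]. *)
Lemma bessel_dual xi : bessel b v ->
  \sum_i normc (dot xi (v i)) ^+ 2 <= b ^+ 2 * nrm xi ^+ 2.
Proof.
move=> hv; set S := \sum_i _.
have S0 : 0 <= S by apply: sumr_ge0 => i _; exact: sqr_ge0.
have /eqP := erefl (dot xi (\sum_i dot xi (v i) *: v i)).
rewrite {2}ell2_dot_sumr.
rewrite (eq_bigr (fun i => (normc (dot xi (v i)) ^+ 2)%:C%C)) => [|i _]; last exact: normc_conjM.
rewrite -rmorph_sum -/S => /eqP SE.
have : S ^+ 2 <= b ^+ 2 * nrm xi ^+ 2 * S.
  have -> : S = normc (dot xi (\sum_i dot xi (v i) *: v i)).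
    by rewrite SE normc_real ger0_norm.
  apply: (@le_trans _ _ ((nrm xi * nrm (\sum_i dot xi (v i) *: v i)) ^+ 2)).
    by rewrite ler_pXn2r ?nnegrE ?mulr_ge0 ?normc_ge0 ?dot_norm_ge0// ell2_dot_le.
  rewrite SE normc_real ger0_norm// exprMn [leRHS]mulrAC [leRHS]mulrC.
  by rewrite ler_wpM2l ?sqr_ge0// hv.
have [->|Sn] := eqVneq S 0; first by rewrite mulr_ge0 ?sqr_ge0.
by rewrite expr2 ler_pM2r// lt_def Sn.
Qed.

Lemma bessel_entry i : 0 <= b -> bessel b v -> nrm (v i) <= b.
Proof.
move=> b0 /(_ (fun j => (j == i)%:R)).
rewrite (bigD1 i)//= big1 => [|j /negbTE ->]; last by rewrite scale0r.
rewrite (bigD1 i)//= big1 => [|j /negbTE ->]; last by rewrite normc0 expr0n.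
rewrite eqxx scale1r normc1 expr1n !addr0 mulr1.
by rewrite ler_pXn2r ?nnegrE ?dot_norm_ge0.
Qed.

Lemma bessel_scale (c : C) : bessel b v -> bessel (normc c * b) (fun i => c *: v i).
Proof.
move=> hv a; have -> : \sum_i a i *: (c *: v i) = c *: \sum_i a i *: v i.
  by rewrite scaler_sumr; apply: eq_bigr => i _; rewrite !scalerA mulrC.
rewrite dot_normZ exprMn; apply: le_trans (ler_wpM2l (sqr_ge0 _) (hv a)) _.
by rewrite exprMn mulrA.
Qed.

Lemma bessel_any : bessel (\sum_i nrm (v i)) v.
Proof.
move=> a; set A := \sum_i normc (a i) ^+ 2.
have A0 : 0 <= A by apply: sumr_ge0 => i _; exact: sqr_ge0.
rewrite -[A]sqr_sqrtr// -exprMn ler_pXn2r ?nnegrE ?mulr_ge0 ?sqrtr_ge0 ?dot_norm_ge0//.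
  apply: le_trans (dot_norm_sum_le _ _) _; rewrite mulr_suml; apply: ler_sum => i _.
  rewrite dot_normZ mulrC ler_wpM2l ?dot_norm_ge0//.
  rewrite -[normc _]ger0_norm ?normc_ge0// -sqrtr_sqr ler_wsqrtr//.
  by apply: (@sum_ge_term _ _ (fun i => normc (a i) ^+ 2)) => j; exact: sqr_ge0.
by apply: sumr_ge0 => i _; exact: dot_norm_ge0.
Qed.

(** Coefficients on [J] are extended by 0 off the image of [g]. *)
Lemma bessel_comp (J : finType) (g : J -> I) : injective g -> bessel b v ->
  bessel b (v \o g).
Proof.
move=> gi hv a.
pose a' i : C := if [pick j | g j == i] is Some j then a j else 0.
have a'g j : a' (g j) = a j.
  by rewrite /a'; case: pickP => [j' /eqP/gi -> //|/(_ j)]; rewrite eqxx.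
have a'0 i : i \notin (g @: [set: J])%SET -> a' i = 0.
  rewrite /a'; case: pickP => // j /eqP <- /negP[]; exact: imset_f.
have red (V : nmodType) (F : I -> V) : (forall i, i \notin (g @: [set: J])%SET -> F i = 0) ->
    \sum_i F i = \sum_j F (g j).
  move=> F0; rewrite (bigID (fun i => i \in (g @: [set: J])%SET))/= [X in _ + X]big1 ?addr0//.
  by rewrite big_imset /=; [apply: eq_bigl => j; rewrite inE|move=> ? ? _ _ /gi].
have := hv a'; rewrite !red => [|i ni|i ni]; last 2 first.
- by rewrite a'0// normc0 expr0n.
- by rewrite a'0// scale0r.
by under eq_bigr do rewrite a'g; under [X in _ <= _ * X]eq_bigr do rewrite a'g.
Qed.

End BesselTheory.

Lemma bessel_row (k : nat) b (v : 'M[ell2]_k) i :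
  bessel b (fun p : 'I_k * 'I_k => v p.1 p.2) -> bessel b (v i).
Proof. by apply: (@bessel_comp _ _ _ _ (fun j => (i, j))) => j j' []. Qed.

Lemma bessel_col (k : nat) b (v : 'M[ell2]_k) j :
  bessel b (fun p : 'I_k * 'I_k => v p.1 p.2) -> bessel b (v^~ j).
Proof. by apply: (@bessel_comp _ _ _ _ (fun i => (i, j))) => i i' []. Qed.

(* [row_op x] is bilinear in [x] and its argument; conjugation turns it into   *)
(* the inner product.                                                         *)
Definition conj_seq (x : ell2) : ell2 :=
  Ell2 (asboolT (square_summableJ (@ell2_summable _ x))).

Lemma conj_seqK x : conj_seq (conj_seq x) = x.
Proof. by apply/val_inj/funext => k; exact: conjCK. Qed.

Lemma nrm_conj_seq x : nrm (conj_seq x) = nrm x.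
Proof.
apply/eqP; rewrite -(@eqrXn2 _ 2) ?dot_norm_ge0// !ell2_norm_sqr; apply/eqP.
by congr (limn (series _)); apply/funext => k; rewrite normc_conj.
Qed.

Lemma row_op_conj_seq x y : row_op x (conj_seq y) = dot x y *: ell2_basis R 0.
Proof. by []. Qed.

Lemma ell2_coord_sum k x : \sum_(j < k) normc (x j) ^+ 2 <= nrm x ^+ 2.
Proof. by have := ell2_norm_ge_sum x k; rewrite big_mkord. Qed.

Lemma ell2_dot_basis x i : dot x (ell2_basis R i) = x i.
Proof.
rewrite /ell2_dot (@csum_single _ _ i) => [|k ki]; rewrite /= /delta_seq.
  by rewrite eqxx [1^*](rmorph1 Num.conj) mulr1.
by rewrite (negbTE ki) [0^*](rmorph0 Num.conj) mulr0.
Qed.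

Lemma ell2_basisE i j : (ell2_basis R i : ell2) j = (j == i)%:R :> C.
Proof. by []. Qed.

Lemma nrm_basis_sum k (c : 'I_k -> C) :
  nrm (\sum_i c i *: ell2_basis R i) ^+ 2 = \sum_i normc (c i) ^+ 2.
Proof.
apply: (@complexI R); rewrite -ell2_dot_self_nrm ell2_dot_sumr rmorph_sum.
apply: eq_bigr => i _; rewrite ell2_dotC ell2_dot_sumr rmorph_sum (bigD1 i)//= big1.
  rewrite addr0 ell2_dot_basis ell2_basisE eqxx mulr1 [(_^*)^*]conjCK.
  exact: normc_conjM.
move=> j ji; rewrite ell2_dot_basis ell2_basisE (_ : (j == i :> nat) = false) ?mulr0.
  exact: (rmorph0 Num.conj).
by apply/negbTE.
Qed.

Lemma nrm_basis i : nrm (ell2_basis R i) = 1.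
Proof.
apply/eqP; rewrite -(@eqrXn2 _ 2) ?dot_norm_ge0// expr1n.
apply/eqP/(@complexI R).
by rewrite -ell2_dot_self_nrm ell2_dot_basis ell2_basisE eqxx.
Qed.

Section RowColumn.
Variables (n : nat) (x : 'M[ell2]_n).

(** With the next lemma: the matrix norm of the row space is the norm of the conjugate-linear map y
    |-> (sum_j <x_ij, y_j>)_i from l2^n to scalar n-vectors. *)
Lemma row_space_sum (y : 'I_n -> ell2) :
  \sum_i normc (\sum_j dot (x i j) (y j)) ^+ 2 <=
  row_space R n x ^+ 2 * \sum_j nrm (y j) ^+ 2.
Proof.
have := bop_mnorm_sum (map_mx (@row_op R) x) (fun j => conj_seq (y j)).
rewrite -/(pullback _ _ _) -/(row_space R n x).
under [X in _ <= _ * X -> _]eq_bigr do rewrite hnormE nrm_conj_seq.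
move=> H; apply: le_trans H; apply: ler_sum => i _.
rewrite (eq_bigr (fun j => dot (x i j) (y j) *: ell2_basis R 0)) => [|j _]; last first.
  by rewrite mxE row_op_conj_seq.
by rewrite -scaler_suml hnormE dot_normZ nrm_basis mulr1.
Qed.

Lemma row_space_le (M : R) : 0 <= M ->
  (forall y : 'I_n -> ell2, \sum_i normc (\sum_j dot (x i j) (y j)) ^+ 2 <=
    M ^+ 2 * \sum_j nrm (y j) ^+ 2) -> row_space R n x <= M.
Proof.
move=> M0 hM; apply: bop_mnorm_le => // xi.
have := hM (fun j => conj_seq (xi j)).
under [X in _ <= _ * X -> _]eq_bigr do rewrite nrm_conj_seq.
apply: le_trans; apply: ler_sum => i _.
rewrite (eq_bigr (fun j => dot (x i j) (conj_seq (xi j)) *: ell2_basis R 0)).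
  by rewrite -scaler_suml hnormE dot_normZ nrm_basis mulr1.
by move=> j _; rewrite mxE -row_op_conj_seq conj_seqK.
Qed.

(** With the next lemma: the matrix norm of the column space is the norm of a |-> (sum_j a_j x_ij)_i
    from scalar n-vectors to l2^n, since a column operator reads only coordinate 0 of its
    argument. *)
Lemma col_space_sum (a : 'I_n -> C) :
  \sum_i nrm (\sum_j a j *: x i j) ^+ 2 <=
  col_space R n x ^+ 2 * \sum_j normc (a j) ^+ 2.
Proof.
have := bop_mnorm_sum (map_mx (@col_op R) x) (fun j => a j *: ell2_basis R 0).
under [X in _ <= _ * X -> _]eq_bigr do rewrite hnormE dot_normZ nrm_basis mulr1.
move=> H; apply: le_trans H; apply: ler_sum => i _.
rewrite [X in _ <= hnorm X ^+ 2](eq_bigr (fun j => a j *: x i j)) => [//|j _].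
by rewrite mxE bopZ; congr (_ *: _); exact: scale1r.
Qed.

Lemma col_space_le (M : R) : 0 <= M ->
  (forall a : 'I_n -> C, \sum_i nrm (\sum_j a j *: x i j) ^+ 2 <=
    M ^+ 2 * \sum_j normc (a j) ^+ 2) -> col_space R n x <= M.
Proof.
move=> M0 hM; apply: bop_mnorm_le => // xi.
apply: (@le_trans _ _ (M ^+ 2 * \sum_j normc ((xi j : ell2) 0%N) ^+ 2)); last first.
  rewrite ler_wpM2l ?sqr_ge0//; apply: ler_sum => j _.
  by rewrite ler_pXn2r ?nnegrE ?normc_ge0 ?dot_norm_ge0// ell2_norm_ge_coord.
apply: le_trans (hM (fun j => (xi j : ell2) 0%N)); apply: ler_sum => i _.
by rewrite [X in hnorm X ^+ 2 <= _](eq_bigr (fun j => (xi j : ell2) 0%N *: x i j)) => [//|j _];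
  rewrite mxE.
Qed.

End RowColumn.
End Bessel.

(** * Estimates for the six endpoint spaces *)

Section RectangularNorms.
Variable R : realType.
Local Notation C := R[i].
Local Notation ell2 := (ell2 R).
Local Notation ell2H := (ell2_hilbert R).
Local Notation nrm := (dot_norm (@ell2_dotp R)).
Local Notation dot := (@ell2_dot R).
Implicit Types (N : mnorms ell2) (b : nat -> nat -> R) (K be : R).

Definition mbessel k be (v : 'M[ell2]_k) :=
  bessel be (fun p : 'I_k * 'I_k => v p.1 p.2).

Definition zero_below m k (v : 'M[ell2]_k) :=
  forall (i j : 'I_k), (m <= i)%N -> v i j = 0.

Definition pairing k (x v : 'M[ell2]_k) : C := \sum_i \sum_j dot (x i j) (v i j).

Definition upper_rect K N b := forall m k (v : 'M[ell2]_k) be,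
  (0 < m)%N -> (m <= k)%N -> 0 <= be -> zero_below m v -> mbessel be v ->
  N k v <= K * be * b m k.

Definition lower_rect N (c : nat -> nat -> R) := forall m k (v x : 'M[ell2]_k),
  (0 < m)%N -> (m <= k)%N -> zero_below m v -> mbessel 1 v ->
  normc (pairing x v) <= c m k * N k x.

(* [N] is of order [b m k] on orthonormal families of [m * k] vectors placed  *)
(* in the first [m] rows of a [k * k] matrix.                                 *)
Record rect_norm K N b : Prop := RectNorm {
  rect_pos : forall m k, (0 < m)%N -> (m <= k)%N -> 0 < b m k;
  rect_upper : upper_rect K N b;
  rect_lower : lower_rect N (fun m k => K * (m%:R * k%:R / b m k)) }.

Lemma normc_sum_first_sqr m k (p : 'I_k -> C) : (m <= k)%N ->
  (forall i : 'I_k, (m <= i)%N -> p i = 0) ->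
  normc (\sum_i p i) ^+ 2 <= m%:R * \sum_i normc (p i) ^+ 2.
Proof.
move=> mk p0; have -> : \sum_i p i = \sum_(i < k) ((i < m)%N%:R * p i).
  by apply: eq_bigr => i _; case: ltnP => [_|/p0 ->]; rewrite ?mul1r ?mulr0.
apply: le_trans (normc_sum_CauchySchwarz _ _) _.
rewrite ler_wpM2r ?sumr_ge0// => [i _|]; first exact: sqr_ge0.
rewrite -[leRHS]mulr1; apply: sum_first_le => // i; rewrite leqNgt.
  by move=> ->; rewrite normc1 expr1n.
by move=> /negbTE ->; rewrite normc0 expr0n.
Qed.

Lemma dot_zero_below m k (v : 'M[ell2]_k) y (i j : 'I_k) : zero_below m v ->
  (m <= i)%N -> dot y (v i j) = 0.
Proof. by move=> v0 mi; rewrite v0// ell2_dotC ell2_dot0l [LHS](rmorph0 Num.conj). Qed.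

Lemma pairing_le_rows m k (v x : 'M[ell2]_k) (M : R) : (m <= k)%N -> zero_below m v ->
  0 <= M -> \sum_(i : 'I_k) normc (\sum_j dot (x i j) (v i j)) ^+ 2 <= M ^+ 2 ->
  normc (pairing x v) <= Num.sqrt m%:R * M.
Proof.
move=> mk v0 M0 hM.
rewrite -(@ler_pXn2r _ 2)// ?nnegrE ?mulr_ge0 ?sqrtr_ge0 ?normc_ge0//.
rewrite exprMn sqr_sqrtr ?ler0n//.
apply: le_trans (ler_wpM2l (ler0n _ m) hM); apply: normc_sum_first_sqr => // i mi.
by rewrite big1// => j _; exact: dot_zero_below mi.
Qed.

Lemma mbessel_dual k be (v : 'M[ell2]_k) xi : mbessel be v ->
  \sum_i \sum_j normc (dot xi (v i j)) ^+ 2 <= be ^+ 2 * nrm xi ^+ 2.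
Proof.
move=> hv; have := bessel_dual xi hv.
by rewrite -(pair_bigA _ (fun i j => normc (dot xi (v i j)) ^+ 2)).
Qed.

Lemma mbessel_entry k be (v : 'M[ell2]_k) i j : 0 <= be -> mbessel be v ->
  nrm (v i j) <= be.
Proof.
move=> b0 hv.
exact: (@bessel_entry _ _ be (fun p : 'I_k * 'I_k => v p.1 p.2) (i, j)).
Qed.

Lemma mbesselZ k be (v : 'M[ell2]_k) (c : C) : mbessel be v ->
  mbessel (normc c * be) (map_mx (fun y => c *: y) v).
Proof.
move=> /(bessel_scale c) hv a; have := hv a.
by under [in X in _ -> X]eq_bigr do rewrite mxE.
Qed.

Lemma zero_belowZ m k (v : 'M[ell2]_k) (c : C) : zero_below m v ->
  zero_below m (map_mx (fun y => c *: y) v).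
Proof. by move=> v0 i j mi; rewrite mxE v0// scaler0. Qed.

Lemma pairingZr k (x v : 'M[ell2]_k) (c : C) :
  pairing x (map_mx (fun y => c *: y) v) = c^* * pairing x v.
Proof.
rewrite mulr_sumr; apply: eq_bigr => i _; rewrite mulr_sumr; apply: eq_bigr => j _.
by rewrite mxE ell2_dotZr.
Qed.

(** * The row and column spaces *)

Section RowColumnSpaces.
Variables (m k : nat).
Hypothesis mk : (m <= k)%N.

(** Cauchy-Schwarz over the [k] columns costs the factor [k]; in column [j] the dual Bessel bound
    applies to [y j]. *)
Lemma row_space_upper (v : 'M[ell2]_k) be : 0 <= be -> mbessel be v ->
  row_space R k v <= be * Num.sqrt k%:R.
Proof.
move=> b0 hv; apply: row_space_le => [|y]; first by rewrite mulr_ge0// sqrtr_ge0.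
rewrite exprMn sqr_sqrtr ?ler0n//.
apply: (@le_trans _ _ (\sum_(i < k) k%:R * \sum_j normc (dot (v i j) (y j)) ^+ 2)).
  by apply: ler_sum => i _; apply: le_trans (normc_sum_sqr_le_card _) _; rewrite card_ord.
rewrite -mulr_sumr [be ^+ 2 * _]mulrC -mulrA ler_wpM2l ?ler0n// exchange_big mulr_sumr.
apply: ler_sum => j _ /=.
rewrite (eq_bigr (fun i => normc (dot (y j) (v i j)) ^+ 2)) => [|i _]; last first.
  by rewrite normc_dotC.
exact: (bessel_dual (y j) (bessel_col j hv)).
Qed.

Lemma col_space_upper (v : 'M[ell2]_k) be : 0 <= be -> zero_below m v -> mbessel be v ->
  col_space R k v <= be * Num.sqrt m%:R.
Proof.
move=> b0 v0 hv; apply: col_space_le => [|a]; first by rewrite mulr_ge0// sqrtr_ge0.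
rewrite exprMn sqr_sqrtr ?ler0n// [be ^+ 2 * _]mulrC -mulrA; apply: sum_first_le => //.
  by move=> i _; exact: (bessel_row i hv).
move=> i mi; rewrite big1 ?dot_norm0 ?expr0n// => j _.
by rewrite v0// scaler0.
Qed.

(** Row [i] of the pairing is the row norm tested on the vectors [v i j], whose squared norms add up
    to at most [k]. *)
Lemma row_space_lower (v x : 'M[ell2]_k) : zero_below m v -> mbessel 1 v ->
  normc (pairing x v) <= m%:R * Num.sqrt k%:R * row_space R k x.
Proof.
move=> v0 hv; apply: le_trans (normc_sum_le _) _; rewrite -mulrA.
apply: sum_first_le => // i mi; last first.
  by rewrite big1 ?normc0// => j _; exact: dot_zero_below mi.
have N0 : 0 <= row_space R k x by exact: bop_mnorm_ge0.
rewrite -(@ler_pXn2r _ 2)// ?nnegrE ?mulr_ge0 ?sqrtr_ge0 ?normc_ge0//.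
rewrite exprMn sqr_sqrtr ?ler0n//.
apply: le_trans (le_trans _ (row_space_sum x (v i))) _.
  apply: (@sum_ge_term _ _ (fun i' => normc (\sum_j dot (x i' j) (v i j)) ^+ 2) i).
  by move=> j; exact: sqr_ge0.
rewrite mulrC ler_wpM2r ?sqr_ge0// -[k in k%:R]card_ord -sumr_const.
by apply: ler_sum => j _; rewrite expr_le1// ?dot_norm_ge0// mbessel_entry.
Qed.

Lemma col_space_entries (x : 'M[ell2]_k) j :
  \sum_i nrm (x i j) ^+ 2 <= col_space R k x ^+ 2.
Proof.
have := col_space_sum x (fun j' => (j' == j)%:R).
have -> : \sum_j' normc ((j' == j)%:R : C) ^+ 2 = 1.
  rewrite (bigD1 j)//= big1 => [|j' /negbTE ->]; last by rewrite normc0 expr0n.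
  by rewrite eqxx normc1 expr1n addr0.
rewrite mulr1; apply: le_trans.
apply: ler_sum => i _; rewrite (bigD1 j)//= big1 => [|j' /negbTE ->]; last first.
  by rewrite scale0r.
by rewrite eqxx scale1r addr0.
Qed.

(** Column by column: a column of [x] has l2-norm at most that of [x], and the pairing uses [m] of
    its entries, each against a vector of norm at most 1. *)
Lemma col_space_lower (v x : 'M[ell2]_k) : zero_below m v -> mbessel 1 v ->
  normc (pairing x v) <= k%:R * Num.sqrt m%:R * col_space R k x.
Proof.
move=> v0 hv; rewrite /pairing exchange_big; apply: le_trans (normc_sum_le _) _.
rewrite -mulrA -[k in k%:R]card_ord -sumr_const mulr_suml; apply: ler_sum => j _.
have N0 : 0 <= col_space R k x by exact: bop_mnorm_ge0.
rewrite mul1r -(@ler_pXn2r _ 2)// ?nnegrE ?mulr_ge0 ?sqrtr_ge0 ?normc_ge0//.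
rewrite exprMn sqr_sqrtr ?ler0n//.
apply: le_trans (normc_sum_first_sqr mk _) _ => [i mi|]; first exact: dot_zero_below mi.
rewrite ler_wpM2l ?ler0n//; apply: le_trans (col_space_entries x j).
apply: ler_sum => i _.
rewrite ler_pXn2r ?nnegrE ?normc_ge0 ?dot_norm_ge0//; apply: le_trans (ell2_dot_le _ _) _.
by rewrite -[leRHS]mulr1 ler_wpM2l ?dot_norm_ge0// mbessel_entry.
Qed.

End RowColumnSpaces.

(** * The minimal structure *)

Section MinSpace.

Definition dot_with (w : ell2) : ell2 -> C := fun y => dot y w.

Lemma dot_with_linear w : scalar (dot_with w).
Proof. by move=> a y y'; exact: ell2_dot_linear. Qed.

HB.instance Definition _ w :=
  GRing.isLinear.Build C ell2 C *%R (dot_with w) (dot_with_linear w).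

Lemma ccol_norm_sqr n (x : 'cV[C]_n) : ccol_norm x ^+ 2 = \sum_i normc (x i ord0) ^+ 2.
Proof. by rewrite sqr_sqrtr// sumr_ge0// => i _; exact: sqr_ge0. Qed.

Lemma ccol_norm0 n : ccol_norm (0 : 'cV[C]_n) = 0.
Proof.
by apply/eqP; rewrite -sqrf_eq0 ccol_norm_sqr big1// => i _; rewrite mxE normc0 expr0n.
Qed.

Lemma ccol_mulmx_le n (A : 'M[C]_n) (M : R) (x : 'cV[C]_n) : 0 <= M ->
  \sum_i \sum_j normc (A i j) ^+ 2 <= M ^+ 2 -> ccol_norm x <= 1 ->
  ccol_norm (A *m x) <= M.
Proof.
move=> M0 hM x1; rewrite -(@ler_pXn2r _ 2)// ?nnegrE ?sqrtr_ge0//.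
apply: le_trans hM; rewrite ccol_norm_sqr; apply: ler_sum => i _; rewrite mxE.
apply: le_trans (normc_sum_CauchySchwarz _ _) _; rewrite -[leRHS]mulr1.
rewrite ler_wpM2l ?sumr_ge0// => [j _|]; first exact: sqr_ge0.
by rewrite -ccol_norm_sqr expr_le1// sqrtr_ge0.
Qed.

Lemma cmx_norm_le n (A : 'M[C]_n) (M : R) : 0 <= M ->
  \sum_i \sum_j normc (A i j) ^+ 2 <= M ^+ 2 -> cmx_norm A <= M.
Proof.
move=> M0 hM; apply: ge_sup.
  by exists (ccol_norm (A *m 0)), 0 => //=; rewrite ccol_norm0.
by move=> _ [x /= x1 <-]; exact: ccol_mulmx_le.
Qed.

Lemma cmx_norm_entry n (A : 'M[C]_n) i j : normc (A i j) <= cmx_norm A.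
Proof.
pose S := \sum_i \sum_j normc (A i j) ^+ 2.
have S0 : 0 <= S.
  by apply: sumr_ge0 => i' _; apply: sumr_ge0 => j' _; exact: sqr_ge0.
apply: (@le_trans _ _ (ccol_norm (A *m delta_mx j ord0))).
  rewrite -(@ler_pXn2r _ 2)// ?nnegrE ?sqrtr_ge0 ?normc_ge0// ccol_norm_sqr.
  rewrite -colE; have -> : A i j = col j A i ord0 by rewrite mxE.
  apply: (@sum_ge_term _ _ (fun i => normc (col j A i ord0) ^+ 2)) => i'.
  exact: sqr_ge0.
apply: ub_le_sup.
  exists (Num.sqrt S) => _ [x /= x1 <-]; apply: ccol_mulmx_le => //.
  by rewrite sqr_sqrtr.
exists (delta_mx j ord0) => //=.
rewrite -(@ler_pXn2r _ 2)// ?nnegrE ?sqrtr_ge0// ccol_norm_sqr expr1n.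
rewrite (bigD1 j)//= big1 => [|i' /negbTE ij]; last by rewrite mxE ij normc0 expr0n.
by rewrite mxE !eqxx normc1 expr1n addr0.
Qed.

(** The functional is tested on the combination of the [v i] with coefficients the conjugates of
    [phi (v i)]. It follows that the scalar matrices in the minimal norm are bounded already in the
    Hilbert-Schmidt norm. *)
Lemma functional_bessel (I : finType) be (v : I -> ell2) (phi : {scalar ell2}) :
  (forall y, normc (phi y) <= nrm y) -> bessel be v ->
  \sum_i normc (phi (v i)) ^+ 2 <= be ^+ 2.
Proof.
move=> hphi hv; set S := \sum_i _.
have S0 : 0 <= S by apply: sumr_ge0 => i _; exact: sqr_ge0.
pose w := \sum_i (phi (v i))^* *: v i.
have pw : phi w = S%:C%C.
  rewrite linear_sum rmorph_sum; apply: eq_bigr => i _.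
  by rewrite linearZ /=; exact: normc_conjM.
have : S ^+ 2 <= be ^+ 2 * S.
  apply: (@le_trans _ _ (nrm w ^+ 2)).
    rewrite ler_pXn2r ?nnegrE ?dot_norm_ge0//; apply: le_trans (hphi w).
    by rewrite pw normc_real ler_norm.
  by apply: le_trans (hv _) _; under eq_bigr do rewrite normc_conj.
have [->|Sn] := eqVneq S 0; first by rewrite sqr_ge0.
by rewrite expr2 ler_pM2r// lt_def Sn.
Qed.

Lemma cmx_norm_functional k (v : 'M[ell2]_k) be (phi : {scalar ell2}) : 0 <= be ->
  (forall y, normc (phi y) <= nrm y) -> mbessel be v -> cmx_norm (map_mx phi v) <= be.
Proof.
move=> b0 hphi hv; apply: cmx_norm_le => //.
under eq_bigr do under eq_bigr do rewrite mxE.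
by rewrite (pair_bigA _ (fun i j => normc (phi (v i j)) ^+ 2)); exact: functional_bessel.
Qed.

Lemma min_space_upper k (v : 'M[ell2]_k) be : 0 <= be -> mbessel be v ->
  min_space R k v <= be.
Proof.
move=> b0 hv; apply: ge_sup.
  exists (cmx_norm (map_mx (dot_with 0) v)), (dot_with 0 : {scalar ell2}) => // y.
  by apply: le_trans (ell2_dot_le _ _) _; rewrite dot_norm0 mulr0 dot_norm_ge0.
by move=> _ [phi hphi <-]; exact: cmx_norm_functional.
Qed.

(** The norming functional is the inner product with the normalized entry. *)
Lemma min_space_entry k (x : 'M[ell2]_k) i j : nrm (x i j) <= min_space R k x.
Proof.
have [x0|xn] := eqVneq (nrm (x i j)) 0.
  by rewrite x0; apply: sup_nonneg => _ [phi _ <-]; apply: sup_nonneg => _ [y _ <-]; exact: sqrtr_ge0.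
have px : 0 < nrm (x i j) by rewrite lt_def xn dot_norm_ge0.
pose w := ((nrm (x i j))^-1)%:C%C *: x i j.
have nw : nrm w = 1 by rewrite dot_normZ normc_real ger0_norm ?mulVf// invr_ge0 ltW.
have le : nrm (x i j) <= cmx_norm (map_mx (dot_with w) x).
  apply: le_trans (cmx_norm_entry _ i j); rewrite mxE /dot_with ell2_dotZr normcM normc_conj.
  rewrite normc_real ell2_dot_self_nrm normc_real !ger0_norm ?sqr_ge0 ?invr_ge0 ?(ltW px)//.
  by rewrite expr2 mulrA mulVf// mul1r.
apply: le_trans le _; apply: ub_le_sup; last first.
  exists (dot_with w : {scalar ell2}) => // y; apply: le_trans (ell2_dot_le _ _) _.
  by rewrite nw mulr1.
exists (\sum_p nrm (x p.1 p.2)) => _ [phi hphi <-].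
apply: cmx_norm_functional => //; last exact: bessel_any.
by apply: sumr_ge0 => p _; exact: dot_norm_ge0.
Qed.

Lemma min_space_lower m k (v x : 'M[ell2]_k) : (m <= k)%N -> zero_below m v ->
  mbessel 1 v -> normc (pairing x v) <= m%:R * k%:R * min_space R k x.
Proof.
move=> mk v0 hv; apply: le_trans (normc_sum_le _) _; rewrite -mulrA.
apply: sum_first_le => // i mi; last first.
  by rewrite big1 ?normc0// => j _; exact: dot_zero_below mi.
apply: le_trans (normc_sum_le _) _.
rewrite -[k in k%:R]card_ord -sumr_const mulr_suml; apply: ler_sum => j _.
rewrite mul1r; apply: le_trans (min_space_entry x i j); apply: le_trans (ell2_dot_le _ _) _.
by rewrite -[leRHS]mulr1 ler_wpM2l ?dot_norm_ge0// mbessel_entry.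
Qed.

End MinSpace.
End RectangularNorms.

(** * The maximal structure and the sum of R and C, tested by Hilbert-Schmidt-valued maps *)

Section MaxPlusSpaces.
Variable R : realType.
Local Notation C := R[i].
Local Notation ell2 := (ell2 R).
Local Notation ell2H := (ell2_hilbert R).
Local Notation nrm := (dot_norm (@ell2_dotp R)).
Local Notation dot := (@ell2_dot R).

(* [bessel_op v y] has matrix [dot y (v i j)] in the canonical basis.         *)
Definition bessel_op_fun k (v : 'M[ell2]_k) (y : ell2) (xi : ell2H) : ell2H :=
  \sum_(i < k) (\sum_(j < k) (xi : ell2) j * dot y (v i j)) *: ell2_basis R i.

Lemma nrm_bessel_op k (v : 'M[ell2]_k) y xi : nrm (bessel_op_fun v y xi) ^+ 2 =
  \sum_(i < k) normc (\sum_(j < k) (xi : ell2) j * dot y (v i j)) ^+ 2.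
Proof. exact: nrm_basis_sum. Qed.

Lemma nrm_bessel_op_le k (v : 'M[ell2]_k) y xi : nrm (bessel_op_fun v y xi) ^+ 2 <=
  (\sum_i \sum_j normc (dot y (v i j)) ^+ 2) * nrm xi ^+ 2.
Proof.
rewrite nrm_bessel_op mulr_suml; apply: ler_sum => i _.
apply: le_trans (normc_sum_CauchySchwarz _ _) _; rewrite mulrC ler_wpM2l ?ell2_coord_sum//.
by apply: sumr_ge0 => j _; exact: sqr_ge0.
Qed.

Lemma bessel_op_funP k (v : 'M[ell2]_k) y : bessel_op_fun v y \in @bop_pred R ell2H.
Proof.
apply/asboolP; split.
  move=> a xi eta; rewrite /bessel_op_fun scaler_sumr -big_split; apply: eq_bigr => i _ /=.
  rewrite scalerA -scalerDl; congr (_ *: _); rewrite mulr_sumr -big_split.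
  by apply: eq_bigr => j _ /=; rewrite mulrDl mulrA.
set S := \sum_i \sum_j normc (dot y (v i j)) ^+ 2.
have S0 : 0 <= S by apply: sumr_ge0 => i _; apply: sumr_ge0 => j _; exact: sqr_ge0.
exists (Num.sqrt S) => xi.
rewrite -(@ler_pXn2r _ 2)// ?nnegrE ?mulr_ge0 ?sqrtr_ge0 ?dot_norm_ge0//.
by rewrite exprMn (sqr_sqrtr S0); exact: nrm_bessel_op_le.
Qed.

Definition bessel_op k (v : 'M[ell2]_k) (y : ell2) : bop ell2H := Bop (bessel_op_funP v y).

Lemma bessel_op_linear k (v : 'M[ell2]_k) : linear (bessel_op v).
Proof.
move=> a y y'; apply/val_inj/funext => xi.
transitivity (a *: bessel_op_fun v y xi + bessel_op_fun v y' xi); last by [].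
rewrite /= /bessel_op_fun scaler_sumr -big_split; apply: eq_bigr => i _ /=.
rewrite scalerA -scalerDl; congr (_ *: _); rewrite mulr_sumr -big_split.
by apply: eq_bigr => j _ /=; rewrite ell2_dot_linear mulrDr mulrCA.
Qed.

HB.instance Definition _ k (v : 'M[ell2]_k) :=
  GRing.isLinear.Build C ell2 (bop ell2H) *:%R (bessel_op v) (bessel_op_linear v).

(** The operator matrix is applied to the column of the basis vectors e_j, of norm sqrt k:
    coordinate i of its i-th component is the i-th row of the pairing, and only the first [m] rows
    count. Lower estimates are thus reduced to contractivity of [bessel_op v]. *)
Lemma bessel_op_pairing m k (v x : 'M[ell2]_k) : (m <= k)%N -> zero_below m v ->
  normc (pairing x v) <=
  Num.sqrt m%:R * (Num.sqrt k%:R * bop_mnorm (map_mx (bessel_op v) x)).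
Proof.
move=> mk v0; apply: pairing_le_rows => //.
  by rewrite mulr_ge0 ?sqrtr_ge0 ?bop_mnorm_ge0.
rewrite exprMn sqr_sqrtr ?ler0n// mulrC.
have := bop_mnorm_sum (map_mx (bessel_op v) x) (fun j => ell2_basis R j).
have -> : \sum_(j < k) hnorm (ell2_basis R j : ell2H) ^+ 2 = k%:R.
  rewrite -[k in k%:R]card_ord -sumr_const; apply: eq_bigr => j _.
  by rewrite hnormE nrm_basis expr1n.
apply: le_trans; apply: ler_sum => i _.
have -> : \sum_j map_mx (bessel_op v) x i j (ell2_basis R j) =
    \sum_(i' < k) (\sum_j dot (x i j) (v i' j)) *: ell2_basis R i' :> ell2.
  under [RHS]eq_bigr do rewrite scaler_suml.
  rewrite exchange_big; apply: eq_bigr => j _; rewrite mxE.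
  rewrite -[LHS]/(bessel_op_fun v (x i j) (ell2_basis R j)); apply: eq_bigr => i' _.
  congr (_ *: _); rewrite (bigD1 j)//= big1 ?addr0 => [|j' jj'].
    by rewrite /delta_seq eqxx mul1r.
  by rewrite /delta_seq (_ : (j' == j :> nat) = false) ?mul0r//; exact/negbTE.
rewrite hnormE nrm_basis_sum.
apply: (@sum_ge_term _ _ (fun i' => normc (\sum_j dot (x i j) (v i' j)) ^+ 2)) => i'.
exact: sqr_ge0.
Qed.

(** The images [u (v i j)] have norm at most [be], and an m x k block of such operators has norm at
    most [be] times sqrt(mk). *)
Lemma max_space_upper m k (v : 'M[ell2]_k) be : (m <= k)%N -> 0 <= be ->
  zero_below m v -> mbessel be v -> max_space R k v <= be * Num.sqrt (m%:R * k%:R).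
Proof.
move=> mk b0 v0 hv.
have nn : 0 <= be * Num.sqrt (m%:R * k%:R) by rewrite mulr_ge0 ?sqrtr_ge0.
have key (H : hilbert R) (u : {linear ell2 -> bop H}) :
    (forall y, bop_norm (u y) <= nrm y) ->
    bop_mnorm (map_mx u v) <= be * Num.sqrt (m%:R * k%:R).
  move=> hu; apply: bop_mnorm_le => // x; rewrite exprMn sqr_sqrtr ?mulr_ge0 ?ler0n//.
  set S := \sum_j hnorm (x j) ^+ 2.
  have -> : be ^+ 2 * (m%:R * k%:R) * S = m%:R * (k%:R * (be ^+ 2 * S)) by ring.
  apply: sum_first_le => // i mi; last first.
    rewrite big1 ?/hnorm ?dot_norm0 ?expr0n// => j _.
    by rewrite mxE v0// linear0.
  rewrite /S mulr_sumr -[k in k%:R]card_ord.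
  apply: (@le_trans _ _ ((\sum_j be * hnorm (x j)) ^+ 2)); last first.
    apply: le_trans (sum_sqr_le_card _) _; rewrite ler_wpM2l ?ler0n//.
    by apply: ler_sum => j _; rewrite exprMn.
  rewrite ler_pXn2r ?nnegrE ?dot_norm_ge0 ?sumr_ge0// => [|j _]; last first.
    by rewrite mulr_ge0 ?hnorm_ge0.
  apply: le_trans (dot_norm_sum_le _ _) _; apply: ler_sum => j _; rewrite mxE.
  apply: le_trans (bop_norm_ub _ _) _; rewrite ler_wpM2r ?hnorm_ge0//.
  by apply: le_trans (hu _) _; exact: mbessel_entry.
apply: ge_sup => [|_ [H [u [hu ->]]]]; last exact: key.
(* The zero map, as [bessel_op] of the empty matrix, shows that the supremum is over a nonempty
   set. *)
exists (bop_mnorm (map_mx (bessel_op (0 : 'M[ell2]_0)) v)), ell2H,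
  (bessel_op (0 : 'M[ell2]_0) : {linear ell2 -> bop ell2H}); split => // y.
apply: bop_norm_le => [|xi]; first exact: dot_norm_ge0.
rewrite -[X in hnorm X]/(bessel_op_fun _ y xi) /bessel_op_fun big_ord0 /hnorm dot_norm0.
by rewrite mulr_ge0 ?dot_norm_ge0.
Qed.

(** The dual Bessel bound controls even the Hilbert-Schmidt norm of [bessel_op v y]. *)
Lemma bessel_op_contraction k (v : 'M[ell2]_k) y : mbessel 1 v ->
  bop_norm (bessel_op v y) <= nrm y.
Proof.
move=> hv; apply: bop_norm_le => [|xi]; first exact: dot_norm_ge0.
rewrite -(@ler_pXn2r _ 2)// ?nnegrE ?mulr_ge0 ?dot_norm_ge0// exprMn.
apply: le_trans (nrm_bessel_op_le _ _ _) _; rewrite ler_wpM2r ?sqr_ge0//.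
by apply: le_trans (mbessel_dual y hv) _; rewrite expr1n mul1r.
Qed.

Lemma max_space_lower m k (v x : 'M[ell2]_k) : (m <= k)%N -> zero_below m v ->
  mbessel 1 v -> normc (pairing x v) <= Num.sqrt (m%:R * k%:R) * max_space R k x.
Proof.
move=> mk v0 hv; apply: le_trans (bessel_op_pairing x mk v0) _.
rewrite mulrA sqrtrM ?ler0n// ler_wpM2l ?mulr_ge0 ?sqrtr_ge0//.
apply: ub_le_sup; last first.
  exists ell2H, (bessel_op v : {linear ell2 -> bop ell2H}); split => // y.
  exact: bessel_op_contraction.
(* A crude bound, uniform in the contraction [u], makes the supremum a true one. *)
pose s := \sum_(p : 'I_k * 'I_k) nrm (x p.1 p.2).
have s0 : 0 <= s by apply: sumr_ge0 => p _; exact: dot_norm_ge0.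
exists (k%:R * s) => _ [H [u [hu ->]]].
apply: bop_mnorm_le => [|xi]; first by rewrite mulr_ge0.
apply: (@le_trans _ _ (\sum_(i < k) (s * \sum_j hnorm (xi j)) ^+ 2)).
  apply: ler_sum => i _; rewrite ler_pXn2r ?nnegrE ?dot_norm_ge0//; last first.
    by apply: mulr_ge0 => //; apply: sumr_ge0 => j _; exact: hnorm_ge0.
  apply: le_trans (dot_norm_sum_le _ _) _; rewrite mulr_sumr; apply: ler_sum => j _.
  rewrite mxE; apply: le_trans (bop_norm_ub _ _) _; rewrite ler_wpM2r ?hnorm_ge0//.
  apply: le_trans (hu _) _.
  apply: (@sum_ge_term _ _ (fun p : 'I_k * 'I_k => nrm (x p.1 p.2)) (i, j)) => p.
  exact: dot_norm_ge0.
set T := (X in _ <= _ * X).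
have -> : (k%:R * s) ^+ 2 * T = k%:R * s ^+ 2 * (k%:R * T) by ring.
rewrite sumr_const card_ord -[leLHS]mulr_natl exprMn [leLHS]mulrA.
apply: ler_wpM2l; first by rewrite mulr_ge0 ?ler0n ?sqr_ge0.
by apply: le_trans (sum_sqr_le_card _) _; rewrite card_ord.
Qed.

(** Coordinate [i] of the output is the row estimate for [z] tested on [eta i]. Each of the [k]
    coordinates contributes [be ^+ 2], and the normalization makes the total 1. *)
Lemma bessel_op_row_contraction k (v : 'M[ell2]_k) (be : R) : be ^+ 2 * k%:R = 1 ->
  mbessel be v -> complete_contraction (row_space R) (bessel_op v).
Proof.
move=> bk hv n z; have N0 : 0 <= row_space R n z by exact: bop_mnorm_ge0.
apply: bop_mnorm_le => // xi.
pose eta (i : 'I_k) p : ell2 := \sum_(j < k) ((xi p : ell2) j)^* *: v i j.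
have E q : hnorm (\sum_p map_mx (bessel_op v) z q p (xi p)) ^+ 2 =
    \sum_(i < k) normc (\sum_p dot (z q p) (eta i p)) ^+ 2.
  have -> : \sum_p map_mx (bessel_op v) z q p (xi p) =
      \sum_(i < k) (\sum_p dot (z q p) (eta i p)) *: ell2_basis R i :> ell2.
    under [RHS]eq_bigr do rewrite scaler_suml.
    rewrite exchange_big; apply: eq_bigr => p _; rewrite mxE.
    rewrite -[LHS]/(bessel_op_fun v (z q p) (xi p)); apply: eq_bigr => i _.
    congr (_ *: _); rewrite ell2_dot_sumr; apply: eq_bigr => j _.
    by congr (_ * _); exact/esym/conjCK.
  by rewrite hnormE nrm_basis_sum.
under eq_bigr do rewrite E.
rewrite exchange_big /=.
apply: (@le_trans _ _ (\sum_(i < k) row_space R n z ^+ 2 *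
    (be ^+ 2 * \sum_p nrm (xi p) ^+ 2))).
  apply: ler_sum => i _; apply: le_trans (row_space_sum z (eta i)) _.
  rewrite ler_wpM2l ?sqr_ge0// mulr_sumr; apply: ler_sum => p _.
  apply: le_trans (bessel_row i hv _) _; rewrite ler_wpM2l ?sqr_ge0//.
  by under eq_bigr do rewrite normc_conj; exact: ell2_coord_sum.
rewrite sumr_const card_ord -mulr_natr; set S := \sum_p _; set N := row_space R n z.
have -> : N ^+ 2 * (be ^+ 2 * S) * k%:R = be ^+ 2 * k%:R * (N ^+ 2 * S) by ring.
by rewrite bk mul1r.
Qed.

(** Here the factor [k] comes from Cauchy-Schwarz over the columns of [v], and [be ^+ 2] from the
    dual Bessel bound in each column. *)
Lemma bessel_op_col_contraction k (v : 'M[ell2]_k) (be : R) : be ^+ 2 * k%:R = 1 ->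
  mbessel be v -> complete_contraction (col_space R) (bessel_op v).
Proof.
move=> bk hv n z; have N0 : 0 <= col_space R n z by exact: bop_mnorm_ge0.
apply: bop_mnorm_le => // xi.
pose g q (j : 'I_k) : ell2 := \sum_p (xi p : ell2) j *: z q p.
have E q : hnorm (\sum_p map_mx (bessel_op v) z q p (xi p)) ^+ 2 =
    \sum_(i < k) normc (\sum_j dot (g q j) (v i j)) ^+ 2.
  have -> : \sum_p map_mx (bessel_op v) z q p (xi p) =
      \sum_(i < k) (\sum_j dot (g q j) (v i j)) *: ell2_basis R i :> ell2.
    rewrite (eq_bigr (fun p => bessel_op_fun v (z q p) (xi p))) => [|p _]; last first.
      by rewrite mxE.
    rewrite exchange_big; apply: eq_bigr => i _ /=; rewrite -scaler_suml; congr (_ *: _).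
    by rewrite exchange_big; apply: eq_bigr => j _; rewrite ell2_dot_suml.
  by rewrite hnormE nrm_basis_sum.
under eq_bigr do rewrite E.
apply: (@le_trans _ _ (\sum_q \sum_(j < k) nrm (g q j) ^+ 2)).
  apply: ler_sum => q _.
  apply: (@le_trans _ _ (\sum_(i < k) k%:R * \sum_j normc (dot (g q j) (v i j)) ^+ 2)).
    by apply: ler_sum => i _; apply: le_trans (normc_sum_sqr_le_card _) _; rewrite card_ord.
  rewrite -mulr_sumr exchange_big mulr_sumr; apply: ler_sum => j _ /=.
  apply: le_trans (ler_wpM2l (ler0n _ k) (bessel_dual (g q j) (bessel_col j hv))) _.
  by rewrite mulrA [k%:R * _]mulrC bk mul1r.
rewrite exchange_big /=.
apply: (@le_trans _ _ (\sum_(j < k) col_space R n z ^+ 2 *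
    \sum_p normc ((xi p : ell2) j) ^+ 2)).
  by apply: ler_sum => j _; exact: (col_space_sum z).
rewrite -mulr_sumr ler_wpM2l ?sqr_ge0// exchange_big; apply: ler_sum => p _.
exact: ell2_coord_sum.
Qed.

Local Notation l1RC := (l1_mnorm (row_space R) (col_space R)).

(* [u] takes the same value on all the representatives of a class when it is  *)
(* used on both summands.                                                     *)
Lemma plus_space_ge k (x : 'M[ell2]_k) (u : {linear ell2 -> bop ell2H}) :
  complete_contraction (row_space R) u -> complete_contraction (col_space R) u ->
  bop_mnorm (map_mx u x) <= plus_space R k x.
Proof.
move=> ur uc; apply: lb_le_inf.
  exists (l1RC (map_mx (fun y => (y, 0)) x + 0)), 0 => // i j /=.
  by rewrite mxE; exists 0; rewrite oppr0.
move=> _ [dl /= hdl <-]; set z := _ + dl.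
apply: ub_le_sup.
  exists (k%:R * (row_space R k (map_mx fst z) + col_space R k (map_mx snd z))).
  move=> _ [H [u1 [u2 [c1 c2 ->]]]]; apply: le_trans (bop_mnormD_le _ _) _.
  by apply: ler_wpM2l; [exact: ler0n|apply: lerD; [exact: c1|exact: c2]].
exists ell2H, u, u; split; [exact: ur|exact: uc|congr (bop_mnorm _)].
apply/matrixP => i j.
rewrite !mxE -linearD; congr (u _); have [y ->] := hdl i j.
by rewrite /= sub0r addrK.
Qed.

(** The class of [x] has the representative (0, x). *)
Lemma plus_space_le_col k (x : 'M[ell2]_k) : plus_space R k x <= col_space R k x.
Proof.
apply: (@le_trans _ _ (l1RC (map_mx (fun y => (0, y)) x))).
  apply: ge_inf.
    by exists 0 => _ [dl _ <-]; apply: sup_nonneg => _ [H [u1 [u2 [_ _ ->]]]]; exact: bop_mnorm_ge0.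
  exists (map_mx (fun y => (- y, y)) x) => [i j|]; first by rewrite mxE; exists (- x i j); rewrite opprK.
  congr (l1RC _); apply/matrixP => i j; rewrite !mxE; congr (_, _) => /=; first by rewrite subrr.
  by rewrite add0r.
apply: ge_sup.
  have c0 N : (forall n z, 0 <= N n z) ->
      complete_contraction N (bessel_op (0 : 'M[ell2]_0)).
    move=> N0 n z; apply: le_trans _ (N0 n z); apply: bop_mnorm_le => // xi.
    rewrite expr0n mul0r big1// => i _; rewrite big1 ?hnormE ?dot_norm0 ?expr0n// => j _.
    by rewrite mxE -[LHS]/(bessel_op_fun _ (z i j) (xi j)) /bessel_op_fun big_ord0.
  by eexists; exists ell2H, (bessel_op (0 : 'M[ell2]_0)), (bessel_op (0 : 'M[ell2]_0));
    split; [apply: c0 => n z; exact: bop_mnorm_ge0|apply: c0 => n z; exact: bop_mnorm_ge0|reflexivity].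
move=> _ [H [u1 [u2 [c1 c2 ->]]]]; apply: le_trans (c2 k x).
rewrite le_eqVlt; apply/orP; left; apply/eqP; congr (bop_mnorm _); apply/matrixP => i j.
by rewrite !mxE linear0 add0r.
Qed.

(** Divided by sqrt k, the family [v] gives a [bessel_op] that is completely contractive on both R
    and C, so [plus_space_ge] applies. The rescaling costs sqrt k on top of the factors sqrt m and
    sqrt k of [bessel_op_pairing]. *)
Lemma plus_space_lower m k (v x : 'M[ell2]_k) : (0 < m)%N -> (m <= k)%N -> zero_below m v ->
  mbessel 1 v -> normc (pairing x v) <= k%:R * Num.sqrt m%:R * plus_space R k x.
Proof.
move=> m0 mk v0 hv; have k0 : 0 < k%:R :> R by rewrite ltr0n (leq_trans m0).
have s0 : 0 < Num.sqrt k%:R :> R by rewrite sqrtr_gt0.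
pose c := (Num.sqrt k%:R)^-1 : R.
have c0 : 0 <= c by rewrite invr_ge0 ltW.
have nc : normc (c%:C%C) = c by rewrite normc_real ger0_norm.
have ck : (normc c%:C%C * 1) ^+ 2 * k%:R = 1.
  by rewrite nc mulr1 exprVn sqr_sqrtr ?ler0n// mulVf// gt_eqF.
have hw := mbesselZ c%:C%C hv; have w0 := zero_belowZ c%:C%C v0.
set w := map_mx _ v in hw w0.
have := le_trans (bessel_op_pairing x mk w0) (ler_wpM2l (sqrtr_ge0 _) (ler_wpM2l (sqrtr_ge0 _)
  (plus_space_ge x (bessel_op_row_contraction ck hw) (bessel_op_col_contraction ck hw)))).
rewrite pairingZr normcM normc_conj nc mulrC -ler_pdivlMr ?invr_gt0// invrK => H.
apply: le_trans H _; rewrite le_eqVlt; apply/orP; left; apply/eqP.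
by rewrite -[k%:R in RHS]sqr_sqrtr ?ler0n//; ring.
Qed.

End MaxPlusSpaces.

(** * The orders of the six endpoint spaces *)

Section SixSpaces.
Variable R : realType.
Local Notation C := R[i].
Local Notation ell2 := (ell2 R).

Lemma sqrt_nat_gt0 n : (0 < n)%N -> 0 < Num.sqrt n%:R :> R.
Proof. by move=> n0; rewrite sqrtr_gt0 ltr0n. Qed.

Lemma div_sqrt (x : R) : 0 < x -> x / Num.sqrt x = Num.sqrt x.
Proof.
move=> x0; rewrite -{1}(sqr_sqrtr (ltW x0)) expr2 mulfK// gt_eqF// sqrtr_gt0.
by [].
Qed.

Lemma mulr_div_sqrt (a x : R) : 0 < x -> a * x / Num.sqrt x = a * Num.sqrt x.
Proof. by move=> x0; rewrite -mulrA div_sqrt. Qed.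

Lemma rect_row : rect_norm 1 (row_space R) (fun m k => Num.sqrt k%:R).
Proof.
split=> [m k m0 mk|m k v be m0 mk b0 v0 hv|m k v x m0 mk v0 hv].
- by rewrite sqrt_nat_gt0// (leq_trans m0).
- by rewrite mul1r row_space_upper.
- by rewrite mul1r mulr_div_sqrt ?row_space_lower// ltr0n (leq_trans m0).
Qed.

Lemma rect_col : rect_norm 1 (col_space R) (fun m k => Num.sqrt m%:R).
Proof.
split=> [m k m0 mk|m k v be m0 mk b0 v0 hv|m k v x m0 mk v0 hv].
- by rewrite sqrt_nat_gt0.
- by rewrite mul1r col_space_upper.
- by rewrite mul1r [m%:R * _]mulrC mulr_div_sqrt ?ltr0n// col_space_lower.
Qed.

Lemma rect_min : rect_norm 1 (min_space R) (fun m k => 1).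
Proof.
split=> [//|m k v be m0 mk b0 v0 hv|m k v x m0 mk v0 hv].
- by rewrite mul1r mulr1 min_space_upper.
- by rewrite mul1r divr1 min_space_lower.
Qed.

Lemma rect_max : rect_norm 1 (max_space R) (fun m k => Num.sqrt (m%:R * k%:R)).
Proof.
split=> [m k m0 mk|m k v be m0 mk b0 v0 hv|m k v x m0 mk v0 hv].
- by rewrite sqrtr_gt0 mulr_gt0// ltr0n// (leq_trans m0).
- by rewrite mul1r max_space_upper.
- rewrite mul1r div_sqrt ?max_space_lower// mulr_gt0// ltr0n//.
  exact: leq_trans mk.
Qed.

Lemma cap_spaceE k (x : 'M[ell2]_k) :
  cap_space R k x = Num.max (row_space R k x) (col_space R k x).
Proof.
have E1 : map_mx fst (map_mx (fun y : ell2 => (y, y)) x) = x.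
  by apply/matrixP => i j; rewrite !mxE.
have E2 : map_mx snd (map_mx (fun y : ell2 => (y, y)) x) = x.
  by apply/matrixP => i j; rewrite !mxE.
by rewrite /cap_space /pullback /linf_mnorm E1 E2.
Qed.

Lemma rect_cap : rect_norm 1 (cap_space R) (fun m k => Num.sqrt k%:R).
Proof.
split=> [m k m0 mk|m k v be m0 mk b0 v0 hv|m k v x m0 mk v0 hv].
- exact: (rect_pos rect_row m0 mk).
- rewrite (cap_spaceE v) ge_max; apply/andP; split.
    exact: (rect_upper rect_row m0 mk b0 v0 hv).
  apply: le_trans (rect_upper rect_col m0 mk b0 v0 hv) _.
  by rewrite mul1r ler_wpM2l// ler_wsqrtr// ler_nat.
- apply: le_trans (rect_lower rect_row x m0 mk v0 hv) _.
  apply: ler_wpM2l; first by rewrite mul1r divr_ge0 ?mulr_ge0 ?ler0n ?sqrtr_ge0.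
  by rewrite (cap_spaceE x) le_max; apply/orP; left; exact: lexx.
Qed.

Lemma rect_plus : rect_norm 1 (plus_space R) (fun m k => Num.sqrt m%:R).
Proof.
split=> [m k m0 mk|m k v be m0 mk b0 v0 hv|m k v x m0 mk v0 hv].
- exact: (rect_pos rect_col m0 mk).
- exact: le_trans (plus_space_le_col v) (rect_upper rect_col m0 mk b0 v0 hv).
- by rewrite mul1r [m%:R * _]mulrC mulr_div_sqrt ?ltr0n// plus_space_lower.
Qed.

End SixSpaces.

(** * Comparison with the norms of the entries, for a fixed size *)

Section RectNormTheory.
Variables (R : realType) (K : R) (N : mnorms (ell2 R)) (b : nat -> nat -> R).
Hypotheses (K1 : 1 <= K) (hN : rect_norm K N b).
Local Notation C := R[i].
Local Notation nrm := (dot_norm (@ell2_dotp R)).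

Lemma rect_const_gt0 m k : (0 < m)%N -> (m <= k)%N ->
  0 < K * (m%:R * k%:R / b m k).
Proof.
move=> m0 mk; apply: mulr_gt0; first exact: lt_le_trans K1.
apply: divr_gt0; last exact: (rect_pos hN).
by rewrite mulr_gt0// ltr0n// (leq_trans m0).
Qed.

Lemma zero_below_top k (v : 'M[ell2 R]_k) : zero_below k v.
Proof. by move=> i j; rewrite leqNgt ltn_ord. Qed.

Lemma mbessel_any k (v : 'M[ell2 R]_k) :
  mbessel (\sum_(p : 'I_k * 'I_k) nrm (v p.1 p.2)) v.
Proof. exact: bessel_any. Qed.

(** The lower estimate with [v = 0] bounds 0 by a positive multiple of [N x]. *)
Lemma rect_ge0 k (x : 'M[ell2 R]_k) : (0 < k)%N -> 0 <= N x.
Proof.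
move=> k0; have := rect_lower hN (v := 0) x k0 (leqnn k) (@zero_below_top _ _).
have -> : pairing x 0 = 0.
  rewrite /pairing big1// => i _; rewrite big1// => j _.
  by rewrite mxE ell2_dotC ell2_dot0l [LHS](rmorph0 Num.conj).
rewrite normc0 pmulr_rge0; last by apply: rect_const_gt0.
apply => a; rewrite big1 => [|p _]; last by rewrite mxE scaler0.
by rewrite dot_norm0 expr0n expr1n mul1r sumr_ge0// => p _; exact: sqr_ge0.
Qed.

(** The lower estimate is used for the matrix whose only nonzero entry is the normalized [x i j].
    Together with [rect_le_sum] this compares [N] with the norms of the entries and stands in for a
    triangle inequality. *)
Lemma rect_entry k (x : 'M[ell2 R]_k) i j : (0 < k)%N ->
  nrm (x i j) <= K * (k%:R * k%:R / b k k) * N x.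
Proof.
move=> k0; have [x0|xn] := eqVneq (nrm (x i j)) 0.
  by rewrite x0 mulr_ge0 ?rect_ge0// ltW// rect_const_gt0.
have px : 0 < nrm (x i j) by rewrite lt_def xn dot_norm_ge0.
pose w := ((nrm (x i j))^-1)%:C%C *: x i j.
have nw : nrm w = 1 by rewrite dot_normZ normc_real ger0_norm ?mulVf// invr_ge0 ltW.
pose v : 'M[ell2 R]_k := \matrix_(i', j') (if (i' == i) && (j' == j) then w else 0).
have hv : mbessel 1 v.
  have := mbessel_any v; rewrite (bigD1 (i, j))//= big1 => [|[i' j'] /=].
    by rewrite mxE !eqxx nw addr0.
  by rewrite mxE -[(i', j') == _]/((i' == i) && (j' == j)) => /negbTE ->; rewrite dot_norm0.
have := rect_lower hN x k0 (leqnn k) (@zero_below_top _ v) hv.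
apply: le_trans; rewrite /pairing (bigD1 i)//= [X in _ + X]big1 => [|i' ii'].
  rewrite addr0 (bigD1 j)//= [X in _ + X]big1 => [|j' jj'].
    have -> : v i j = w by rewrite mxE !eqxx.
    rewrite addr0 /w ell2_dotZr normcM normc_conj normc_real.
    rewrite ell2_dot_self_nrm normc_real !ger0_norm ?sqr_ge0 ?invr_ge0 ?(ltW px)//.
    by rewrite expr2 mulrA mulVf// mul1r.
  by rewrite mxE (negbTE jj') andbF ell2_dotC ell2_dot0l [LHS](rmorph0 Num.conj).
rewrite big1// => j' _.
by rewrite mxE (negbTE ii') /= ell2_dotC ell2_dot0l [LHS](rmorph0 Num.conj).
Qed.

Lemma rect_le_sum k (x : 'M[ell2 R]_k) : (0 < k)%N ->
  N x <= K * (\sum_(p : 'I_k * 'I_k) nrm (x p.1 p.2)) * b k k.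
Proof.
move=> k0; apply: (rect_upper hN) => //; last exact: mbessel_any; last exact: zero_below_top.
by apply: sumr_ge0 => p _; exact: dot_norm_ge0.
Qed.

End RectNormTheory.

Lemma rect_norm_weaken (R : realType) (K K' : R) (N : mnorms (ell2 R)) b b' :
  (forall m k, (0 < m)%N -> (m <= k)%N -> b m k = b' m k) -> 1 <= K -> K <= K' ->
  rect_norm K N b -> rect_norm K' N b'.
Proof.
move=> bb' K1 KK' hN.
split=> [m k m0 mk|m k v be m0 mk b0 v0 hv|m k v x m0 mk v0 hv]; rewrite -bb'//.
- exact: (rect_pos hN).
- apply: le_trans (rect_upper hN m0 mk b0 v0 hv) _.
  by rewrite !ler_wpM2r// (ltW (rect_pos hN m0 mk)).
- apply: le_trans (rect_lower hN x m0 mk v0 hv) _.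
  have k0 : (0 < k)%N by exact: leq_trans mk.
  rewrite ler_wpM2r ?(rect_ge0 K1 hN)// ler_wpM2r//.
  by rewrite divr_ge0 ?mulr_ge0 ?ler0n// (ltW (rect_pos hN m0 mk)).
Qed.

(** * Interpolation of the estimates *)

Section InterpolationUpper.
Variable R : realType.
Local Notation C := R[i].
Local Notation ell2 := (ell2 R).
Implicit Types (e A c t s : R).

Lemma gauss_small e A c : 0 < e -> 0 <= A ->
  exists2 T, 0 <= T & forall t, T < `|t| -> expR (c - t ^+ 2) * A <= e.
Proof.
move=> e0 A0; have E0 := expR_gt0 c.
exists (1 + expR c * A / e) => [|t tT].
  by rewrite addr_ge0// divr_ge0 ?(ltW e0)// mulr_ge0// ltW.
have K0 : 0 <= expR c * A / e by rewrite divr_ge0 ?(ltW e0)// mulr_ge0// ltW.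
have t1 : 1 < `|t| by apply: le_lt_trans tT; rewrite lerDl.
have t0 : 0 < `|t| by apply: lt_trans t1.
have h : expR (- t ^+ 2) <= `|t|^-1.
  rewrite expRN lef_pV2 ?posrE ?expR_gt0//; apply: le_trans (expR_ge1Dx _).
  rewrite -real_normK ?num_real// expr2.
  have : `|t| <= `|t| * `|t| by rewrite ler_peMl ?(ltW t0)// ltW.
  by clear; lra.
rewrite expRD -mulrA [expR (- _) * A]mulrC mulrA.
apply: le_trans (ler_wpM2l _ h) _; first by rewrite mulr_ge0// ltW.
rewrite ler_pdivrMr// -ler_pdivrMl// mulrC; apply: ltW; apply: le_lt_trans tT.
by rewrite lerDr.
Qed.

Lemma ccont_small (f : C -> C) (z : C) e A : 0 < e -> 0 <= A -> ccont f z ->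
  exists2 d, 0 < d & forall w, normc (w - z) < d -> normc (f w - f z) * A <= e.
Proof.
move=> e0 A0 /ccontP cf; have A1 : 0 < A + 1 by rewrite ltr_wpDl.
have [d d0 hd] := cf _ (divr_gt0 e0 A1); exists d => // w /hd/ltW h.
apply: le_trans (ler_wpM2r A0 h) _.
by rewrite mulrAC ler_pdivrMr// ler_wpM2l ?(ltW e0)// lerDl.
Qed.

Lemma cvg0_withinC (A : set C) (z : C^o) (phi : C -> R) :
  (phi w @[w --> within A (nbhs z)] --> (0 : R)) <->
  forall e, 0 < e -> exists2 d, 0 < d &
    forall w, A w -> normc (w - z) < d -> `|phi w| <= e.
Proof.
split=> [/cvgr0Pnorm_le h e e0|h].
  have /nbhs_normcP[d d0 hd] : nbhs (z : C^o) [set w | A w -> `|phi w| <= e] by exact: h.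
  by exists d => // w Aw /hd; exact.
apply/cvgr0Pnorm_le => e /h[d d0 hd].
suff : nbhs (z : C^o) [set w | A w -> `|phi w| <= e] by [].
by apply/nbhs_normcP; exists d => // w wz Aw; exact: hd.
Qed.

Lemma sum_norm_ge0 (V : lmodType C) (n0 n1 : V -> R) x :
  (forall y, 0 <= n0 y) -> (forall y, 0 <= n1 y) -> 0 <= sum_norm n0 n1 x.
Proof.
move=> p0 p1; apply: lb_le_inf; first by exists (n0 0 + n1 (x - 0)), 0.
by move=> _ [y _ <-]; rewrite addr_ge0.
Qed.

Lemma sum_norm_le (V : lmodType C) (n0 n1 : V -> R) x :
  (forall y, 0 <= n0 y) -> (forall y, 0 <= n1 y) -> n1 0 <= 0 ->
  sum_norm n0 n1 x <= n0 x.
Proof.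
move=> p0 p1 n10; apply: (@le_trans _ _ (n0 x + n1 (x - x))).
  apply: ge_inf; last by exists x.
  by exists 0 => _ [y _ <-]; rewrite addr_ge0.
by rewrite subrr -[leRHS]addr0 lerD2l.
Qed.

Lemma calderon_norm_ge0 (V : lmodType C) (n0 n1 : V -> R) (F : C -> V) :
  (forall y, 0 <= n0 y) -> 0 <= calderon_norm n0 n1 F.
Proof.
move=> p0; rewrite /calderon_norm le_max; apply/orP; left.
by apply: sup_nonneg => _ [t _ <-].
Qed.

Lemma normc_vertical (a t s : R) : normc (Complex a t - Complex a s) = `|t - s|.
Proof.
rewrite (_ : _ - _ = Complex 0 (t - s)) /=; first by rewrite expr0n add0r sqrtr_sqr.
by apply/eqP; rewrite eq_complex /= subrr !eqxx.
Qed.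

Variables (V : lmodType C) (n0 n1 : V -> R) (v : V) (B0 B1 theta : R).
Hypotheses (p0 : forall y, 0 <= n0 y) (p1 : forall y, 0 <= n1 y).
Hypotheses (B00 : 0 < B0) (B10 : 0 < B1).
Variable (be : R).
Hypotheses (be0 : 0 <= be) (t0 : 0 <= theta) (t1 : theta <= 1).
Hypotheses (n0v : forall c : C, n0 (c *: v) <= normc c * (be * B0)).
Hypotheses (n1v : forall c : C, n1 (c *: v) <= normc c * (be * B1)).

Let l := ln B0 - ln B1.

(* The extremal function [z |-> (B0 / B1)^(z - theta) v], with a Gaussian     *)
(* factor that makes it vanish at infinity.                                   *)
Definition interp_factor (z : C) : C :=
  cexp (l%:C%C * z + z * z + (- (l * theta + theta ^+ 2))%:C%C).
Local Notation g := interp_factor.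
Definition interp_fun (z : C) : V := g z *: v.

Lemma interp_factor_diff z : cdiff g z.
Proof.
apply: (@cdiff_comp _ (@cexp R)
  (fun z => l%:C%C * z + z * z + (- (l * theta + theta ^+ 2))%:C%C)); last exact: cexp_diff.
apply: cdiffD; last exact: cdiff_cst.
apply: cdiffD; first by apply: cdiffM; [exact: cdiff_cst|exact: cdiff_id].
by apply: cdiffM; exact: cdiff_id.
Qed.

Lemma normc_interp_factor x y :
  normc (g (Complex x y)) = expR (l * (x - theta) + x ^+ 2 - theta ^+ 2 - y ^+ 2).
Proof. by rewrite normc_cexp; congr expR => /=; ring. Qed.

Lemma interp_fun_theta : interp_fun theta%:C%C = v.
Proof.
rewrite /interp_fun (_ : g _ = 1) ?scale1r// /interp_factor.
rewrite (_ : _ + _ = 0) ?/cexp /= ?expR0 ?cos0 ?sin0 ?mulr1 ?mulr0//.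
by apply/eqP; rewrite eq_complex /=; apply/andP; split; apply/eqP; ring.
Qed.

Lemma n1_0 : n1 0 <= 0.
Proof. by have := n1v 0; rewrite scale0r normc0 mul0r. Qed.

Lemma sum_norm_v (c : C) : sum_norm n0 n1 (c *: v) <= normc c * (be * B0).
Proof. exact: le_trans (sum_norm_le _ p0 p1 n1_0) (n0v c). Qed.

Lemma interp_boundary (N : V -> R) (B a : R) : 0 < B -> (forall y, 0 <= N y) ->
  (forall c : C, N (c *: v) <= normc c * (be * B)) -> boundary_C0 N a interp_fun.
Proof.
move=> B0' pN Nv; have bB : 0 <= be * B by rewrite mulr_ge0// ltW.
have inf e : 0 < e -> exists2 T, 0 <= T & forall t, T < `|t| -> `|N (interp_fun (Complex a t))| <= e.
  move=> e0; have [T T0 hT] := @gauss_small e (be * B) (l * (a - theta) + a ^+ 2 - theta ^+ 2) e0 bB.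
  exists T => // t /hT; apply: le_trans; rewrite ger0_norm//.
  by apply: le_trans (Nv _) _; rewrite normc_interp_factor.
split.
- move=> s; apply/cvgr0Pnorm_le => e e0.
  have [d d0 hd] := ccont_small e0 bB (cdiff_continuous (@interp_factor_diff (Complex a s))).
  apply/nbhs_ballP; exists d => // t; rewrite /ball/= => st.
  rewrite ger0_norm// -scalerBl; apply: le_trans (Nv _) _; apply: hd.
  by rewrite normc_vertical distrC.
- apply/cvgr0Pnorm_le => e /inf[T T0 hT]; exists T; split; first exact: num_real.
  by move=> t Tt; apply: hT; apply: lt_le_trans Tt (ler_norm _).
- apply/cvgr0Pnorm_le => e /inf[T T0 hT]; exists (- T); split; first exact: num_real.
  move=> t Tt; apply: hT; rewrite -normrN; apply: lt_le_trans (ler_norm _).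
  by rewrite ltrNr.
Qed.

Lemma interp_fun_calderon : calderon_space n0 n1 interp_fun.
Proof.
have bB : 0 <= be * B0 by rewrite mulr_ge0// ltW.
have ps x := sum_norm_ge0 x p0 p1.
split.
- exists (expR (`|l| + 1) * (be * B0)) => -[x y] /andP[x0 x1].
  apply: le_trans (sum_norm_v _) _; rewrite ler_wpM2r// normc_interp_factor ler_expR.
  have h1 : l * (x - theta) <= `|l|.
    apply: le_trans (ler_norm _) _; rewrite normrM ler_piMr// ler_norml.
    by move: x0 x1 t0 t1 => /= x0 x1 t0' t1'; apply/andP; split; lra.
  have h2 : x ^+ 2 <= 1 by rewrite expr_le1.
  have := sqr_ge0 theta; have := sqr_ge0 y; lra.
- move=> z _; apply/cvg0_withinC => e e0.
  have [d d0 hd] := ccont_small e0 bB (cdiff_continuous (@interp_factor_diff z)).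
  exists d => // w _ /hd h; rewrite ger0_norm// -scalerBl.
  exact: le_trans (sum_norm_v _) h.
- move=> z _; have [k hk] := cdiff_approx (@interp_factor_diff z).
  exists (k *: v); apply/cvg0_withinC => e e0.
  have A1 : 0 < be * B0 + 1 by rewrite ltr_wpDl.
  have [d d0 hd] := hk _ (divr_gt0 e0 A1).
  exists d => // h /eqP h0; rewrite subr0 => hd'.
  have nh : 0 < normc h.
    by rewrite lt_def normc_ge0 andbT; apply/eqP => /eq0_normc.
  rewrite ger0_norm// -scalerBl scalerA -scalerBl; apply: le_trans (sum_norm_v _) _.
  have := hd (z + h); rewrite (_ : z + h - z = h); last by rewrite addrAC subrr add0r.
  move=> /(_ hd') H; have -> : h^-1 * (g (z + h) - g z) - k = h^-1 * (g (z + h) - g z - k * h).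
    by rewrite [RHS]mulrBr [k * h]mulrC mulKf//; apply/eqP.
  rewrite normcM normcV; apply: (@le_trans _ _ (e / (be * B0 + 1) * (be * B0))).
    by rewrite ler_wpM2r// mulrC ler_pdivrMr.
  by rewrite mulrAC ler_pdivrMr// ler_wpM2l ?(ltW e0)// lerDl.
- exact: interp_boundary B00 p0 n0v.
- exact: interp_boundary B10 p1 n1v.
Qed.

(** On the line of real part j, the scalar factor turns the bound B_j into B0^(1 - theta) B1^theta
    times exp(j - theta^2 - t^2), which is at most [expR 1]. *)
Lemma interp_fun_norm :
  calderon_norm n0 n1 interp_fun <= expR 1 * be * (B0 `^ (1 - theta) * B1 `^ theta).
Proof.
have E : B0 `^ (1 - theta) * B1 `^ theta = expR ((1 - theta) * ln B0 + theta * ln B1).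
  by rewrite /powR !gt_eqF// expRD.
have H (N : V -> R) (B x : R) : 0 < B -> (forall c : C, N (c *: v) <= normc c * (be * B)) ->
    l * (x - theta) + ln B + x ^+ 2 <= 1 + ((1 - theta) * ln B0 + theta * ln B1) ->
    sup [set N (interp_fun (Complex x t)) | t in [set: R]] <=
      expR 1 * be * (B0 `^ (1 - theta) * B1 `^ theta).
  move=> Bp Nv hl; apply: ge_sup; first by exists (N (interp_fun (Complex x 0))), 0.
  move=> _ [t _ <-]; apply: le_trans (Nv _) _; rewrite normc_interp_factor E.
  rewrite mulrCA [expR 1 * be]mulrC -mulrA ler_wpM2l// -{1}(@lnK _ B) ?posrE//.
  rewrite -!expRD ler_expR; have := sqr_ge0 theta; have := sqr_ge0 t.
  by move: hl; lra.
rewrite /calderon_norm ge_max; apply/andP; split; [apply: (H _ B0)|apply: (H _ B1)] => //.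
  by rewrite expr0n/= /l; lra.
by rewrite expr1n /l; lra.
Qed.

End InterpolationUpper.

(** * Lower estimates for the interpolation norm *)

Section InterpolationLower.
Variable R : realType.
Local Notation C := R[i].
Local Notation ell2 := (ell2 R).
Local Notation nrm := (dot_norm (@ell2_dotp R)).

Lemma pairingB k (x y v : 'M[ell2]_k) : pairing (x - y) v = pairing x v - pairing y v.
Proof.
rewrite /pairing -sumrB; apply: eq_bigr => i _; rewrite -sumrB; apply: eq_bigr => j _.
by rewrite !mxE ell2_dotB.
Qed.

Lemma pairingD k (x y v : 'M[ell2]_k) : pairing (x + y) v = pairing x v + pairing y v.
Proof.
rewrite /pairing -big_split; apply: eq_bigr => i _; rewrite -big_split; apply: eq_bigr => j _ /=.
by rewrite !mxE -[x i j]scale1r ell2_dot_linear mul1r scale1r.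
Qed.

Lemma pairingZl k (c : C) (x : Mn ell2 k) (v : 'M[ell2]_k) :
  pairing (c *: x) v = c * pairing x v.
Proof.
rewrite /pairing mulr_sumr; apply: eq_bigr => i _; rewrite mulr_sumr.
by apply: eq_bigr => j _; rewrite mxE ell2_dotZ.
Qed.

(** The pairing is continuous for the sum norm, so that the regularity of [F] passes to the scalar
    function z |-> pairing (F z) v. *)
Lemma pairing_sum_norm k (n0 n1 : 'M[ell2]_k -> R) (v : 'M[ell2]_k) (c0 c1 : R) (x : Mn ell2 k) :
  0 < c0 -> 0 < c1 -> (forall y, 0 <= n0 y) -> (forall y, 0 <= n1 y) ->
  (forall y, normc (pairing y v) <= c0 * n0 y) ->
  (forall y, normc (pairing y v) <= c1 * n1 y) ->
  normc (pairing x v) <= (c0 + c1) * @sum_norm R (Mn ell2 k) n0 n1 x.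
Proof.
move=> c00 c10 p0 p1 h0 h1; have c01 : 0 < c0 + c1 by rewrite addr_gt0.
rewrite -ler_pdivrMl// mulrC; apply: lb_le_inf; first by exists (n0 0 + n1 (x - 0)), 0.
move=> _ [y _ <-]; rewrite ler_pdivrMr// mulrC.
have -> : pairing x v = pairing (x - y) v + pairing y v by rewrite -pairingD subrK.
apply: le_trans (normcD _ _) _; apply: le_trans (lerD (h1 _) (h0 _)) _.
rewrite addrC mulrDr; apply: lerD; apply: ler_wpM2r => //; first by rewrite lerDl ltW.
by rewrite lerDr ltW.
Qed.

(** This makes the suprema in [calderon_norm] true ones. Continuity is transferred to the sum [phi]
    of the norms of the entries, which has a maximum on a segment; outside it the decay at infinity
    applies. *)
Lemma boundary_bounded (N : mnorms ell2) b k (a : R) (F : C -> Mn ell2 k) :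
  rect_norm 1 N b -> (0 < k)%N -> @boundary_C0 R (Mn ell2 k) (N k) a F ->
  exists M, forall t, N k (F (Complex a t)) <= M.
Proof.
move=> hN k0 [cF Fp Fm].
pose phi t : R := \sum_(p : 'I_k * 'I_k) nrm (F (Complex a t) p.1 p.2).
pose c := 1 * (k%:R * k%:R / b k k); have c0 : 0 < c by exact: (rect_const_gt0 (lexx 1) hN).
pose A := \sum_(p : 'I_k * 'I_k) c.
have A0 : 0 <= A by apply: sumr_ge0 => p _; exact: ltW.
have dphi s t : `|phi t - phi s| <= A * N k (F (Complex a t) - F (Complex a s)).
  rewrite /phi -sumrB mulr_suml; apply: le_trans (ler_norm_sum _ _ _) _.
  apply: ler_sum => p _.
  apply: le_trans (rect_entry (lexx 1) hN (F (Complex a t) - F (Complex a s)) p.1 p.2 k0).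
  have -> : (F (Complex a t) - F (Complex a s)) p.1 p.2 =
      F (Complex a t) p.1 p.2 - F (Complex a s) p.1 p.2 by rewrite !mxE.
  have tri (y z : ell2) : nrm y <= nrm (y - z) + nrm z.
    by rewrite -{1}[y](subrK z); exact: dot_normD.
  set y := F _ _ _; set z := F _ _ _; have h1 := tri y z; have h2 := tri z y.
  rewrite -[z - y]opprB dot_normN in h2.
  by rewrite ler_norml; apply/andP; split; [rewrite lerNl opprB|]; rewrite lerBlDr.
have cphi s : {for s, continuous phi}.
  apply: for_continuous_ed => e e0; have A1 : 0 < A + 1 by rewrite ltr_wpDl.
  have /cvgr0Pnorm_le/(_ _ (divr_gt0 e0 A1))/nbhs_ballP[d d0 hd] := cF s.
  exists d => // t ts; apply: le_trans (dphi s t) _.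
  have := hd t; rewrite /ball/= distrC => /(_ ts)/(le_trans (ler_norm _)) h.
  apply: le_trans (ler_wpM2l A0 h) _.
  by rewrite mulrCA ler_piMr ?(ltW e0)// ler_pdivrMr// mul1r lerDl.
have /cvgr0Pnorm_le/(_ _ ltr01)[T1 [_ h1]] := Fp.
have /cvgr0Pnorm_le/(_ _ ltr01)[T2 [_ h2]] := Fm.
pose T := `|T1| + `|T2|.
have T0 : - T <= T by rewrite /T; have := normr_ge0 T1; have := normr_ge0 T2; clear; lra.
have cT : {within `[- T, T], continuous phi} by apply: continuous_subspaceT => s; exact: cphi.
have [s _ hs] := EVT_max T0 cT.
have bk : 0 < b k k by exact: (rect_pos hN).
exists (1 + phi s * b k k) => t.
have phi0 u : 0 <= phi u by apply: sumr_ge0 => p _; exact: dot_norm_ge0.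
have pb u : 0 <= phi u * b k k by rewrite mulr_ge0// ltW.
have [tT|tT] := boolP (t \in `[- T, T]).
  apply: le_trans (rect_le_sum hN (F (Complex a t)) k0) _; rewrite mul1r -/(phi t).
  apply: (@le_trans _ _ (phi s * b k k)); last by rewrite lerDr.
  by rewrite ler_wpM2r ?(ltW bk)//; exact: hs.
have h : `|N k (F (Complex a t))| <= 1.
  move: tT; rewrite in_itv/= negb_and -!ltNge => /orP[tT|tT].
    by apply: h2; apply: lt_le_trans tT _; rewrite /T; have := ler_norm (- T2);
      rewrite normrN; have := normr_ge0 T1; clear; lra.
  by apply: h1; apply: le_lt_trans tT; rewrite /T; have := ler_norm T1;
    have := normr_ge0 T2; clear; lra.
by apply: le_trans (ler_norm _) _; apply: le_trans h _; rewrite lerDl.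
Qed.

Lemma powR_div_mix (a p q theta : R) : 0 < a -> 0 < p -> 0 < q ->
  (a / p) `^ (1 - theta) * (a / q) `^ theta = a / (p `^ (1 - theta) * q `^ theta).
Proof.
move=> a0 p0 q0; rewrite /powR !gt_eqF ?divr_gt0// -!expRD -expRN.
rewrite !ln_div ?posrE// -[a in RHS]lnK ?posrE// -expRD; congr expR; ring.
Qed.

Variables (N0 N1 : mnorms ell2) (b0 b1 : nat -> nat -> R) (theta : R).
Hypotheses (h0 : rect_norm 1 N0 b0) (h1 : rect_norm 1 N1 b1).
Hypotheses (t0 : 0 <= theta) (t1 : theta <= 1).

Let b m k := b0 m k `^ (1 - theta) * b1 m k `^ theta.

Let scale_le N bN m k (v : 'M[ell2]_k) be (hN : rect_norm 1 N bN) :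
  (0 < m)%N -> (m <= k)%N -> 0 <= be -> zero_below m v -> mbessel be v ->
  forall c : C, N k (c *: (v : Mn ell2 k)) <= normc c * (be * bN m k).
Proof.
move=> m0 mk be0 v0 hv c.
apply: le_trans (rect_upper hN m0 mk _ (zero_belowZ c v0) (mbesselZ c hv)) _.
  by rewrite mulr_ge0 ?normc_ge0.
by rewrite mul1r mulrA.
Qed.

Let interp_set k (x : Mn ell2 k) := [set @calderon_norm R (Mn ell2 k) (@N0 k) (@N1 k) F | F in
  [set F | @calderon_space R (Mn ell2 k) (@N0 k) (@N1 k) F /\ F theta%:C%C = x]].

(** The explicit function [interp_fun] competes in the infimum. Keeping it as a member of the set
    also provides nonemptiness for the lower estimate. *)
Lemma interp_norm_upper m k (v : 'M[ell2]_k) be :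
  (0 < m)%N -> (m <= k)%N -> 0 <= be -> zero_below m v -> mbessel be v ->
  exists2 r, interp_set v r & r <= expR 1 * be * b m k.
Proof.
move=> m0 mk be0 v0 hv; have k0 : (0 < k)%N by exact: leq_trans mk.
have p0 y : 0 <= @N0 k y by exact: (rect_ge0 (lexx 1) h0).
have p1 y : 0 <= @N1 k y by exact: (rect_ge0 (lexx 1) h1).
have B0 := rect_pos h0 m0 mk; have B1 := rect_pos h1 m0 mk.
have s0 := scale_le h0 m0 mk be0 v0 hv; have s1 := scale_le h1 m0 mk be0 v0 hv.
exists (@calderon_norm R (Mn ell2 k) (@N0 k) (@N1 k) (@interp_fun R (Mn ell2 k) v (b0 m k) (b1 m k) theta)).
  exists (@interp_fun R (Mn ell2 k) v (b0 m k) (b1 m k) theta); last by [].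
  split; last exact: interp_fun_theta.
  exact: (@interp_fun_calderon R (Mn ell2 k) (@N0 k) (@N1 k) v _ _ theta p0 p1 B0 B1 be be0 t0 t1 s0 s1).
exact: (@interp_fun_norm R (Mn ell2 k) (@N0 k) (@N1 k) v _ _ theta B0 B1 be be0 s0 s1).
Qed.

(** The three lines theorem for z |-> pairing (F z) v, where [F] is any competitor; the bounds on
    the two lines are the lower estimates for [N0] and [N1]. *)
Lemma interp_norm_lower m k (v x : 'M[ell2]_k) :
  (0 < m)%N -> (m <= k)%N -> zero_below m v -> mbessel 1 v ->
  normc (pairing x v) <= expR 1 * (m%:R * k%:R / b m k) *
    @interp_norm R (Mn ell2 k) (@N0 k) (@N1 k) theta x.
Proof.
move=> m0 mk v0 hv; have k0 : (0 < k)%N by exact: leq_trans mk.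
have p0 y : 0 <= @N0 k y by exact: (rect_ge0 (lexx 1) h0).
have p1 y : 0 <= @N1 k y by exact: (rect_ge0 (lexx 1) h1).
have mk0 : 0 < m%:R * k%:R :> R by rewrite mulr_gt0// ltr0n.
have B0 := rect_pos h0 m0 mk; have B1 := rect_pos h1 m0 mk.
have bmk : 0 < b m k by rewrite mulr_gt0// powR_gt0.
pose c0 := m%:R * k%:R / b0 m k; pose c1 := m%:R * k%:R / b1 m k.
have c00 : 0 < c0 by rewrite divr_gt0.
have c10 : 0 < c1 by rewrite divr_gt0.
have q0 y : normc (pairing y v) <= c0 * @N0 k y.
  by have := rect_lower h0 y m0 mk v0 hv; rewrite mul1r.
have q1 y : normc (pairing y v) <= c1 * @N1 k y.
  by have := rect_lower h1 y m0 mk v0 hv; rewrite mul1r.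
have D0 : 0 < expR 1 * (m%:R * k%:R / b m k) by rewrite mulr_gt0 ?expR_gt0// divr_gt0.
rewrite -ler_pdivrMl// mulrC; apply: lb_le_inf.
  (* The infimum is over a nonempty set, because the entries of [x] form a Bessel family for some
     constant. *)
  have s0 : 0 <= \sum_(p : 'I_k * 'I_k) nrm (x p.1 p.2).
    by apply: sumr_ge0 => p _; exact: dot_norm_ge0.
  have [r hr _] := interp_norm_upper k0 (leqnn k) s0 (@zero_below_top _ _ x) (mbessel_any x).
  by exists r.
move=> _ [F [cF Fx] <-]; rewrite ler_pdivrMr// mulrC.
set S := calderon_norm _ _ _.
have [[M hM] contF diffF bd0 bd1] := cF.
have qs y := pairing_sum_norm y c00 c10 p0 p1 q0 q1.
have ps y := @sum_norm_ge0 R (Mn ell2 k) (@N0 k) (@N1 k) y p0 p1.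
have c01 : 0 < c0 + c1 by rewrite addr_gt0.
pose g z := pairing (F z) v.
have gB z w : g w - g z = pairing (F w - F z) v by rewrite pairingB.
have -> : pairing x v = g theta%:C%C by rewrite /g Fx.
rewrite -powR_div_mix//.
apply: (@three_lines R g ((c0 + c1) * M)) => //.
- by rewrite /S; exact: calderon_norm_ge0.
- by rewrite t0.
- move=> z /hM h; apply: le_trans (qs _) _; exact: ler_wpM2l (ltW c01) _ _ h.
- move=> z sz e e0; have /cvg0_withinC/(_ _ (divr_gt0 e0 c01))[d d0 hd] := contF z sz.
  exists d => // w sw wz; rewrite gB; apply: le_trans (qs _) _.
  have := hd w sw wz; rewrite ger0_norm// ler_pdivlMr//.
  by rewrite mulrC.
- move=> z z01; have [y hy] := diffF z z01.
  apply: (@cdiffP _ g z (pairing y v)) => e e0.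
  have /cvg0_withinC/(_ _ (divr_gt0 e0 c01))[d d0 hd] := hy.
  exists d => // w wz; have [->|wz0] := eqVneq w z.
    by rewrite !subrr mulr0 subr0 normc0 mulr0.
  have nwz : w - z != 0 by rewrite subr_eq0.
  have := hd (w - z) nwz; rewrite subr0 => /(_ wz); rewrite ger0_norm//.
  rewrite ler_pdivlMr// mulrC => /(le_trans (qs _)).
  rewrite pairingB pairingZl [z + _]addrC subrK -gB => H.
  have -> : g w - g z - pairing y v * (w - z) =
      ((w - z)^-1 * (g w - g z) - pairing y v) * (w - z).
    by rewrite mulrBl mulrAC mulVf// mul1r.
  by rewrite normcM ler_wpM2r ?normc_ge0.
- move=> t; apply: le_trans (q0 _) _; apply: ler_wpM2l; first exact: ltW.
  rewrite /S /calderon_norm le_max; apply/orP; left; apply: ub_le_sup; last by exists t.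
  by have [M0 hM0] := boundary_bounded h0 k0 bd0; exists M0 => _ [s _ <-].
- move=> t; apply: le_trans (q1 _) _; apply: ler_wpM2l; first exact: ltW.
  rewrite /S /calderon_norm le_max; apply/orP; right; apply: ub_le_sup; last by exists t.
  by have [M0 hM0] := boundary_bounded h1 k0 bd1; exists M0 => _ [s _ <-].
Qed.

Lemma rect_interp : rect_norm (expR 1) (interp N0 N1 theta) b.
Proof.
have e1 : 1 <= expR 1 :> R by rewrite -[leLHS]expR0 ler_expR.
have [E0|n0] := eqVneq theta 0.
  have -> : interp N0 N1 theta = N0.
    by apply: functional_extensionality_dep => n; apply/funext => x; rewrite /interp E0 eqxx.
  apply: (@rect_norm_weaken _ 1 _ _ b0) => // m k m0 mk.
  by rewrite /b E0 subr0 powRr0 mulr1 powRr1// (ltW (rect_pos h0 m0 mk)).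
have [E1|n1] := eqVneq theta 1.
  have -> : interp N0 N1 theta = N1.
    by apply: functional_extensionality_dep => n; apply/funext => x; rewrite /interp (negbTE n0) E1 eqxx.
  apply: (@rect_norm_weaken _ 1 _ _ b1) => // m k m0 mk.
  by rewrite /b E1 subrr powRr0 mul1r powRr1// (ltW (rect_pos h1 m0 mk)).
have E n x : interp N0 N1 theta x = @interp_norm R (Mn ell2 n) (@N0 n) (@N1 n) theta x.
  by rewrite /interp (negbTE n0) (negbTE n1).
split=> [m k m0 mk|m k v be m0 mk be0 v0 hv|m k v x m0 mk v0 hv].
- by rewrite mulr_gt0// powR_gt0// ?(rect_pos h0)// ?(rect_pos h1).
- rewrite E; have [r hr hle] := interp_norm_upper m0 mk be0 v0 hv.
  apply: le_trans hle; apply: ge_inf => //; exists 0 => _ [F _ <-].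
  apply: calderon_norm_ge0 => y; apply: (rect_ge0 (lexx 1) h0).
  exact: leq_trans mk.
- by rewrite E; exact: interp_norm_lower.
Qed.

End InterpolationLower.

(** * Almost orthogonal differences *)

Section Selection.
Variable R : realType.
Local Notation C := R[i].
Local Notation ell2 := (ell2 R).
Local Notation nrm := (dot_norm (@ell2_dotp R)).
Local Notation dot := (@ell2_dot R).

Lemma nat_pigeonhole (T : finType) (h : nat -> T) L :
  exists l l', [/\ (L <= l)%N, (l < l')%N & h l = h l'].
Proof.
pose f (i : 'I_(#|T|.+1)) := h (L + i)%N.
have : ~~ injectiveb f.
  apply/negP => /injectiveP/leq_card; by rewrite card_ord ltnn.
move=> /injectivePn[i [j ij fij]].
have [lij|lji|/ord_inj eij] := ltngtP i j.
- by exists (L + i)%N, (L + j)%N; split; rewrite ?leq_addr ?ltn_add2l.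
- by exists (L + j)%N, (L + i)%N; split; rewrite ?leq_addr ?ltn_add2l//; exact/esym.
- by rewrite eij eqxx in ij.
Qed.

(** Pigeonhole on a grid of mesh [e]: finitely many bounded sequences visit finitely many cells. *)
Lemma bounded_close_pair (J : finType) (phi : J -> nat -> R) (B e : R) L :
  (forall c l, `|phi c l| <= B) -> 0 < e ->
  exists l l', [/\ (L <= l)%N, (l < l')%N & forall c, `|phi c l - phi c l'| <= e].
Proof.
move=> hB e0; pose x c l := (phi c l + B) / e.
have x0 c l : 0 <= x c l.
  rewrite divr_ge0 ?(ltW e0)//; have := hB c l; rewrite ler_norml => /andP[h _].
  by rewrite -lerBlDr sub0r.
pose Q := Num.truncn ((B + B) / e).
have xQ c l : (Num.truncn (x c l) < Q.+1)%N.
  rewrite ltnS le_truncn// ler_pM2r ?invr_gt0// lerD2r.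
  by have := hB c l; rewrite ler_norml => /andP[].
pose h l : {ffun J -> 'I_Q.+1} := [ffun c => Ordinal (xQ c l)].
have [l [l' [Ll ll' hll']]] := nat_pigeonhole h L.
exists l, l'; split=> // c.
have tE : Num.truncn (x c l) = Num.truncn (x c l').
  by have := congr1 (fun u : {ffun J -> 'I_Q.+1} => val (u c)) hll'; rewrite !ffunE.
have /andP[a1 a2] := truncn_itv (x0 c l).
have /andP[b1 b2] := truncn_itv (x0 c l').
rewrite tE -natr1 in a1 a2; rewrite -natr1 in b2.
have -> : phi c l - phi c l' = (x c l - x c l') * e.
  by rewrite mulrBl !divfK ?gt_eqF//; ring.
rewrite normrM (gtr0_norm e0) ler_piMl ?(ltW e0)// ler_norml.
by move: a1 a2 b1 b2; clear; move=> *; apply/andP; split; lra.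
Qed.

(** The inner products with the finitely many [w i] are bounded sequences, and two terms of [g] at
    which they nearly agree have a difference almost orthogonal to all [w i]. This is a finite form
    of weak compactness. *)
Lemma bounded_near_orthogonal (I : finType) (w : I -> ell2) (g : nat -> ell2) (M e : R) L :
  (forall l, nrm (g l) <= M) -> 0 < e ->
  exists l l', [/\ (L <= l)%N, (l < l')%N &
    forall i, normc (dot (w i) (g l - g l')) <= e].
Proof.
move=> gM e0.
pose phi (c : I * bool) l : R :=
  if c.2 then complex.Re (dot (w c.1) (g l)) else complex.Im (dot (w c.1) (g l)).
pose B := (\sum_i nrm (w i)) * M.
have M0 : 0 <= M by apply: le_trans (gM 0%N); exact: dot_norm_ge0.
have hB c l : `|phi c l| <= B.
  apply: (@le_trans _ _ (normc (dot (w c.1) (g l)))).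
    by rewrite /phi; case: c.2; [exact: normc_Re|exact: normc_Im].
  apply: le_trans (ell2_dot_le _ _) _; apply: ler_pM; rewrite ?dot_norm_ge0//.
  by apply: (@sum_ge_term _ _ (fun i => nrm (w i))) => i; exact: dot_norm_ge0.
have [l [l' [Ll ll' h]]] := bounded_close_pair L hB (divr_gt0 e0 (ltr0n _ 2)).
exists l, l'; split=> // i; apply: le_trans (normc_le _) _; rewrite ell2_dotBr.
rewrite (splitr e); apply: lerD.
  by have := h (i, true); rewrite /phi raddfB.
by have := h (i, false); rewrite /phi raddfB.
Qed.

(** Greedy choice: the new pair is taken beyond all earlier indices and almost orthogonal to the
    earlier differences. *)
Lemma near_orthogonal_pairs (g : nat -> ell2) (M e : R) (N : nat) :
  (forall l, nrm (g l) <= M) -> 0 < e ->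
  exists q : nat -> nat * nat,
    (forall i, (i < N)%N -> ((q i).1 < (q i).2)%N) /\
    (forall i j, (i < j)%N -> (j < N)%N -> ((q i).2 < (q j).1)%N /\
      normc (dot (g (q i).1 - g (q i).2) (g (q j).1 - g (q j).2)) <= e).
Proof.
move=> gM e0; elim: N => [|N [q [q1 q2]]]; first by exists (fun=> (0, 0)%N).
pose w (i : 'I_N) := g (q i).1 - g (q i).2.
have [l [l' [Ll ll' h]]] := bounded_near_orthogonal w (\max_(i < N) (q i).2).+1 gM e0.
exists (fun i => if (i < N)%N then q i else (l, l')); split.
  move=> i; rewrite ltnS leq_eqVlt => /orP[/eqP ->|iN]; first by rewrite ltnn.
  by rewrite iN; exact: q1.
move=> i j ij; rewrite ltnS leq_eqVlt => /orP[/eqP jN|jN]; last first.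
  by rewrite jN (ltn_trans ij jN); exact: q2.
rewrite jN ltnn -jN ij; rewrite jN in ij; split; last exact: (h (Ordinal ij)).
by apply: leq_trans Ll; rewrite ltnS; exact: (leq_bigmax (Ordinal ij)).
Qed.

(** In the expansion of the square, the diagonal contributes at most A^2 and the other terms at most
    |I| e <= 3 A^2, in total (2A)^2. *)
Lemma near_orthogonal_bessel (I : finType) (v : I -> ell2) (A e : R) : 0 <= A ->
  0 <= e -> #|I|%:R * e <= 3 * A ^+ 2 ->
  (forall i, nrm (v i) <= A) -> (forall i j, i != j -> normc (dot (v i) (v j)) <= e) ->
  bessel (2 * A) v.
Proof.
move=> A0 e0 eA vA ve a; set S := \sum_i normc (a i) ^+ 2.
have S0 : 0 <= S by apply: sumr_ge0 => i _; exact: sqr_ge0.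
have -> : nrm (\sum_i a i *: v i) ^+ 2 =
    normc (dot (\sum_i a i *: v i) (\sum_i a i *: v i)).
  by rewrite ell2_dot_self_nrm normc_real ger0_norm// sqr_ge0.
rewrite ell2_dot_suml; apply: le_trans (normc_sum_le _) _.
apply: (@le_trans _ _ (\sum_i (normc (a i) ^+ 2 * A ^+ 2 +
    normc (a i) * (\sum_j normc (a j)) * e))).
  apply: ler_sum => i _; rewrite normcM ell2_dot_sumr expr2 -!mulrA -mulrDr.
  apply: ler_wpM2l; first exact: normc_ge0.
  apply: le_trans (normc_sum_le _) _; rewrite (bigD1 i)//= normcM normc_conj; apply: lerD.
    apply: ler_wpM2l; first exact: normc_ge0.
    rewrite ell2_dot_self_nrm normc_real ger0_norm ?sqr_ge0//.
    by rewrite ler_pXn2r ?nnegrE ?dot_norm_ge0.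
  rewrite mulr_suml [leRHS](bigD1 i)//=; apply: ler_wpDl.
    by rewrite mulr_ge0 ?normc_ge0.
  apply: ler_sum => j ji; rewrite normcM normc_conj ler_wpM2l ?normc_ge0//.
  by rewrite ve// eq_sym.
rewrite big_split /= -mulr_suml -/S -!mulr_suml.
have := sum_sqr_le_card (fun i => normc (a i)); rewrite -/S expr2 => h.
apply: le_trans (lerD (lexx _) (ler_wpM2r e0 h)) _.
have -> : #|I|%:R * S * e = (#|I|%:R * e) * S by ring.
apply: le_trans (lerD (lexx _) (ler_wpM2r S0 eA)) _.
by rewrite le_eqVlt; apply/orP; left; apply/eqP; ring.
Qed.

Lemma bessel_restrict (I : finType) (P : pred I) (b : R) (v : I -> ell2) : bessel b v ->
  bessel b (fun i => if P i then v i else 0).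
Proof.
move=> hv a; have -> : \sum_i a i *: (if P i then v i else 0) =
    \sum_i (if P i then a i else 0) *: v i.
  by apply: eq_bigr => i _; case: ifP; rewrite ?scaler0 ?scale0r.
apply: le_trans (hv _) _; rewrite ler_wpM2l ?sqr_ge0//; apply: ler_sum => i _.
by case: ifP => // _; rewrite normc0 expr0n sqr_ge0.
Qed.

Section TwoSided.
Variables (K : R) (N : mnorms ell2) (b : nat -> nat -> R).
Hypotheses (K1 : 1 <= K) (hN : rect_norm K N b).

(** For the lower bound [v] is paired with itself, divided by [be] to make the Bessel constant 1;
    before the division the pairing is the sum of the squared norms, at least m k al^2. *)
Lemma rect_two_sided m k (v : 'M[ell2]_k) (be al : R) : (0 < m)%N -> (m <= k)%N ->
  0 < be -> 0 <= al -> zero_below m v -> mbessel be v ->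
  (forall i j : 'I_k, (i < m)%N -> al <= nrm (v i j)) ->
  al ^+ 2 / (K * be) * b m k <= N v <= K * be * b m k.
Proof.
move=> m0 mk be0 al0 v0 hv vl; apply/andP; split; last first.
  exact: (rect_upper hN m0 mk (ltW be0) v0 hv).
have k0 : (0 < k)%N by exact: leq_trans mk.
have mk0 : 0 < m%:R * k%:R :> R by rewrite mulr_gt0// ltr0n.
have K0 : 0 < K by exact: lt_le_trans K1.
have b0 : 0 < b m k by exact: (rect_pos hN).
have nc : normc (be^-1)%:C%C = be^-1 by rewrite normc_real ger0_norm// invr_ge0 ltW.
have hw : mbessel 1 (map_mx (fun y => (be^-1)%:C%C *: y) v).
  by have := mbesselZ (be^-1)%:C%C hv; rewrite nc mulVf// gt_eqF.
have := rect_lower hN v m0 mk (zero_belowZ (be^-1)%:C%C v0) hw.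
rewrite pairingZr normcM normc_conj nc => h.
have pv : m%:R * k%:R * al ^+ 2 <= normc (pairing v v).
  have -> : pairing v v = (\sum_i \sum_j nrm (v i j) ^+ 2)%:C%C.
    rewrite /pairing rmorph_sum; apply: eq_bigr => i _; rewrite rmorph_sum.
    by apply: eq_bigr => j _; exact: ell2_dot_self_nrm.
  rewrite normc_real ger0_norm; last first.
    by apply: sumr_ge0 => i _; apply: sumr_ge0 => j _; exact: sqr_ge0.
  rewrite (bigID (fun i : 'I_k => (i < m)%N))/=; apply: ler_wpDr.
    by apply: sumr_ge0 => i _; apply: sumr_ge0 => j _; exact: sqr_ge0.
  rewrite -mulrA -[m in m%:R]card_ord -sumr_const mulr_suml.
  rewrite (big_ord_widen k (fun=> 1 * (k%:R * al ^+ 2)))//; apply: ler_sum => i im.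
  rewrite mul1r -[k in k%:R]card_ord -sumr_const mulr_suml; apply: ler_sum => j _.
  by rewrite mul1r ler_pXn2r ?nnegrE ?dot_norm_ge0// vl.
have := le_trans (ler_wpM2l (ltW (_ : 0 < be^-1)) pv) h.
rewrite invr_gt0 => /(_ be0) {}h.
have -> : al ^+ 2 / (K * be) * b m k =
    be^-1 * (m%:R * k%:R * al ^+ 2) * (b m k / (K * (m%:R * k%:R))).
  by field; rewrite !gt_eqF ?ltr0n.
rewrite -ler_pdivlMr ?divr_gt0 ?mulr_gt0 ?ltr0n//.
apply: le_trans h _; rewrite le_eqVlt; apply/orP; left; apply/eqP.
by field; rewrite !gt_eqF ?ltr0n.
Qed.

End TwoSided.
End Selection.

(** * Transfer of the order along an embedding *)

Section Comparison.
Variable R : realType.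
Local Notation C := R[i].
Local Notation ell2 := (ell2 R).
Local Notation nrm := (dot_norm (@ell2_dotp R)).
Local Notation dot := (@ell2_dot R).
Local Notation e_ := (ell2_basis R).

Lemma rect_single_le (K : R) (N : mnorms ell2) b u : rect_norm K N b ->
  N 1%N (const_mx u) <= K * nrm u * b 1%N 1%N.
Proof.
move=> hN; have := rect_le_sum hN (const_mx u : 'M[ell2]_1) (leqnn 1).
by rewrite -(pair_bigA _ (fun i j => nrm ((const_mx u : 'M[ell2]_1) i j))) /= !big_ord1 mxE.
Qed.

Lemma rect_single_ge (K : R) (N : mnorms ell2) b u : 1 <= K -> rect_norm K N b ->
  nrm u <= K * (1%:R * 1%:R / b 1%N 1%N) * N 1%N (const_mx u).
Proof.
move=> K1 hN; have := rect_entry K1 hN (const_mx u : 'M[ell2]_1) ord0 ord0 (leqnn 1).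
by rewrite mxE.
Qed.

Lemma nrm_basis_diff (s : R) a b : 0 <= s -> a != b ->
  s <= nrm (s%:C%C *: e_ a - s%:C%C *: e_ b) <= 2 * s.
Proof.
move=> s0 ab; have ns i : nrm (s%:C%C *: e_ i) = s.
  by rewrite dot_normZ nrm_basis mulr1 normc_real ger0_norm.
apply/andP; split.
  apply: le_trans (ell2_norm_ge_coord (s%:C%C *: e_ a - s%:C%C *: e_ b) a).
  rewrite -[_ a]/(s%:C%C * (e_ a : ell2) a - s%:C%C * (e_ b : ell2) a).
  by rewrite !ell2_basisE eqxx (negbTE ab) mulr0 subr0 mulr1 normc_real ler_norm.
apply: le_trans (dot_normD _ _ _) _.
by rewrite dot_normN !ns mulr_natl mulr2n.
Qed.

Lemma dot_basis_diff (s : R) a b c d : [/\ c != a, d != a, c != b & d != b] ->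
  dot (s%:C%C *: e_ a - s%:C%C *: e_ b) (s%:C%C *: e_ c - s%:C%C *: e_ d) = 0.
Proof.
move=> [ca da cb db]; rewrite -!scalerBr ell2_dotZ ell2_dotZr ell2_dotBr !ell2_dotB.
rewrite !ell2_dot_basis !ell2_basisE (negbTE ca) (negbTE da) (negbTE cb) (negbTE db).
by rewrite !subr0 !mulr0.
Qed.

(** The constant must not depend on [m] and [k], whereas the scale [s], the tolerance [ep] and the
    selected pairs depend on [k]. Both families of differences have norms and Bessel constants
    comparable to [s], which therefore cancels. *)
Lemma embedding_comparison (K : R) (X Y : mnorms ell2) bX bY (f : ell2 -> ell2) :
  1 <= K -> rect_norm K X bX -> rect_norm K Y bY ->
  completely_lipschitz_small_scale_embedding X Y f ->
  exists2 A : R, 0 < A & forall m k, (0 < m)%N -> (m <= k)%N ->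
    bY m k <= A * bX m k /\ bX m k <= A * bY m k.
Proof.
move=> K1 hX hY [L L1 hf].
have K0 : 0 < K by exact: lt_le_trans K1.
have L0 : 0 < L by exact: lt_le_trans L1.
have p0 : 0 < bX 1%N 1%N by exact: (rect_pos hX).
have r0 : 0 < bY 1%N 1%N by exact: (rect_pos hY).
pose aX := K * (1%:R * 1%:R / bX 1%N 1%N); pose aY := K * (1%:R * 1%:R / bY 1%N 1%N).
have aX0 : 0 < aX by rewrite mulr_gt0// divr_gt0// mulr1.
have aY0 : 0 < aY by rewrite mulr_gt0// divr_gt0// mulr1.
pose D := aY * L * (K * bX 1%N 1%N); pose d := (aX * L * (K * bY 1%N 1%N))^-1.
have D0 : 0 < D := mulr_gt0 (mulr_gt0 aY0 L0) (mulr_gt0 K0 p0).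
have d0 : 0 < d by rewrite invr_gt0; exact: mulr_gt0 (mulr_gt0 aX0 L0) (mulr_gt0 K0 r0).
(* On 1 x 1 matrices the hypothesis says that [f] is bi-Lipschitz for the Hilbert norm on a small
   ball. *)
have lip u u' : K * nrm u * bX 1%N 1%N <= 1 -> K * nrm u' * bX 1%N 1%N <= 1 ->
    d * nrm (u - u') <= nrm (f u - f u') <= D * nrm (u - u').
  move=> hu hu'.
  have := hf 1%N (const_mx u) (const_mx u') (le_trans (rect_single_le _ hX) hu)
    (le_trans (rect_single_le _ hX) hu').
  rewrite !map_const_mx.
  have cB (y z : ell2) : const_mx y - const_mx z = const_mx (y - z) :> 'M[ell2]_1.
    by apply/matrixP => i j; rewrite !mxE.
  rewrite !cB mulrC ler_pdivrMr// => /andP[lo up]; apply/andP; split.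
    rewrite /d mulrC ler_pdivrMr; last exact: mulr_gt0 (mulr_gt0 aX0 L0) (mulr_gt0 K0 r0).
    apply: le_trans (rect_single_ge _ K1 hX) _; rewrite -/aX.
    apply: le_trans (ler_wpM2l (ltW aX0) lo) _.
    apply: le_trans (ler_wpM2l (ltW aX0) (ler_wpM2r (ltW L0) (rect_single_le _ hY))) _.
    by rewrite le_eqVlt; apply/orP; left; apply/eqP; ring.
  apply: le_trans (rect_single_ge _ K1 hY) _; rewrite -/aY.
  apply: le_trans (ler_wpM2l (ltW aY0) up) _.
  apply: le_trans (ler_wpM2l (ltW aY0) (ler_wpM2l (ltW L0) (rect_single_le _ hX))) _.
  by rewrite le_eqVlt; apply/orP; left; apply/eqP; rewrite /D; ring.
clearbody D d.
(* The factor 16 is the product of the two fours in the Bessel constants, [4 * s] for the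
   differences of basis vectors and [4 * D * s] for those of their images. *)
pose E := 16 * L * K ^+ 2 * D.
have E0 : 0 < E by rewrite !mulr_gt0 ?exprn_gt0.
exists (E / d ^+ 2 + E); first by rewrite addr_gt0// divr_gt0// exprn_gt0.
move=> m k m0 mk; have k0 : (0 < k)%N by exact: leq_trans mk.
pose I : finType := ('I_k * 'I_k)%type.
have I0 : 0 < #|I|%:R :> R.
  by rewrite ltr0n card_prod card_ord muln_gt0 k0.
have bk0 : 0 < bX k k by exact: (rect_pos hX).
(* The scale: all matrices below lie in the unit ball. *)
pose s := Num.min (K * bX 1%N 1%N)^-1 (K * #|I|%:R * bX k k)^-1.
have s0 : 0 < s by rewrite lt_min !invr_gt0 !mulr_gt0.
have nse l : nrm (s%:C%C *: e_ l) = s.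
  by rewrite dot_normZ nrm_basis mulr1 normc_real ger0_norm// ltW.
have s1 : K * s * bX 1%N 1%N <= 1.
  rewrite mulrAC -ler_pdivlMl ?mulr_gt0// mulr1.
  by rewrite /s ge_min lexx.
have s2 : K * (#|I|%:R * s) * bX k k <= 1.
  have -> : K * (#|I|%:R * s) * bX k k = K * #|I|%:R * bX k k * s by ring.
  rewrite -ler_pdivlMl ?mulr_gt0// mulr1.
  by rewrite /s ge_min lexx orbT.
pose g l := f (s%:C%C *: e_ l).
have lipg l l' : d * nrm (s%:C%C *: e_ l - s%:C%C *: e_ l') <= nrm (g l - g l') <=
    D * nrm (s%:C%C *: e_ l - s%:C%C *: e_ l') by apply: lip; rewrite nse.
have gM l : nrm (g l) <= D * (2 * s) + nrm (g 0%N).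
  rewrite -[g l](subrK (g 0%N)); apply: le_trans (dot_normD _ _ _) _; rewrite lerD2r.
  have /andP[_ h] := lipg l 0%N; apply: le_trans h _; apply: ler_wpM2l; first exact: ltW.
  apply: le_trans (dot_normD _ _ _) _.
  by rewrite dot_normN !nse mulr_natl mulr2n.
pose A := D * (2 * s).
have A0 : 0 < A by rewrite !mulr_gt0.
pose ep := 3 * A ^+ 2 / #|I|%:R.
have ep0 : 0 < ep by rewrite divr_gt0// mulr_gt0// exprn_gt0.
have [q [q1 q2]] := near_orthogonal_pairs #|I| gM ep0.
pose idx (p : I) : nat := enum_rank p.
have idxN p : (idx p < #|I|)%N by exact: ltn_ord.
pose xv p := s%:C%C *: e_ (q (idx p)).1 - s%:C%C *: e_ (q (idx p)).2.
pose yv p := g (q (idx p)).1 - g (q (idx p)).2.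
have qn p : (q (idx p)).1 != (q (idx p)).2 by rewrite neq_ltn q1.
have xb p : s <= nrm (xv p) <= 2 * s by apply: nrm_basis_diff; [exact: ltW|exact: qn].
have yb p : d * s <= nrm (yv p) <= A.
  have /andP[h1 h2] := lipg (q (idx p)).1 (q (idx p)).2; have /andP[h3 h4] := xb p.
  apply/andP; split; [apply: le_trans h1|apply: le_trans h2 _]; apply: ler_wpM2l => //;
    exact: ltW.
(* Differences of basis vectors over disjoint pairs are exactly orthogonal, hence the tolerance
   0. *)
have besx : bessel (2 * (2 * s)) xv.
  apply: (@near_orthogonal_bessel _ _ _ _ 0) => //.
  - by rewrite mulr_ge0// ltW.
  - by rewrite mulr0 mulr_ge0// sqr_ge0.
  - by move=> p; have /andP[] := xb p.
  - move=> p p' pp'; rewrite dot_basis_diff ?normc0//.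
    have : (idx p != idx p')%N.
      by apply: contra pp' => /eqP/ord_inj/enum_rank_inj ->.
    rewrite neq_ltn => /orP[lt|lt]; have [h _] := q2 _ _ lt (idxN _);
      have h1 := q1 _ (idxN p); have h2 := q1 _ (idxN p').
      have h3 := ltn_trans h1 h; have h4 := ltn_trans h h2; have h5 := ltn_trans h3 h2.
      by split; rewrite neq_ltn ?h ?h3 ?h4 ?h5 orbT.
    have h3 := ltn_trans h2 h; have h4 := ltn_trans h h1; have h5 := ltn_trans h3 h1.
    by split; rewrite neq_ltn ?h ?h3 ?h4 ?h5.
have besy : bessel (2 * A) yv.
  apply: (@near_orthogonal_bessel _ _ _ _ ep).
  - exact: ltW.
  - exact: ltW.
  - by rewrite /ep mulrC divfK// gt_eqF.
  - by move=> p; have /andP[] := yb p.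
  - move=> p p' pp'.
    have : (idx p != idx p')%N.
      by apply: contra pp' => /eqP/ord_inj/enum_rank_inj ->.
    rewrite neq_ltn => /orP[lt|lt]; first exact: (q2 _ _ lt (idxN _)).2.
    by rewrite normc_dotC; exact: (q2 _ _ lt (idxN _)).2.
(* Two matrices in the unit ball; in the first [m] rows their difference has entries [xv], and the
   difference of their images under [f] has entries [yv]. *)
pose U : 'M[ell2]_k := \matrix_(i, j) (if (i < m)%N then s%:C%C *: e_ (q (idx (i, j))).1 else 0).
pose U' : 'M[ell2]_k := \matrix_(i, j) (if (i < m)%N then s%:C%C *: e_ (q (idx (i, j))).2 else 0).
have ball (W : 'M[ell2]_k) : (forall i j, nrm (W i j) <= s) -> X k W <= 1.
  move=> hW; apply: le_trans (rect_le_sum hX W k0) _; apply: le_trans s2.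
  apply: ler_wpM2r; first exact: ltW.
  apply: ler_wpM2l; first exact: ltW.
  rewrite -sumr_const mulr_suml.
  by apply: ler_sum => p _; rewrite mul1r.
have U1 : X k U <= 1.
  apply: ball => i j; rewrite mxE; case: ifP => _; first by rewrite nse.
  by rewrite dot_norm0 ltW.
have U'1 : X k U' <= 1.
  apply: ball => i j; rewrite mxE; case: ifP => _; first by rewrite nse.
  by rewrite dot_norm0 ltW.
have := hf k U U' U1 U'1; set V := U - U'; set W := map_mx f U - map_mx f U'.
have VE i j : V i j = if (i < m)%N then xv (i, j) else 0.
  by rewrite !mxE; case: ifP => // _; rewrite subrr.
(* In the remaining rows both matrices vanish, and [f 0] cancels. *)
have WE i j : W i j = if (i < m)%N then yv (i, j) else 0.
  by rewrite !mxE; case: ifP => // _; rewrite subrr.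
have V0 : zero_below m V by move=> i j mi; rewrite VE ltnNge mi.
have W0 : zero_below m W by move=> i j mi; rewrite WE ltnNge mi.
have Vb : mbessel (2 * (2 * s)) V.
  have := bessel_restrict (fun p : I => (p.1 < m)%N) besx; congr bessel.
  by apply/funext => -[i j]; rewrite VE.
have Wb : mbessel (2 * A) W.
  have := bessel_restrict (fun p : I => (p.1 < m)%N) besy; congr bessel.
  by apply/funext => -[i j]; rewrite WE.
have Vl (i j : 'I_k) : (i < m)%N -> s <= nrm (V i j).
  by move=> im; rewrite VE im; have /andP[] := xb (i, j).
have Wl (i j : 'I_k) : (i < m)%N -> d * s <= nrm (W i j).
  by move=> im; rewrite WE im; have /andP[] := yb (i, j).
have be0 : 0 < 2 * (2 * s) by rewrite !mulr_gt0.
have be'0 : 0 < 2 * A by rewrite mulr_gt0.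
have ds0 : 0 < d * s by rewrite mulr_gt0.
have /andP[X1 X2] := rect_two_sided K1 hX m0 mk be0 (ltW s0) V0 Vb Vl.
have /andP[Y1 Y2] := rect_two_sided K1 hY m0 mk be'0 (ltW ds0) W0 Wb Wl.
rewrite mulrC ler_pdivrMr// mulrC => /andP[lo up].
have bX0 : 0 < bX m k by exact: (rect_pos hX).
have bY0 : 0 < bY m k by exact: (rect_pos hY).
have nz : [/\ K != 0, s != 0, D != 0 & d != 0] by rewrite !gt_eqF.
have [nK ns nD nd] := nz.
split.
  apply: (@le_trans _ _ (E / d ^+ 2 * bX m k)); last first.
    by rewrite ler_wpM2r ?(ltW bX0)// lerDl ltW.
  have := le_trans Y1 (le_trans up (ler_wpM2l (ltW L0) X2)).
  rewrite -(ler_pdivlMl _ _ (divr_gt0 (exprn_gt0 2 ds0) (mulr_gt0 K0 be'0))).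
  move=> h; apply: le_trans h _; rewrite le_eqVlt; apply/orP; left; apply/eqP.
  by rewrite /E /A; field; rewrite nK ns nD nd.
apply: (@le_trans _ _ (E * bY m k)); last first.
  by rewrite ler_wpM2r ?(ltW bY0)// lerDr ltW// divr_gt0// exprn_gt0.
have := le_trans X1 (le_trans lo (ler_wpM2l (ltW L0) Y2)).
rewrite -(ler_pdivlMl _ _ (divr_gt0 (exprn_gt0 2 s0) (mulr_gt0 K0 be0))).
move=> h; apply: le_trans h _; rewrite le_eqVlt; apply/orP; left; apply/eqP.
by rewrite /E /A; field; rewrite nK ns.
Qed.

End Comparison.

(** * Exponents *)

Section Exponents.
Variable R : realType.

(** If c < a, an integer above A^(1/(a - c)) violates the inequality. *)
Lemma powR_exponent_le (a c A : R) : 0 < A ->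
  (forall n, (0 < n)%N -> n%:R `^ a <= A * n%:R `^ c) -> a <= c.
Proof.
move=> A0 h; rewrite leNgt; apply/negP => ca; have d0 : 0 < a - c by rewrite subr_gt0.
pose t := A `^ (a - c)^-1; have t0 : 0 <= t by exact: powR_ge0.
pose n := (Num.truncn t).+1.
have tn : t < n%:R by have /andP[] := truncn_itv t0.
have n0 : 0 < n%:R :> R by rewrite ltr0n.
have := h n isT; apply/negP; rewrite -ltNge -ltr_pdivlMr ?powR_gt0//.
have -> : n%:R `^ a / n%:R `^ c = n%:R `^ (a - c).
  by rewrite -powRN -powRD// (gt_eqF n0) implybT.
have -> : A = t `^ (a - c) by rewrite -powRrM mulVf ?gt_eqF// powRr1// ltW.
by apply: gt0_ltr_powR => //; rewrite nnegrE// ltW.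
Qed.

(* Evaluated at squares, on which the square roots are rational.              *)
Definition exponents (b : nat -> nat -> R) (r q : R) := forall n, (0 < n)%N ->
  b 1%N (n ^ 2)%N = n%:R `^ r /\ b (n ^ 2)%N (n ^ 2)%N = n%:R `^ q.

Lemma sqrt_nat_sqr n : Num.sqrt (n ^ 2)%N%:R = n%:R :> R.
Proof. by rewrite natrX sqrtr_sqr ger0_norm. Qed.

Lemma exponents_row_col theta : exponents
  (fun m k => (Num.sqrt k%:R) `^ (1 - theta) * (Num.sqrt m%:R) `^ theta) (1 - theta) 1.
Proof.
move=> n n0; rewrite sqrt_nat_sqr sqrtr1 powR1 mulr1; split=> //.
rewrite -powRD; first by rewrite subrK.
by rewrite (gt_eqF (_ : 0 < n%:R))// ?implybT// ltr0n.
Qed.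

Lemma exponents_min_max theta : exponents
  (fun m k => 1 `^ (1 - theta) * (Num.sqrt (m%:R * k%:R)) `^ theta) theta (2 * theta).
Proof.
move=> n n0; rewrite powR1 !mul1r sqrt_nat_sqr; split=> //.
by rewrite -expr2 sqrtr_sqr ger0_norm// natrX -powR_mulrn// -powRrM.
Qed.

Lemma six_spaces_exponents (theta : R) (X : mnorms (ell2 R)) : 0 <= theta <= 1 ->
  [\/ X = interp (row_space R) (col_space R) theta,
      X = interp (min_space R) (max_space R) theta |
      X = interp (cap_space R) (plus_space R) theta] ->
  exists b r q, [/\ rect_norm (expR 1) X b, exponents b r q &
    (r = 1 - theta /\ q = 1) \/ (r = theta /\ q = 2 * theta)].
Proof.
move=> /andP[t0 t1] [->|->|->].
- eexists; exists (1 - theta), 1; split; last by left.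
    exact: (rect_interp (rect_row R) (rect_col R) t0 t1).
  exact: exponents_row_col.
- eexists; exists theta, (2 * theta); split; last by right.
    exact: (rect_interp (rect_min R) (rect_max R) t0 t1).
  exact: exponents_min_max.
- eexists; exists (1 - theta), 1; split; last by left.
    exact: (rect_interp (rect_cap R) (rect_plus R) t0 t1).
  exact: exponents_row_col.
Qed.

End Exponents.

Theorem corollary1p8 (R : realType) (theta gamma : R)
    (htheta : 0 <= theta <= 1) (hgamma : 0 <= gamma <= 1)
    (X Y : mnorms (ell2 R))
    (hX : [\/ X = interp (row_space R) (col_space R) theta,
              X = interp (min_space R) (max_space R) theta |
              X = interp (cap_space R) (plus_space R) theta])
    (hY : [\/ Y = interp (row_space R) (col_space R) gamma,
              Y = interp (min_space R) (max_space R) gamma |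
              Y = interp (cap_space R) (plus_space R) gamma])
    (f : ell2 R -> ell2 R)
    (hf : completely_lipschitz_small_scale_embedding X Y f) :
  theta = gamma.
Proof.
have [bX [r [q [rX eX oX]]]] := six_spaces_exponents htheta hX.
have [bY [r' [q' [rY eY oY]]]] := six_spaces_exponents hgamma hY.
have e1 : 1 <= expR 1 :> R by rewrite -[leLHS]expR0 ler_expR.
have [A A0 hA] := embedding_comparison e1 rX rY hf.
have n2 n : (0 < n -> 0 < n ^ 2)%N by rewrite expn_gt0 => ->.
(* The comparison holds in both directions: size (1, n^2) equates the first exponents, and size
   (n^2, n^2) the second ones. *)
have rr' : r = r'.
  apply: le_anti; apply/andP; split; apply: (powR_exponent_le A0) => n n0;
    have [<- _] := eX n n0; have [<- _] := eY n n0;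
    by have [] := hA 1%N (n ^ 2)%N isT (n2 n n0).
have qq' : q = q'.
  apply: le_anti; apply/andP; split; apply: (powR_exponent_le A0) => n n0;
    have [_ <-] := eX n n0; have [_ <-] := eY n n0;
    by have [] := hA (n ^ 2)%N (n ^ 2)%N (n2 n n0) (leqnn _).
(* Within a kind the first exponents decide. Across kinds the second exponents make one parameter
   1/2, and the first ones, which then read 1 - theta = gamma or theta = 1 - gamma, make the other
   1/2 too. *)
move: rr' qq'; case: oX => -[-> ->]; case: oY => -[-> ->]; clear; lra.
Qed.
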